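(* Let $X$ be a $2$-convex Banach sequence lattice and $J$ an index set with $\Lambda_T\subset J$. Then there is a constant $C\ge1$ depending only on $X$ such that for all $m,n$ $$C^{-1}\Big(\frac m{n+m}\Big)^{\frac{m-1}{2m}}\le K_m(B_{X_n},J)\le C\Big(\frac m{n+m}\Big)^{\frac{m-1}{2m}},$$ and moreover, with a constant $C\ge1$ depending only on $X$, for all $n\ge2$, $$C^{-1}\sqrt{\frac{\log n}{n}}\le K(B_{X_n},J)\le C\sqrt{\frac{\log n}{n}}.$$
   Context: $X$ is a Banach space of complex sequences with the ideal property, $2$-convex: $\|(\sum_k|x_k|^2)^{1/2}\|_X\le M(\sum_k\|x_k\|^2)^{1/2}$ for all finite families. $X_n$ is $\mathbb{C}^n$ with $\|z\|=\|\sum_{k\le n}|z_k|e_k\|_X$, $B_{X_n}$ its open unit ball. $\Lambda_T$ is the set of finitely supported multi-indices with entries in $\{0,1\}$; an index set is a subset of $\mathbb{N}_0^{(\mathbb{N})}$, and $J(m)=\{\alpha\in J:|\alpha|=m\}$. For an index set $I$, the Bohr radius $K(B_{X_n},I)$ is the supremum of $r\in(0,1)$ with $\sup_{z\in rB_{X_n}}\sum_{\alpha\in I}|c_\alpha(f)z^\alpha|\le\sup_{B_{X_n}}|f|$ for all bounded holomorphic $f$ on $B_{X_n}$ whose Taylor coefficients $c_\alpha(f)=\partial^\alpha f(0)/\alpha!$ vanish outside $I$; $K_m(B_{X_n},J):=K(B_{X_n},J(m))$. *)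

(* Defs.v *)
From HB Require Import structures.
From mathcomp Require Import all_boot all_order all_algebra.
From mathcomp Require Import complex.
From mathcomp Require Import all_classical all_reals all_analysis.
Unset Printing Implicit Defensive.
Import Order.TTheory GRing.Theory Num.Theory.
Import numFieldNormedType.Exports.
Local Open Scope classical_set_scope.
Local Open Scope ring_scope.

Definition cabs {R : rcfType} (z : R[i]) : R := Normc.normc z.

Section BohrDefs.
Variable R : realType.
Local Notation C := (R[i]).

(* C^n, as row vectors with the (max-)normed-module structure over C;
   the topology is the usual one on C^n. *)
Definition Cn (n : nat) : normedModType C := 'rV[C]_n.

(* X is given by its underlying set Xs of sequences nat -> C together  *)
(* with its norm Xn (a function on all sequences; only its values on   *)
(* Xs matter).                                                         *)

Definition seq_unit (k : nat) : nat -> C := fun j => if j == k then 1 else 0.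

Definition banach_seq_lattice (Xs : set (nat -> C)) (Xn : (nat -> C) -> R) : Prop :=
  [/\
    [/\ Xs (fun=> 0),
        (forall x y, Xs x -> Xs y -> Xs (fun k => x k + y k)) &
        (forall (a : C) x, Xs x -> Xs (fun k => a * x k))],
    [/\ (forall x, Xs x -> 0 <= Xn x),
        (forall x, Xs x -> Xn x = 0 -> x = fun=> 0),
        (forall (a : C) x, Xs x -> Xn (fun k => a * x k) = cabs a * Xn x) &
        (forall x y, Xs x -> Xs y -> Xn (fun k => x k + y k) <= Xn x + Xn y)],
    (forall u : nat -> (nat -> C), (forall j, Xs (u j)) ->
       (forall e : R, 0 < e -> exists N, forall i j, (N <= i)%N -> (N <= j)%N ->
          Xn (fun k => u i k - u j k) < e) ->
       exists x, Xs x /\ (forall e : R, 0 < e -> exists N, forall j, (N <= j)%N ->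
          Xn (fun k => u j k - x k) < e)),
    (forall x y, Xs y -> (forall k, cabs (x k) <= cabs (y k)) ->
       Xs x /\ Xn x <= Xn y) &
    (* X contains the unit sequences e_k (needed for X_n to be defined) *)
    (forall k, Xs (seq_unit k))].

Definition two_convex (Xs : set (nat -> C)) (Xn : (nat -> C) -> R) : Prop :=
  exists M : R, forall (N : nat) (x : 'I_N -> (nat -> C)), (forall j, Xs (x j)) ->
    Xn (fun k => ((Num.sqrt (\sum_(j < N) cabs (x j k) ^+ 2))%:C)%C)
      <= M * Num.sqrt (\sum_(j < N) Xn (x j) ^+ 2).

Definition Xn_norm (Xn : (nat -> C) -> R) (n : nat) (z : Cn n) : R :=
  Xn (fun j => \sum_(k < n) ((cabs (z 0 k))%:C)%C * seq_unit k j).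

Definition Xball (Xn : (nat -> C) -> R) (n : nat) (r : R) : set (Cn n) :=
  [set z | Xn_norm Xn n z < r].

(* Multi-indices: elements of N_0^(N) are finitely supported nat -> nat. *)
Definition mindex := nat -> nat.

Definition supp_le (n : nat) (a : mindex) : Prop := forall k, (n <= k)%N -> a k = 0%N.

Definition fin_supp (a : mindex) : Prop := exists N, supp_le N a.

Definition index_set (J : set mindex) : Prop := forall a, J a -> fin_supp a.

Definition LambdaT : set mindex := [set a | fin_supp a /\ forall k, (a k <= 1)%N].

Definition mdeg_is (a : mindex) (m : nat) : Prop :=
  exists N, supp_le N a /\ (\sum_(k < N) a k)%N = m.

Definition homog_part (J : set mindex) (m : nat) : set mindex :=
  [set a | J a /\ mdeg_is a m].

(* Holomorphy = complex (C-linear, Frechet) differentiability.         *)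

Definition pderiv (n : nat) (k : 'I_n) (g : Cn n -> C^o) : Cn n -> C^o :=
  fun z => 'D_(delta_mx 0 k : Cn n) g z.

Definition dmulti (n : nat) (a : mindex) (g : Cn n -> C^o) : Cn n -> C^o :=
  foldr (fun (k : 'I_n) h => iter (a k) (pderiv n k) h) g (enum 'I_n).

Definition mfact (n : nat) (a : mindex) : nat := (\prod_(k < n) (a k)`!)%N.

(* Taylor coefficient c_a(f) = d^a f(0) / a! (for a supported in {0..n-1}) *)
Definition taylor_coef (n : nat) (a : mindex) (f : Cn n -> C^o) : C :=
  dmulti n a f 0 / (mfact n a)%:R.

Definition monom (n : nat) (z : Cn n) (a : mindex) : C :=
  \prod_(k < n) z 0 k ^+ a k.

Definition holomorphic_on (n : nat) (U : set (Cn n)) (f : Cn n -> C^o) : Prop :=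
  forall z : Cn n, U z -> differentiable f z.

Definition bounded_on (n : nat) (U : set (Cn n)) (f : Cn n -> C^o) : Prop :=
  exists b : R, forall z, U z -> cabs (f z) <= b.

Definition bohr_radius (Xn : (nat -> C) -> R) (n : nat) (I : set mindex) : R :=
  sup [set r : R | (0 < r < 1) /\
    forall f : Cn n -> C^o,
      holomorphic_on n (Xball Xn n 1) f -> bounded_on n (Xball Xn n 1) f ->
      (forall a, supp_le n a -> ~ I a -> taylor_coef n a f = 0) ->
      (ereal_sup [set (\esum_(a in [set a | I a /\ supp_le n a])
                         (cabs (taylor_coef n a f * monom n z a))%:E)%E
                 | z in Xball Xn n r]
       <= ereal_sup [set (cabs (f z))%:E | z in Xball Xn n 1])%E].

Definition bohr_radius_m (Xn : (nat -> C) -> R) (n : nat) (J : set mindex) (m : nat) : R :=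
  bohr_radius Xn n (homog_part J m).

End BohrDefs.

Arguments seq_unit {R}.
Arguments banach_seq_lattice {R}.
Arguments two_convex {R}.
Arguments Cn {R}.
Arguments Xn_norm {R}.
Arguments Xball {R}.
Arguments pderiv {R}.
Arguments dmulti {R}.
Arguments taylor_coef {R}.
Arguments monom {R}.
Arguments holomorphic_on {R}.
Arguments bounded_on {R}.
Arguments bohr_radius {R}.
Arguments bohr_radius_m {R}.

(* Main.v *)
(* Lower bounds.  On the ball of X_n the degree-m part of f satisfies
   |f_m| <= sup |f|, and |f_m| <= 2 (sup |f| - |f(0)|) for m >= 1.  For an
   m-homogeneous polynomial P = sum_a c_a z^a the Sidon-type estimate
   sum_a |c_a| <= C^m ((n+m)/m)^((m-1)/2) sup_{T^n} |P| follows by summing the Euler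
   derivatives z_k d_k P over k: by Cauchy's estimate their moduli add up to at
   most 2^m sup |P|, on m-homogeneous polynomials the L2 norm on the torus is at
   most C^m times the L1 norm, and Cauchy-Schwarz brings in the number of
   monomials containing z_k.  Applied to w |-> P(w z), with z in the ball, it
   gives both lower bounds; this half does not need 2-convexity.

   Upper bounds.  2-convexity yields weights p with ||p|| <= max(M, 1) such that
   the unit ball lies in the ellipsoid sum_k |z_k|^2 / p_k^2 <= 6 n.  Split the
   variables z_k / p_k into m blocks of length n %/ m and take an m-linear form
   with random signs; for a good choice of signs it is at most
   C^m sqrt (n / m) on products of l2 balls, which bounds its supremum on the
   ball of X_n, while all (n %/ m)^m coefficients are unimodular and tetrahedral.
   Evaluating at a multiple of p bounds the radius for each m; m = trunc_log 2 n
   gives the bound for K(B_{X_n}, J).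

   The Cauchy formula needed to pass from complex differentiability to Taylor
   coefficients is obtained without integrals: circle integrals are replaced by
   means over the 2^d-th roots of unity. *)

Require Import Defs.
From HB Require Import structures.
From mathcomp Require Import all_boot all_order all_algebra.
From mathcomp Require Import complex.
From mathcomp Require Import all_classical all_reals all_analysis.
From mathcomp Require Import ring lra zify.
Set Implicit Arguments.
Unset Strict Implicit.
Unset Printing Implicit Defensive.
Import Order.TTheory GRing.Theory Num.Theory.
Import numFieldNormedType.Exports.
Local Open Scope classical_set_scope.
Local Open Scope ring_scope.

(** * Absolute values and roots of unity *)

(** A degree-m estimate may lose a factor C^m, since the radius is its m-th root; hence the crude
    constants throughout. Summing over all degrees is more delicate: bounding each |f_m| by sup |f|
    leaves no room beside |f(0)|, whereas the gap sup |f| - |f(0)| leaves exactly the room that a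
    geometric series fills. The logarithm comes from the exponent: with x = m / (n + m),
    x^((m-1)/(2m)) is sqrt x times x^(-1/(2m)). The second factor is bounded as soon as m is of
    order log n, and sqrt x is then of order sqrt (log n / n). The random form is tetrahedral, so
    its monomials lie in every J that contains [LambdaT], while the Sidon-type estimate holds for
    all monomials of degree m at once; this is why one constant serves all J. The roots of unity
    have order 2^d because the bisection in Goursat's argument then keeps the nodes: a square at
    level d + 1 is four squares at level d, with exact cancellation on the inner sides. *)

Section Cabs.
Context {R : realType}.
Local Notation C := (R[i]).
Implicit Types (x y z : C) (r : R).

Lemma normC_cabs z : `|z| = (cabs z)%:C%C.
Proof. by []. Qed.

Lemma cabs_ge0 z : 0 <= cabs z.
Proof. by rewrite -ler0c -normC_cabs. Qed.

Lemma cabs0 : cabs (0 : C) = 0. Proof. exact: Normc.normc0. Qed.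
Lemma cabs1 : cabs (1 : C) = 1. Proof. exact: Normc.normc1. Qed.

Lemma cabs_eq0 z : (cabs z == 0) = (z == 0).
Proof. by apply/eqP/eqP => [|->]; [exact: Normc.eq0_normc | exact: cabs0]. Qed.

Lemma cabs_gt0 z : (0 < cabs z) = (z != 0).
Proof. by rewrite lt0r cabs_eq0 cabs_ge0 andbT. Qed.

Lemma cabsM x y : cabs (x * y) = cabs x * cabs y.
Proof. exact: Normc.normcM. Qed.

Lemma cabsV x : cabs x^-1 = (cabs x)^-1.
Proof. exact: Normc.normcV. Qed.

Lemma cabsX x n : cabs (x ^+ n) = cabs x ^+ n.
Proof. by elim: n => [|n IH]; rewrite ?expr0 ?cabs1 // !exprS cabsM IH. Qed.

Lemma cabsD x y : cabs (x + y) <= cabs x + cabs y.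
Proof. exact: le_normcD. Qed.

Lemma cabsN x : cabs (- x) = cabs x.
Proof. exact: normcN. Qed.

Lemma cabsB x y : cabs (x - y) <= cabs x + cabs y.
Proof. by rewrite -(cabsN y) cabsD. Qed.

Lemma cabs_real r : cabs (r%:C%C) = `|r|.
Proof. by rewrite /cabs /= expr0n addr0 sqrtr_sqr. Qed.

Lemma cabs_nat n : cabs (n%:R : C) = n%:R.
Proof. by have := cabs_real n%:R; rewrite rmorph_nat ger0_norm. Qed.

Lemma cabs_sum (I : Type) (s : seq I) (P : pred I) (F : I -> C) :
  cabs (\sum_(i <- s | P i) F i) <= \sum_(i <- s | P i) cabs (F i).
Proof.
elim/big_rec2: _ => [|i y x _ h]; first by rewrite cabs0.
by rewrite (le_trans (cabsD _ _))// lerD2l.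
Qed.

Lemma cabs_prod (I : Type) (s : seq I) (P : pred I) (F : I -> C) :
  cabs (\prod_(i <- s | P i) F i) = \prod_(i <- s | P i) cabs (F i).
Proof.
elim/big_rec2: _ => [|i y x _ h]; first by rewrite cabs1.
by rewrite cabsM h.
Qed.

Lemma cabs_sqr z : cabs z ^+ 2 = complex.Re z ^+ 2 + complex.Im z ^+ 2.
Proof. by case: z => a b; rewrite /cabs /= sqr_sqrtr // addr_ge0 ?sqr_ge0. Qed.

Lemma normRe_le z : `|complex.Re z| <= cabs z.
Proof.
rewrite -(@ler_pXn2r _ 2) ?nnegrE ?normr_ge0 ?cabs_ge0//.
by rewrite cabs_sqr real_normK ?num_real// lerDl sqr_ge0.
Qed.

Lemma normIm_le z : `|complex.Im z| <= cabs z.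
Proof.
rewrite -(@ler_pXn2r _ 2) ?nnegrE ?normr_ge0 ?cabs_ge0//.
by rewrite cabs_sqr real_normK ?num_real// lerDr sqr_ge0.
Qed.

Lemma Re_le_cabs z : complex.Re z <= cabs z.
Proof. exact: le_trans (ler_norm _) (normRe_le z). Qed.

Lemma cabs_le_ReIm z : cabs z <= `|complex.Re z| + `|complex.Im z|.
Proof.
rewrite -(@ler_pXn2r _ 2) ?nnegrE ?addr_ge0 ?cabs_ge0//.
rewrite cabs_sqr sqrrD !real_normK ?num_real// lerD2r lerDl.
by rewrite mulrn_wge0 ?mulr_ge0.
Qed.

Lemma cabs_conj z : cabs (z^*)%C = cabs z.
Proof. by case: z => a b; rewrite /cabs /= sqrrN. Qed.

Lemma conj_mul_cabs z : z * (z^*)%C = (cabs z ^+ 2)%:C%C.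
Proof. by rewrite -sqr_normc normC_cabs -rmorphXn. Qed.

Lemma cabs_lt_norm z r : (`|z| < r%:C%C) = (cabs z < r).
Proof. by rewrite normC_cabs ltcR. Qed.

Lemma gt0C_ex (e : C) : 0 < e -> exists2 r : R, 0 < r & e = r%:C%C.
Proof.
move=> e0; exists (complex.Re e); first by move: e0; rewrite ltcE /= => /andP[].
move: e0; rewrite ltcE => /andP[/eqP /= h _]; rewrite [LHS]complexE h.
by rewrite rmorph0 mulr0 addr0.
Qed.

Lemma Re_realM r z : complex.Re (r%:C%C * z) = r * complex.Re z.
Proof. by case: z => a b /=; rewrite mul0r subr0. Qed.

Lemma Re_sum (I : Type) (s : seq I) (P : pred I) (F : I -> C) :
  complex.Re (\sum_(i <- s | P i) F i) = \sum_(i <- s | P i) complex.Re (F i).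
Proof. exact: (big_morph (@complex.Re R) (fun x y : C => raddfD (@complex.Re R : Rcomplex R -> R) x y) erefl). Qed.

End Cabs.

(** * Means over roots of unity *)

Section UnitCircle.
Context {R : realType}.
Local Notation C := (R[i]).

Definition cis (t : R) : C := ((cos (2 * pi * t)) +i* (sin (2 * pi * t)))%C.

Lemma cisD s t : cis (s + t) = cis s * cis t.
Proof.
by rewrite /cis mulrDr cosD sinD; apply/eqP; rewrite eq_complex /= eqxx /= addrC.
Qed.

Lemma cis0 : cis 0 = 1.
Proof. by rewrite /cis mulr0 cos0 sin0. Qed.

Lemma cis1 : cis 1 = 1.
Proof. by rewrite /cis mulr1 mulrC mulr_natr cos2pi sin2pi. Qed.

Lemma cis_half : cis (2^-1) = -1.
Proof.
rewrite /cis (_ : 2 * pi * 2^-1 = pi) ?cospi ?sinpi; last by field.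
by apply/eqP; rewrite eq_complex /= oppr0 !eqxx.
Qed.

Lemma cabs_cis t : cabs (cis t) = 1.
Proof. by rewrite /cabs /= cos2Dsin2 sqrtr1. Qed.

Lemma cisX t n : cis t ^+ n = cis (n%:R * t).
Proof.
elim: n => [|n IH]; first by rewrite mul0r cis0 expr0.
by rewrite exprS IH -cisD -natr1 mulrDl mul1r addrC.
Qed.

Lemma lip_of_derive (f df : R -> R) (a b : R) :
  (forall x : R, is_derive x 1 f (df x)) -> (forall x : R, `|df x| <= 1) ->
  `|f a - f b| <= `|a - b|.
Proof.
move=> fd dle; wlog ab : a b / b <= a => [H|].
  have [/H //|/ltW /H] := leP b a.
  by rewrite distrC (distrC b).
have [|c _ ->] := @MVT_segment _ f df b a ab (fun x _ => fd x).
  apply: continuous_subspaceT => x; apply/differentiable_continuous.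
  by apply/derivable1_diffP; case: (fd x).
by rewrite normrM ler_piMl.
Qed.

Lemma cis_lip s t : cabs (cis s - cis t) <= 4 * pi * `|s - t|.
Proof.
have h (a b : R) : cabs (((cos a) +i* (sin a))%C - ((cos b) +i* (sin b))%C) <= 2 * `|a - b|.
  rewrite (le_trans (cabs_le_ReIm _))//= mulr_natl mulr2n; apply: lerD.
    apply: (@lip_of_derive cos (fun x => - sin x)) => x.
    by rewrite normrN ler_norml sin_geN1 sin_le1.
  apply: (@lip_of_derive sin cos) => x.
  by rewrite ler_norml cos_geN1 cos_le1.
rewrite (le_trans (h _ _))// -mulrBr normrM ger0_norm ?mulr_ge0 ?pi_ge0//.
by rewrite !mulrA -natrM.
Qed.

Definition uroot (l : nat) : C := cis ((2 ^ l)%:R^-1).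

Lemma uroot_neq0 l : uroot l != 0.
Proof. by rewrite -cabs_gt0 cabs_cis ltr01. Qed.

Lemma cabs_uroot l : cabs (uroot l) = 1. Proof. exact: cabs_cis. Qed.

(** The order divides 2^l. A proper divisor would divide 2^(l-1), but [uroot l] to that power is
    -1. *)
Lemma uroot_prim l : (2 ^ l)%N.-primitive_root (uroot l).
Proof.
have Lgt0 : (0 < 2 ^ l)%N by rewrite expn_gt0.
have e : uroot l ^+ (2 ^ l) = 1.
  by rewrite cisX divff ?cis1// pnatr_eq0 -lt0n.
have [m pm mL] := prim_order_exists Lgt0 e.
have /(dvdn_pfactor _ _ (isT : prime 2)) [a al Em] := mL.
move: al; rewrite leq_eqVlt => /predU1P[al|al].
  by rewrite -{1}al -Em.
have l0 : (0 < l)%N by apply: leq_ltn_trans al.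
have : (m %| 2 ^ l.-1)%N.
  by rewrite Em dvdn_exp2l // -ltnS prednK.
rewrite (prim_order_dvd pm) cisX.
rewrite (_ : _ * _ = 2^-1); last first.
  have -> : ((2 ^ l)%:R : R) = 2 * (2 ^ l.-1)%:R by rewrite -natrM -expnS prednK.
  by field; rewrite pnatr_eq0 -lt0n expn_gt0.
rewrite cis_half => /eqP /(congr1 (@complex.Re R)) /=; lra.
Qed.

Definition cmean (l : nat) (F : C -> C) : C :=
  (\sum_(k < 2 ^ l) F (uroot l ^+ k)) / (2 ^ l)%:R.

Lemma Lneq0 l : ((2 ^ l)%:R : C) != 0.
Proof. by rewrite pnatr_eq0 -lt0n expn_gt0. Qed.

Lemma eq_cmean l (F G : C -> C) : (forall z, cabs z = 1 -> F z = G z) ->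
  cmean l F = cmean l G.
Proof.
move=> h; congr (_ / _); apply: eq_bigr => k _.
by rewrite h// cabsX cabs_uroot expr1n.
Qed.

Lemma cmeanD l (F G : C -> C) : cmean l (fun z => F z + G z) = cmean l F + cmean l G.
Proof. by rewrite /cmean big_split mulrDl. Qed.

Lemma cmeanZ l a (F : C -> C) : cmean l (fun z => a * F z) = a * cmean l F.
Proof. by rewrite /cmean -mulr_sumr mulrA. Qed.

Lemma cmeanB l (F G : C -> C) : cmean l (fun z => F z - G z) = cmean l F - cmean l G.
Proof.
rewrite -[- cmean l G]mulN1r -cmeanZ -cmeanD; apply: eq_cmean => z _.
by rewrite mulN1r.
Qed.

Lemma cmean_sum l (I : Type) (s : seq I) (P : pred I) (F : I -> C -> C) :
  cmean l (fun z => \sum_(i <- s | P i) F i z) = \sum_(i <- s | P i) cmean l (F i).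
Proof. by rewrite /cmean exchange_big /= mulr_suml. Qed.

Lemma cmean_cst l a : cmean l (fun=> a) = a.
Proof.
by rewrite /cmean sumr_const card_ord -(mulr_natr a) mulfK// Lneq0.
Qed.

Lemma cabs_cmean l (F : C -> C) (b : R) : (forall z, cabs z = 1 -> cabs (F z) <= b) ->
  cabs (cmean l F) <= b.
Proof.
move=> h; rewrite cabsM cabsV cabs_nat ler_pdivrMr ?ltr0n ?expn_gt0//.
rewrite (le_trans (cabs_sum _ _ _))//.
apply: (@le_trans _ _ (\sum_(k < 2 ^ l) b)).
  by apply: ler_sum => k _; rewrite h// cabsX cabs_uroot expr1n.
by rewrite sumr_const card_ord mulr_natr.
Qed.

Lemma cmean_expn l (j : nat) :
  cmean l (fun z => z ^+ j) = ((2 ^ l %| j)%N)%:R.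
Proof.
rewrite /cmean.
have E k : (uroot l ^+ k) ^+ j = (uroot l ^+ j) ^+ k by rewrite -!exprM mulnC.
under eq_bigr do rewrite E.
case: (boolP (_ %| _)%N) => [|]; rewrite (prim_order_dvd (uroot_prim l)).
  move=> /eqP ->; under eq_bigr do rewrite expr1n.
  by rewrite sumr_const card_ord divff// Lneq0.
move=> h; apply/eqP; rewrite mulf_eq0; apply/orP; left.
rewrite -subr_eq0 in h; rewrite -(mulrI_eq0 _ (mulfI h)) -subrX1 exprAC.
by rewrite (prim_expr_order (uroot_prim l)) expr1n subrr.
Qed.

End UnitCircle.

(** * Cauchy's formula on a disc *)

Section LinearApprox.
Context {R : realType}.
Local Notation C := (R[i]).

Lemma derivable_approx (V : normedModType C) (f : V -> C^o) (a v : V) :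
  derivable f a v -> forall e : R, 0 < e -> exists2 d : R, 0 < d &
  forall t : C, cabs t < d ->
    cabs (f (t *: v + a) - f a - 'D_v f a * t) <= e * cabs t.
Proof.
move=> df e e0.
have /cvgrPdist_le /(_ e%:C%C) := df.
rewrite ltcR => /(_ e0).
rewrite /dnbhs near_withinE => /nbhs_ballP[d /= /gt0C_ex[d' d'0 ->] H].
exists d' => // t td.
have [->|t0] := eqVneq t 0.
  by rewrite scale0r add0r subrr mulr0 subrr cabs0 mulr0.
have := H t; rewrite /ball /= sub0r normrN cabs_lt_norm => /(_ td t0).
rewrite -/('D_v f a) normC_cabs lecR => h.
have -> : f (t *: v + a) - f a - 'D_v f a * t =
   - ('D_v f a - t^-1 *: (f (t *: v + a) - f a)) * t.
  rewrite /GRing.scale /= mulNr mulrBl [t^-1 * _]mulrC -mulrA mulVf// mulr1.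
  by rewrite opprB.
by rewrite mulNr cabsN cabsM ler_wpM2r ?cabs_ge0.
Qed.

Lemma derive_approx (V : normedModType C) (f : V -> C^o) (a v : V) (D : C) :
  (forall e : R, 0 < e -> exists2 d : R, 0 < d &
  forall t : C, cabs t < d ->
    cabs (f (t *: v + a) - f a - D * t) <= e * cabs t) ->
  'D_v f a = D.
Proof.
move=> H; apply: cvg_lim => //; apply/cvgrPdist_le => e /gt0C_ex[e' e'0 ->].
have [d d0 Hd] := H _ e'0.
rewrite /dnbhs near_withinE; apply/nbhs_ballP; exists d%:C%C => /=; first by rewrite ltcR.
move=> t; rewrite /ball /= sub0r normrN cabs_lt_norm => td t0.
have {}Hd := Hd t td.
rewrite normC_cabs lecR -(ler_pM2r (_ : 0 < cabs t)) ?cabs_gt0// (le_trans _ Hd)//.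
rewrite -cabsM -cabsN le_eqVlt; apply/orP; left; apply/eqP; congr cabs.
rewrite /GRing.scale /= mulrBl [t^-1 * _]mulrC -mulrA mulVf// mulr1.
by rewrite opprB.
Qed.

End LinearApprox.

(** * Goursat's theorem for the image of the unit square under a Lipschitz map *)

Section Goursat.
Context {R : realType}.
Local Notation C := (R[i]).
Variables (h : C^o -> C^o) (g : R -> R -> C) (K : R).
Hypothesis K1 : 1 <= K.
Hypothesis g_lip : forall s t s' t', 0 <= s <= 1 -> 0 <= t <= 1 ->
  0 <= s' <= 1 -> 0 <= t' <= 1 ->
  cabs (g s t - g s' t') <= K * (`|s - s'| + `|t - t'|).
Hypothesis h_der : forall s t, 0 <= s <= 1 -> 0 <= t <= 1 -> derivable h (g s t) 1.

(* Trapezoid sums of f along the images under g of horizontal and vertical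
   segments.  Goursat's theorem is proved for them because trapezoid sums along a
   circle are means over roots of unity (circle_trap). *)
Definition trap (f : C -> C) (a b : C) : C := (f a + f b) / 2 * (b - a).

Definition hside (f : C -> C) (d : nat) (x y w : R) : C :=
  \sum_(0 <= k < 2 ^ d)
    trap f (g (x + k%:R * w / (2 ^ d)%:R) y) (g (x + k.+1%:R * w / (2 ^ d)%:R) y).

Definition vside (f : C -> C) (d : nat) (x y w : R) : C :=
  \sum_(0 <= k < 2 ^ d)
    trap f (g x (y + k%:R * w / (2 ^ d)%:R)) (g x (y + k.+1%:R * w / (2 ^ d)%:R)).

Definition boundary (f : C -> C) d x y w : C :=
  hside f d x y w + vside f d (x + w) y w - hside f d x (y + w) w - vside f d x y w.

Lemma pow2_neq0 d : ((2 ^ d)%:R : R) != 0.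
Proof. by rewrite pnatr_eq0 -lt0n expn_gt0. Qed.

Lemma hside_split f d x y w :
  hside f d.+1 x y w = hside f d x y (w / 2) + hside f d (x + w / 2) y (w / 2).
Proof.
have E z : z * w / (2 ^ d.+1)%:R = z * (w / 2) / (2 ^ d)%:R.
  by rewrite expnS natrM; field; rewrite pow2_neq0.
rewrite /hside expnS mul2n -addnn.
rewrite (big_cat_nat (n := (2 ^ d)%N)) //= ?leq_addr//; congr (_ + _).
  by apply: eq_bigr => k _; rewrite addnn -mul2n -expnS !E.
rewrite -{1}[(2 ^ d)%N]add0n big_addn addnK; apply: eq_bigr => k _.
rewrite addnn -mul2n -expnS !E -addSn !natrD.
have e z : x + (z + (2 ^ d)%:R) * (w / 2) / (2 ^ d)%:R = x + w / 2 + z * (w / 2) / (2 ^ d)%:R.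
  by field; rewrite pow2_neq0.
by rewrite !e.
Qed.

Lemma vside_split f d x y w :
  vside f d.+1 x y w = vside f d x y (w / 2) + vside f d x (y + w / 2) (w / 2).
Proof.
have E z : z * w / (2 ^ d.+1)%:R = z * (w / 2) / (2 ^ d)%:R.
  by rewrite expnS natrM; field; rewrite pow2_neq0.
rewrite /vside expnS mul2n -addnn.
rewrite (big_cat_nat (n := (2 ^ d)%N)) //= ?leq_addr//; congr (_ + _).
  by apply: eq_bigr => k _; rewrite addnn -mul2n -expnS !E.
rewrite -{1}[(2 ^ d)%N]add0n big_addn addnK; apply: eq_bigr => k _.
rewrite addnn -mul2n -expnS !E -addSn !natrD.
have e z : y + (z + (2 ^ d)%:R) * (w / 2) / (2 ^ d)%:R = y + w / 2 + z * (w / 2) / (2 ^ d)%:R.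
  by field; rewrite pow2_neq0.
by rewrite !e.
Qed.

(** The level drops together with the side, so the small squares use the nodes of the large one and
    the sums over the inner sides cancel exactly, not only in the limit. *)
Lemma boundary_split f d x y w :
  boundary f d.+1 x y w =
    boundary f d x y (w / 2) + boundary f d (x + w / 2) y (w / 2) +
    boundary f d x (y + w / 2) (w / 2) + boundary f d (x + w / 2) (y + w / 2) (w / 2).
Proof.
rewrite /boundary !hside_split !vside_split.
have e z : z + w / 2 + w / 2 = z + w by field.
rewrite !e; ring.
Qed.

(** The trapezoid rule is exact on affine functions: each term is an increment of the antiderivative
    A u + B u^2 / 2, and the sums telescope around the closed curve. *)
Lemma boundary_affine (f : C -> C) (A B : C) d x y w : (forall u, f u = A + B * u) ->
  boundary f d x y w = 0.
Proof.
move=> fE; pose G u := A * u + B * u ^+ 2 / 2.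
have tE a b : trap f a b = G b - G a by rewrite /trap !fE /G; field.
have -> : 0 = (G (g (x + w) y) - G (g x y)) + (G (g (x + w) (y + w)) - G (g (x + w) y))
  - (G (g (x + w) (y + w)) - G (g x (y + w))) - (G (g x (y + w)) - G (g x y)) by ring.
have e z : z + (2 ^ d)%:R * w / (2 ^ d)%:R = z + w by field; rewrite pow2_neq0.
rewrite /boundary; congr (_ + _ - _ - _).
all: rewrite /hside /vside; under eq_bigr do rewrite tE.
1,3: by rewrite (telescope_sumr (fun k => G (g (x + k%:R * w / (2 ^ d)%:R) _)))// e mul0r mul0r addr0.
all: by rewrite (telescope_sumr (fun k => G (g _ (y + k%:R * w / (2 ^ d)%:R))))// e mul0r mul0r addr0.
Qed.

Lemma boundaryD (f1 f2 : C -> C) d x y w :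
  boundary (fun u => f1 u + f2 u) d x y w = boundary f1 d x y w + boundary f2 d x y w.
Proof.
have tD a b : trap (fun u => f1 u + f2 u) a b = trap f1 a b + trap f2 a b.
  by rewrite /trap; ring.
have hD x' y' w' : hside (fun u => f1 u + f2 u) d x' y' w' = hside f1 d x' y' w' + hside f2 d x' y' w'.
  by rewrite /hside -big_split; apply: eq_bigr => k _; rewrite tD.
have vD x' y' w' : vside (fun u => f1 u + f2 u) d x' y' w' = vside f1 d x' y' w' + vside f2 d x' y' w'.
  by rewrite /vside -big_split; apply: eq_bigr => k _; rewrite tD.
by rewrite /boundary !hD !vD; ring.
Qed.

Lemma trap_le (f : C -> C) a b (m : R) : cabs (f a) <= m -> cabs (f b) <= m ->
  cabs (trap f a b) <= m * cabs (b - a).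
Proof.
move=> ha hb; rewrite cabsM ler_wpM2r ?cabs_ge0// cabsM cabsV cabs_nat.
rewrite ler_pdivrMr// (le_trans (cabsD _ _))//; lra.
Qed.

Lemma cabs_sum_le_nat N (F : nat -> C) (m : R) : (forall k, (k < N)%N -> cabs (F k) <= m) ->
  cabs (\sum_(0 <= k < N) F k) <= N%:R * m.
Proof.
move=> H; rewrite (le_trans (cabs_sum _ _ _))//.
rewrite mulr_natl -[N in X in _ <= X]subn0 -sumr_const_nat.
by rewrite big_nat_cond [leRHS]big_nat_cond; apply: ler_sum => k /andP[/andP[_ kN] _]; apply: H.
Qed.

Lemma param_in (x w : R) d k : 0 <= x -> 0 <= w -> (k <= 2 ^ d)%N ->
  x <= x + k%:R * w / (2 ^ d)%:R <= x + w.
Proof.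
move=> x0 w0 kd; rewrite lerDl divr_ge0 ?mulr_ge0//= lerD2l ler_pdivrMr ?ltr0n ?expn_gt0//.
by rewrite mulrC ler_wpM2l// ler_nat.
Qed.

(** Each side consists of 2^d chords of length at most K w / 2^d, so the bound is uniform in d. *)
Lemma boundary_le (f : C -> C) (m : R) d x y w : 0 <= x -> 0 <= y -> 0 <= w ->
  x + w <= 1 -> y + w <= 1 ->
  (forall s t, x <= s <= x + w -> y <= t <= y + w -> cabs (f (g s t)) <= m) ->
  cabs (boundary f d x y w) <= 4 * (m * (K * w)).
Proof.
move=> x0 y0 w0 xw yw H.
have m0 : 0 <= m by apply: le_trans (cabs_ge0 _) (H x y _ _); rewrite lexx lerDl.
have K0 : 0 <= K by apply: le_trans K1.
have P0 : (0 < (2 ^ d)%:R :> R) by rewrite ltr0n expn_gt0.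
have stepE z k : z + k.+1%:R * w / (2 ^ d)%:R - (z + k%:R * w / (2 ^ d)%:R) = w / (2 ^ d)%:R.
  by rewrite -natr1; field; rewrite pow2_neq0.
have wE : m * (K * w) = (2 ^ d)%:R * (m * (K * (w / (2 ^ d)%:R))) by field; rewrite pow2_neq0.
have hb y' : y <= y' <= y + w -> cabs (hside f d x y' w) <= m * (K * w).
  move=> /andP[y1 y2]; rewrite wE; apply: cabs_sum_le_nat => k kd.
  have /andP[a1 a2] := @param_in x w d k x0 w0 (ltnW kd).
  have /andP[b1 b2] := @param_in x w d k.+1 x0 w0 kd.
  have := @trap_le f (g (x + k%:R * w / (2 ^ d)%:R) y') (g (x + k.+1%:R * w / (2 ^ d)%:R) y') m.
  move=> /(_ _ _)/le_trans; apply.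
  - by apply: H; rewrite ?a1 ?a2 ?y1.
  - by apply: H; rewrite ?b1 ?b2 ?y1.
  rewrite ler_wpM2l//; apply: le_trans (g_lip _ _ _ _) _.
  1-4: apply/andP; split; lra.
  by rewrite stepE subrr normr0 addr0 ger0_norm// divr_ge0// ltW.
have vb x' : x <= x' <= x + w -> cabs (vside f d x' y w) <= m * (K * w).
  move=> /andP[x1 x2]; rewrite wE; apply: cabs_sum_le_nat => k kd.
  have /andP[a1 a2] := @param_in y w d k y0 w0 (ltnW kd).
  have /andP[b1 b2] := @param_in y w d k.+1 y0 w0 kd.
  have := @trap_le f (g x' (y + k%:R * w / (2 ^ d)%:R)) (g x' (y + k.+1%:R * w / (2 ^ d)%:R)) m.
  move=> /(_ _ _)/le_trans; apply.
  - by apply: H; rewrite ?a1 ?a2 ?x1.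
  - by apply: H; rewrite ?b1 ?b2 ?x1.
  rewrite ler_wpM2l//; apply: le_trans (g_lip _ _ _ _) _.
  1-4: apply/andP; split; lra.
  by rewrite stepE subrr normr0 add0r ger0_norm// divr_ge0// ltW.
have I1 z : z <= z <= z + w by rewrite lexx lerDl.
have I2 z : z <= z + w <= z + w by rewrite lexx lerDl w0.
rewrite /boundary (le_trans (cabsB _ _))//.
have := hb _ (I1 y); have := hb _ (I2 y); have := vb _ (I1 x); have := vb _ (I2 x).
have := cabsB (hside f d x y w + vside f d (x + w) y w) (hside f d x (y + w) w).
have := cabsD (hside f d x y w) (vside f d (x + w) y w).
lra.
Qed.

(** A tolerance proportional to the area is the one that is inherited from the four quarters. *)
Let small (e x y w : R) := exists d0, forall d, (d0 <= d)%N ->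
  cabs (boundary h d x y w) <= e * w ^+ 2.

Lemma small_local (e x y : R) : 0 < e -> 0 <= x <= 1 -> 0 <= y <= 1 ->
  exists2 r : R, 0 < r & forall x' y' w, 0 <= x' -> 0 <= y' -> 0 <= w -> w < r ->
   x' + w <= 1 -> y' + w <= 1 -> x' <= x <= x' + w -> y' <= y <= y' + w -> small e x' y' w.
Proof.
move=> e0 xI yI; have K0 : 0 < K by apply: lt_le_trans K1.
set p := g x y.
(* On the square |u - p| is at most 2 K w and the perimeter contributes 4 K w, whence the factor 8
   K^2. *)
have e'0 : 0 < e / (8 * K ^+ 2) by rewrite divr_gt0// mulr_gt0// exprn_gt0.
have [r r0 Hr] := derivable_approx (h_der xI yI) e'0.
exists (r / (2 * K)); first by rewrite divr_gt0// mulr_gt0.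
move=> x' y' w x0 y0 w0 wr xw yw /andP[x1 x2] /andP[y1 y2]; exists 0%N => d _.
pose D := 'D_1 h p.
(* Only the remainder of the first-order expansion at p counts, because the affine part has boundary
   sum 0. *)
have -> : boundary h d x' y' w = boundary (fun u => h u - h p - D * (u - p)) d x' y' w.
  rewrite -[RHS]addr0 -[X in _ = _ + X](@boundary_affine (fun u => (h p - D * p) + D * u) (h p - D * p) D d x' y' w)//.
  by rewrite -boundaryD; congr boundary; apply/funext => u; ring.
apply: le_trans (boundary_le (m := e / (8 * K ^+ 2) * (K * (2 * w))) _ _ _ _ _ _ _) _ => //.
  move=> s t /andP[s1 s2] /andP[t1 t2].
  have dist : cabs (g s t - p) <= K * (2 * w).
    apply: le_trans (g_lip _ _ _ _) _ => //.
    1-2: apply/andP; split; lra.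
    have h1 : `|s - x| <= w by rewrite ler_norml; apply/andP; split; lra.
    have h2 : `|t - y| <= w by rewrite ler_norml; apply/andP; split; lra.
    by apply: ler_wpM2l; [exact: ltW | lra].
  have lt : cabs (g s t - p) < r.
    apply: le_lt_trans dist _.
    by move: wr; rewrite ltr_pdivlMr ?mulr_gt0//; apply: le_lt_trans; rewrite mulrA mulrC (mulrC K).
  have := Hr _ lt; rewrite /GRing.scale /= mulr1 subrK => /le_trans; apply.
  by rewrite ler_wpM2l// ltW.
rewrite le_eqVlt; apply/orP; left; apply/eqP; field.
by rewrite gt_eqF.
Qed.

Lemma small_split (e x y w : R) : small e x y (w / 2) -> small e (x + w / 2) y (w / 2) ->
  small e x (y + w / 2) (w / 2) -> small e (x + w / 2) (y + w / 2) (w / 2) -> small e x y w.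
Proof.
move=> [d1 H1] [d2 H2] [d3 H3] [d4 H4]; exists (d1 + d2 + d3 + d4).+1 => -[//|d] dd.
rewrite boundary_split.
have {}H1 := H1 d ltac:(lia); have {}H2 := H2 d ltac:(lia).
have {}H3 := H3 d ltac:(lia); have {}H4 := H4 d ltac:(lia).
have e4 : e * (w / 2) ^+ 2 = e * w ^+ 2 / 4 by field.
rewrite !e4 in H1 H2 H3 H4.
set b1 := boundary _ _ _ _ _ in H1 *; set b2 := boundary _ _ _ _ _ in H2 *.
set b3 := boundary _ _ _ _ _ in H3 *; set b4 := boundary _ _ _ _ _ in H4 *.
have := cabsD (b1 + b2 + b3) b4; have := cabsD (b1 + b2) b3; have := cabsD b1 b2.
lra.
Qed.

Lemma goursat (e : R) : 0 < e -> exists d0, forall d, (d0 <= d)%N ->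
  cabs (boundary h d 0 0 1) <= e.
Proof.
move=> e0; suff : small e 0 0 1 by rewrite /small expr1n mulr1.
apply: contrapT => nS.
pose ok (q : R * R * R) := [/\ 0 <= q.1.1 /\ 0 <= q.1.2, 0 < q.2, q.1.1 + q.2 <= 1,
   q.1.2 + q.2 <= 1 & ~ small e q.1.1 q.1.2 q.2].
(* Bisection of a bad square into a bad quarter. The existential stands before the hypothesis
   [ok q], so that [choice] yields a total successor function. *)
have step (q : R * R * R) : exists q' : R * R * R, ok q ->
   [/\ ok q', q'.2 = q.2 / 2, q.1.1 <= q'.1.1 <= q.1.1 + q.2 / 2 & q.1.2 <= q'.1.2 <= q.1.2 + q.2 / 2].
  case: (pselect (ok q)) => [okq|nok]; last by exists q.
  case: q okq => [[x y] w] [/= [x0 y0] w0 xw yw nQ].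
  have [S1|S1] := pselect (small e x y (w / 2)); last first.
    exists (x, y, w / 2) => _; split => //=; last 2 first.
    1-2: by apply/andP; split; lra.
    by split => //=; first [split; lra | lra].
  have [S2|S2] := pselect (small e (x + w / 2) y (w / 2)); last first.
    exists (x + w / 2, y, w / 2) => _; split => //=; last 2 first.
    1-2: by apply/andP; split; lra.
    by split => //=; first [split; lra | lra].
  have [S3|S3] := pselect (small e x (y + w / 2) (w / 2)); last first.
    exists (x, y + w / 2, w / 2) => _; split => //=; last 2 first.
    1-2: by apply/andP; split; lra.
    by split => //=; first [split; lra | lra].
  have [S4|S4] := pselect (small e (x + w / 2) (y + w / 2) (w / 2)); last first.
    exists (x + w / 2, y + w / 2, w / 2) => _; split => //=; last 2 first.
    1-2: by apply/andP; split; lra.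
    by split => //=; first [split; lra | lra].
  by case: nQ; apply: small_split.
have /choice[nxt Hn] := step.
pose q n := iter n nxt (0, 0, 1).
have okq n : ok (q n).
  elim: n => [|n IH]; last by have [] := Hn (q n) IH.
  by split => //=; rewrite ?add0r.
have qw n : (q n).2 = (2 ^ n)%:R^-1.
  elim: n => [|n IH]; first by rewrite invr1.
  have [_ + _ _] := Hn (q n) (okq n); rewrite -/(q n.+1) => ->.
  by rewrite IH expnSr natrM invfM.
have mono n k : (q n).1.1 <= (q (n + k)%N).1.1 /\ (q (n + k)%N).1.1 + (q (n + k)%N).2 <= (q n).1.1 + (q n).2
  /\ (q n).1.2 <= (q (n + k)%N).1.2 /\ (q (n + k)%N).1.2 + (q (n + k)%N).2 <= (q n).1.2 + (q n).2.
  elim: k => [|k [I1 [I2 [I3 I4]]]]; first by rewrite addn0 !lexx.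
  have [_ + /andP[+ +] /andP[+ +]] := Hn (q (n + k)%N) (okq _).
  by rewrite -/(q (n + k).+1) addnS => -> *; repeat split; lra.
have cross n k : (q n).1.1 <= (q k).1.1 + (q k).2 /\ (q n).1.2 <= (q k).1.2 + (q k).2.
  have [_ w0 _ _ _] := okq n; have [_ w1 _ _ _] := okq k.
  case: (leqP n k) => nk.
    by have := mono n (k - n)%N; rewrite subnKC// => -[? [? [? ?]]]; split; lra.
  by have := mono k (n - k)%N; rewrite subnKC ?(ltnW nk)// => -[? [? [? ?]]]; split; lra.
(* The point common to all nested squares; [small_local] at this point contradicts the badness of a
   late square. *)
pose X := sup (range (fun n => (q n).1.1)); pose Y := sup (range (fun n => (q n).1.2)).
have XI n : (q n).1.1 <= X <= (q n).1.1 + (q n).2.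
  apply/andP; split.
    apply: ub_le_sup; last by exists n.
    by exists ((q 0%N).1.1 + (q 0%N).2) => _ [k _ <-]; case: (cross k 0%N).
  apply: ge_sup; first by exists (q 0%N).1.1, 0%N.
  by move=> _ [k _ <-]; case: (cross k n).
have YI n : (q n).1.2 <= Y <= (q n).1.2 + (q n).2.
  apply/andP; split.
    apply: ub_le_sup; last by exists n.
    by exists ((q 0%N).1.2 + (q 0%N).2) => _ [k _ <-]; case: (cross k 0%N).
  apply: ge_sup; first by exists (q 0%N).1.2, 0%N.
  by move=> _ [k _ <-]; case: (cross k n).
have X01 : 0 <= X <= 1 by have := XI 0%N; rewrite /= add0r.
have Y01 : 0 <= Y <= 1 by have := YI 0%N; rewrite /= add0r.
have [r r0 Hr] := small_local e0 X01 Y01.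
have [n nr] : exists n, (2 ^ n)%:R^-1 < r.
  exists (Num.bound r^-1).
  have := upper_nthrootP (leqnn (Num.bound r^-1)).
  by rewrite -natrX -[X in _ -> _ < X]invrK ltf_pV2// posrE ?ltr0n ?expn_gt0// invr_gt0.
have [[x0 y0] w0 xw yw []] := okq n.
by apply: Hr => //; rewrite ?(ltW w0)// qw.
Qed.

End Goursat.

(** * From trapezoid sums to means over a circle *)

Section CircleMeans.
Context {R : realType}.
Local Notation C := (R[i]).

Definition ctends (u : nat -> C) (l : C) :=
  forall e : R, 0 < e -> exists N, forall n, (N <= n)%N -> cabs (u n - l) <= e.

(** A cyclic shift, allowed since w^(2^d) = 1, gathers the two half-weights at each node into (w -
    w^-1) / 2. With the factor 2^d this is a discrete form of 2 pi i, the ratio of the contour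
    integral to the mean. *)
Lemma circle_trap (phi : C -> C) (z : C) d :
  \sum_(0 <= k < 2 ^ d) trap phi (z * cis (k%:R / (2 ^ d)%:R)) (z * cis (k.+1%:R / (2 ^ d)%:R))
  = (uroot d - (uroot d)^-1) / 2 * (2 ^ d)%:R * cmean d (fun w => phi (z * w) * (z * w)).
Proof.
have Ec k : cis (k%:R / (2 ^ d)%:R) = (uroot d : C) ^+ k by rewrite cisX.
pose w : C := uroot d; pose F k := phi (z * w ^+ k) * (z * w ^+ k).
have w0 : w != 0 := uroot_neq0 d.
have tE k : trap phi (z * cis (k%:R / (2 ^ d)%:R)) (z * cis (k.+1%:R / (2 ^ d)%:R))
   = (w - 1) / 2 * F k + (1 - w^-1) / 2 * F k.+1.
  rewrite /trap !Ec -/w /F exprS.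
  move: (phi (z * w ^+ k)) (phi (z * (w * w ^+ k))) (w ^+ k) => p1 p2 u; move: (w) w0 => v v0 {F}.
  by field.
under eq_bigr do rewrite tE.
rewrite big_split -!mulr_sumr /=.
have -> : \sum_(0 <= k < 2 ^ d) F k.+1 = \sum_(0 <= k < 2 ^ d) F k.
  apply/eqP; rewrite -subr_eq0 -sumrB telescope_sumr// /F.
  by rewrite (prim_expr_order (uroot_prim d)) expr0 subrr.
rewrite big_mkord -mulrDl /cmean.
rewrite -[in RHS]mulrA [(2 ^ d)%:R * _]mulrC divfK ?Lneq0//.
by congr (_ * _); rewrite -mulrDl; congr (_ / _); rewrite -/w; ring.
Qed.

Lemma cabs_exprB1 (x : C) n : cabs x = 1 -> cabs (x ^+ n - 1) <= n%:R * cabs (x - 1).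
Proof.
move=> x1; rewrite subrX1 cabsM mulrC ler_wpM2r ?cabs_ge0//.
rewrite (le_trans (cabs_sum _ _ _))//.
under eq_bigr do rewrite cabsX x1 expr1n.
by rewrite sumr_const card_ord.
Qed.

(** A lower bound for the discrete 2 pi i is enough to pass from small trapezoid sums to small
    means. It holds because the power 2^(d-2) of w^2 is -1, so 2 <= 2^(d-2) |w^2 - 1|. *)
Lemma uroot_factor_ge d : (2 <= d)%N ->
  1 <= cabs ((uroot d - (uroot d)^-1) / 2 * (2 ^ d)%:R : C).
Proof.
case: d => [|[|d]]// _.
have w0 : (uroot d.+2 : C) != 0 := uroot_neq0 _.
have -> : uroot d.+2 - (uroot d.+2)^-1 = (uroot d.+2)^-1 * (uroot d.+2 ^+ 2 - 1) :> C.
  by field; exact: w0.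
rewrite !cabsM !cabsV cabs_uroot invr1 mul1r !cabs_nat.
have := @cabs_exprB1 (uroot d.+2 ^+ 2) (2 ^ d)%N.
rewrite cabsX cabs_uroot expr1n => /(_ erefl).
rewrite -exprM -expnS cisX.
rewrite (_ : _ / _ = 2^-1); last first.
  by rewrite [in X in _ / X]expnS natrM; field; rewrite pnatr_eq0 -lt0n expn_gt0.
rewrite cis_half -opprD cabsN (_ : 1 + 1 = 2%:R) // cabs_nat !expnS !natrM.
set u := cabs _; set v := _%:R; have : 0 <= u := cabs_ge0 _; nra.
Qed.

Lemma derivable_div (f : C^o -> C^o) (p a : C^o) : derivable f p 1 -> p != a ->
  derivable (fun u => (f u - f a) / (u - a)) p 1.
Proof.
move=> df pa.
have d1 : derivable (f - cst (f a)) p 1.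
  by apply: derivableB; [exact: df | exact: derivable_cst].
have d2 : derivable (id - cst a) p 1.
  by apply: derivableB; [exact: derivable_id | exact: derivable_cst].
have d3 : derivable (fun y : C^o => ((id - cst a) y)^-1 : C^o) p 1.
  by apply: (@derivableV C C^o); [rewrite subr_eq0 | exact: d2].
exact: (@derivableM C C^o _ _ _ _ d1 d3).
Qed.

(* Goursat on the homotopy retracting the circle to a small circle around a. *)
Lemma circle_mean_diff (g : C^o -> C^o) (r : R) (a : C) :
  (forall z, cabs z <= r -> derivable g z 1) -> cabs a < r ->
  ctends (fun d => cmean d (fun w => (g (r%:C%C * w) - g a) / (r%:C%C * w - a) * (r%:C%C * w))) 0.
Proof.
move=> dg ar e e0.
have r0 : 0 < r by apply: le_lt_trans (cabs_ge0 _) ar.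
pose h : C^o -> C^o := fun u => (g u - g a) / (u - a).
have [d1 d10 Hd1] := derivable_approx (dg a (ltW ar)) ltr01.
set D := 'D_1 g a in Hd1; set m := cabs D + 1.
have m1 : 1 <= m by rewrite lerDr cabs_ge0.
have m0 : 0 < m by apply: lt_le_trans m1.
have P0 : 0 < 4 * pi :> R by rewrite mulr_gt0// pi_gt0.
(* The scale of the inner curve: the second term places it where the difference quotient is bounded
   by m, the third makes its trapezoid sum at most e / 2. Being positive, it keeps the homotopy off
   a. *)
pose del := Num.min (1 / 2) (Num.min (d1 / (4 * r)) (e / 2 / (m * (4 * pi * r)))).
have del0 : 0 < del.
  by rewrite !lt_min !divr_gt0//= !mulr_gt0// ?pi_gt0.
have del1 : del <= 1 / 2 by rewrite /del ge_min lexx.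
have deld : del * (2 * r) < d1.
  have : del <= d1 / (4 * r) by rewrite /del !ge_min lexx orbT.
  rewrite ler_pdivlMr ?mulr_gt0//; nra.
have dele : m * (del * (4 * pi * r)) <= e / 2.
  have : del <= e / 2 / (m * (4 * pi * r)) by rewrite /del !ge_min lexx !orbT.
  rewrite ler_pdivlMr; first by rewrite mulrCA mulrA.
  by rewrite !mulr_gt0// pi_gt0.
pose lam s : R := del + s * (1 - del).
pose G s t : C := a + (lam s)%:C%C * (r%:C%C * cis t - a).
have lam01 s : 0 <= s <= 1 -> del <= lam s <= 1.
  by move=> /andP[s0 s1]; rewrite /lam; apply/andP; split; nra.
have cr t : cabs (r%:C%C * cis t - a) <= 2 * r.
  rewrite (le_trans (cabsB _ _))// cabsM cabs_cis cabs_real gtr0_norm//; lra.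
pose K := 1 + 2 * r + 4 * pi * r.
have GE s t s' t' : G s t - G s' t' = ((s - s') * (1 - del))%:C%C * (r%:C%C * cis t - a)
    + (lam s')%:C%C * r%:C%C * (cis t - cis t').
  rewrite /G /lam !rmorphD !rmorphM /= !rmorphB /= rmorph1; ring.
have Glip s t s' t' : 0 <= s <= 1 -> 0 <= t <= 1 -> 0 <= s' <= 1 -> 0 <= t' <= 1 ->
    cabs (G s t - G s' t') <= K * (`|s - s'| + `|t - t'|).
  move=> _ _ /lam01/andP[l1 l2] _; rewrite GE (le_trans (cabsD _ _))//.
  have A : cabs (((s - s') * (1 - del))%:C%C * (r%:C%C * cis t - a)) <= `|s - s'| * (2 * r).
    rewrite cabsM cabs_real normrM ler_pM ?mulr_ge0 ?cabs_ge0// ler_piMr// ger0_norm; lra.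
  have B : cabs ((lam s')%:C%C * r%:C%C * (cis t - cis t')) <= r * (4 * pi * `|t - t'|).
    rewrite -mulrA cabsM cabs_real cabsM cabs_real (gtr0_norm r0) ger0_norm; last lra.
    rewrite -[leRHS]mul1r ler_pM ?mulr_ge0 ?cabs_ge0//; [lra | lra |].
    by apply: ler_wpM2l; [exact: ltW | exact: cis_lip].
  apply: (le_trans (lerD A B)); rewrite /K.
  have : 0 <= `|s - s'| by []. have : 0 <= `|t - t'| by [].
  have P1 : 0 < 4 * pi * r by rewrite mulr_gt0.
  nra.
have K1 : 1 <= K by have : 0 < 4 * pi * r; [rewrite mulr_gt0 | rewrite /K; lra].
have GE' s t : G s t - a = (lam s)%:C%C * (r%:C%C * cis t - a) by rewrite /G addrC addKr.
have Gr s t : 0 <= s <= 1 -> cabs (G s t) <= r.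
  move=> /lam01/andP[l1 l2]; have -> : G s t = (1 - lam s)%:C%C * a + (lam s)%:C%C * (r%:C%C * cis t).
    by rewrite /G rmorphB rmorph1; ring.
  rewrite (le_trans (cabsD _ _))// !cabsM !cabs_real cabs_cis (gtr0_norm r0) !ger0_norm; try lra.
  nra.
have Ga s t : 0 <= s <= 1 -> G s t != a.
  move=> /lam01/andP[l1 l2]; rewrite -subr_eq0 GE' mulf_eq0 negb_or; apply/andP; split.
    by rewrite -cabs_gt0 cabs_real ger0_norm; lra.
  rewrite subr_eq0; apply/negP => /eqP E; move: ar; rewrite -E cabsM cabs_cis mulr1 cabs_real.
  by rewrite gtr0_norm// ltxx.
have hder s t : 0 <= s <= 1 -> 0 <= t <= 1 -> derivable h (G s t) 1.
  by move=> sI tI; apply: derivable_div; [apply: dg; exact: Gr | exact: Ga].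
have [d0 Hd0] := goursat K1 Glip hder (divr_gt0 e0 (ltr0n _ 2)).
exists (maxn d0 2) => d; rewrite geq_max => /andP[/Hd0 Hb d2].
have I01 : 0 <= (0 : R) <= 1 by rewrite lexx ler01.
have I11 : 0 <= (1 : R) <= 1 by rewrite lexx ler01.
(* The sides t = 0 and t = 1 have the same image and cancel, so only the outer circle and the inner
   curve remain. *)
have hsE : hside G h d 0 (0 + 1) 1 = hside G h d 0 0 1.
  by apply: eq_bigr => k _; rewrite /G (add0r 1) cis0 cis1.
have hbd t : cabs (h (G 0 t)) <= m.
  have Gt : cabs (G 0 t - a) < d1.
    rewrite GE' /lam mul0r addr0 cabsM cabs_real gtr0_norm//.
    by apply: le_lt_trans deld; rewrite ler_wpM2l// ltW.
  have := Hd1 _ Gt; rewrite mul1r /GRing.scale /= mulr1 subrK => H.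
  have g0 : 0 < cabs (G 0 t - a) by rewrite cabs_gt0 subr_eq0 Ga.
  rewrite cabsM cabsV ler_pdivrMr// /m mulrDl mul1r -cabsM.
  have := cabsD (g (G 0 t) - g a - D * (G 0 t - a)) (D * (G 0 t - a)).
  rewrite subrK; lra.
have v0 : cabs (vside G h d 0 0 1) <= e / 2.
  apply: le_trans dele.
  have -> : m * (del * (4 * pi * r)) = (2 ^ d)%:R * (m * (del * (4 * pi * r) / (2 ^ d)%:R)).
    by field; rewrite pnatr_eq0 -lt0n expn_gt0.
  apply: cabs_sum_le_nat => k _.
  rewrite (le_trans (trap_le (hbd _) (hbd _)))// ler_wpM2l ?(ltW m0)//.
  rewrite GE subrr mul0r rmorph0 mul0r add0r /lam mul0r addr0 -mulrA !cabsM !cabs_real.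
  rewrite (gtr0_norm r0) (gtr0_norm del0) -!mulrA ler_wpM2l ?(ltW del0)//.
  apply: (le_trans (ler_wpM2l (ltW r0) (cis_lip _ _))).
  rewrite !add0r !mul1r -mulrBl -(natr1 k) [k%:R + 1]addrC addrK mul1r.
  by rewrite gtr0_norm ?invr_gt0 ?ltr0n ?expn_gt0// le_eqVlt; apply/orP; left; apply/eqP; ring.
have v1 : vside G h d (0 + 1) 0 1 = (uroot d - (uroot d)^-1) / 2 * (2 ^ d)%:R
   * cmean d (fun w => h (r%:C%C * w) * (r%:C%C * w)).
  rewrite -circle_trap; apply: eq_bigr => k _.
  have l1 : lam (0 + 1) = 1 by rewrite /lam; ring.
  by rewrite /G l1 rmorph1 !mul1r !mulr1 !add0r ![a + _]addrC !subrK.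
move: Hb; rewrite /boundary hsE v1.
set A := _ * cmean _ _; set M := cmean _ _ in A *.
have -> : hside G h d 0 0 1 + A - hside G h d 0 0 1 - vside G h d 0 0 1 = A - vside G h d 0 0 1 by ring.
move=> Hb; rewrite subr0.
have AM : cabs M <= cabs A.
  by rewrite /A cabsM -[leLHS]mul1r ler_wpM2r ?cabs_ge0// uroot_factor_ge.
apply: (le_trans AM).
have := cabsD (A - vside G h d 0 0 1) (vside G h d 0 0 1); rewrite subrK; lra.
Qed.

End CircleMeans.

Section CircleLimits.
Context {R : realType}.
Local Notation C := (R[i]).

Lemma ctends_ext (u v : nat -> C) (l : C) N0 : (forall n, (N0 <= n)%N -> u n = v n) ->
  ctends u l -> ctends v l.
Proof.
move=> uv h e e0; have [N H] := h e e0; exists (maxn N N0) => n.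
by rewrite geq_max => /andP[nN nN0]; rewrite -uv// H.
Qed.

Lemma ctends_cst (l : C) : ctends (fun=> l) l.
Proof. by move=> e e0; exists 0%N => n _; rewrite subrr cabs0 ltW. Qed.

Lemma ctendsD (u v : nat -> C) (k l : C) : ctends u k -> ctends v l ->
  ctends (fun n => u n + v n) (k + l).
Proof.
move=> hu hv e e0; have e2 : 0 < e / 2 by rewrite divr_gt0.
have [N H] := hu _ e2; have [N' H'] := hv _ e2.
exists (maxn N N') => n; rewrite geq_max => /andP[/H h1 /H' h2].
have -> : u n + v n - (k + l) = (u n - k) + (v n - l) by ring.
by have := cabsD (u n - k) (v n - l); lra.
Qed.

Lemma ctendsZ (a : C) (u : nat -> C) (l : C) : ctends u l -> ctends (fun n => a * u n) (a * l).
Proof.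
move=> hu e e0; have a0 := cabs_ge0 a.
have [N H] := hu (e / (cabs a + 1)) (divr_gt0 e0 (ltr_wpDl a0 ltr01)).
exists N => n /H; rewrite ler_pdivlMr ?ltr_wpDl// -mulrBr cabsM.
have := cabs_ge0 (u n - l); nra.
Qed.

Lemma ctends_unique (u : nat -> C) (k l : C) : ctends u k -> ctends u l -> k = l.
Proof.
move=> hk hl; apply/eqP; rewrite -subr_eq0 -cabs_eq0 eq_le cabs_ge0 andbT.
apply/ler_addgt0Pr => e e0; have e2 : 0 < e / 2 by rewrite divr_gt0.
have [N H] := hk _ e2; have [N' H'] := hl _ e2.
have h1 := H (maxn N N') (leq_maxl _ _); have h2 := H' (maxn N N') (leq_maxr _ _).
have -> : k - l = (u (maxn N N') - l) - (u (maxn N N') - k) by ring.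
have := cabsB (u (maxn N N') - l) (u (maxn N N') - k); lra.
Qed.

Lemma ctends_le (u : nat -> C) (l : C) (b : R) N : ctends u l ->
  (forall n, (N <= n)%N -> cabs (u n) <= b) -> cabs l <= b.
Proof.
move=> h H; apply/ler_addgt0Pr => e e0; have [N' H'] := h _ e0.
have h1 := H' (maxn N N') (leq_maxr _ _); have h2 := H (maxn N N') (leq_maxl _ _).
have := cabsB (u (maxn N N')) (u (maxn N N') - l).
by rewrite opprB addrC subrK; lra.
Qed.

Lemma pow2_gt_ex (k : nat) : exists d0, forall d, (d0 <= d)%N -> (k < 2 ^ d)%N.
Proof.
exists k => d kd; apply: leq_trans (ltn_expl d (ltnSn 1)) => //.
Qed.

Lemma expr_small (x e : R) : 0 <= x < 1 -> 0 < e ->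
  exists n0, forall n, (n0 <= n)%N -> x ^+ n <= e.
Proof.
move=> /andP[x0 x1] e0.
have : (x ^+ n @[n --> \oo] --> (0 : R)) by apply: cvg_expr; rewrite ger0_norm.
move=> /cvgrPdist_le /(_ e e0) [n0 _ H]; exists n0 => n /H.
by rewrite sub0r normrN ger0_norm ?exprn_ge0.
Qed.

Lemma cabs1V (w : C) : cabs w = 1 -> w^-1 = (w^*)%C.
Proof.
move=> w1; have w0 : w != 0 by rewrite -cabs_gt0 w1.
by apply: (mulfI w0); rewrite mulfV// conj_mul_cabs w1 expr1n rmorph1.
Qed.

Lemma cmean_conj l (F : C -> C) : cmean l (fun w => ((F w)^*)%C) = ((cmean l F)^*)%C.
Proof. by rewrite /cmean rmorphM rmorph_sum /= conjc_inv conjc_nat. Qed.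

(** Below degree 2^l the discrete mean is exact, so the coefficients of a polynomial are read off
    with no error. *)
Lemma cmean_mono l i j : (i < 2 ^ l)%N -> (j < 2 ^ l)%N ->
  cmean l (fun w : C => w ^+ i * w^-1 ^+ j) = (i == j)%:R.
Proof.
wlog ij : i j / (j <= i)%N => [H|] il jl.
  case: (leqP j i) => [|/ltnW] ij; first exact: H.
  rewrite eq_sym -[RHS]conjc_nat -H// -cmean_conj; apply: eq_cmean => w w1.
  by rewrite rmorphM !rmorphXn /= conjc_inv -cabs1V// invrK mulrC.
transitivity (cmean l (fun w : C => w ^+ (i - j))).
  apply: eq_cmean => w w1; have w0 : w != 0 by rewrite -cabs_gt0 w1.
  by rewrite -{1}(subnK ij) exprD -mulrA -exprMn divff// expr1n mulr1.
rewrite cmean_expn; congr (_%:R); congr nat_of_bool.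
apply/idP/eqP => [|->]; last by rewrite subnn dvdn0.
move=> /dvdnP[k]; case: k => [|k]; first by move=> h; apply/eqP; lia.
by rewrite mulSn; lia.
Qed.

(** With u = a / r the mean equals 1 / (1 - u^(2^d)) exactly: after multiplication by 1 - u^(2^d)
    the integrand is the geometric sum in u / w, of which only the constant term has nonzero
    mean. *)
Lemma cmean_kernel (r : R) (a : C) : 0 < r -> cabs a < r ->
  ctends (fun d => cmean d (fun w => (r%:C%C * w) / (r%:C%C * w - a))) 1.
Proof.
move=> r0 ar; have rC : r%:C%C != 0 :> C by rewrite -cabs_gt0 cabs_real normr_gt0 gt_eqF.
pose u := a / r%:C%C.
have cu : cabs u = cabs a / r by rewrite cabsM cabsV cabs_real gtr0_norm.
have u1 : 0 <= cabs u < 1 by rewrite cabs_ge0 cu ltr_pdivrMr// mul1r.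
move: (u1) => /andP[_ u1'].
have E d : cmean d (fun w => (r%:C%C * w) / (r%:C%C * w - a)) = (1 - u ^+ (2 ^ d))^-1.
  have n0 : 1 - u ^+ (2 ^ d) != 0.
    rewrite subr_eq0; apply/negP => /eqP /(congr1 cabs); rewrite cabs1 cabsX => h.
    have : cabs u ^+ (2 ^ d) < 1 by rewrite exprn_ilt1 ?cabs_ge0// -lt0n expn_gt0.
    by rewrite -h ltxx.
  apply: (mulfI n0); rewrite mulfV// -cmeanZ.
  transitivity (cmean d (fun w => \sum_(j < 2 ^ d) u ^+ j * (w ^+ 0 * w^-1 ^+ j))).
    congr (_ / _); apply: eq_bigr => k _; set w := _ ^+ k.
    have w1 : cabs w = 1 by rewrite cabsX cabs_uroot expr1n.
    have w0 : w != 0 by rewrite -cabs_gt0 w1.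
    have wL : w^-1 ^+ (2 ^ d) = 1.
      by rewrite exprVn -exprM mulnC exprM (prim_expr_order (uroot_prim d)) expr1n invr1.
    have d0 : r%:C%C * w - a != 0.
      rewrite subr_eq0; apply/negP => /eqP /(congr1 cabs).
      by rewrite cabsM w1 mulr1 cabs_real gtr0_norm// => h; move: ar; rewrite -h ltxx.
    under eq_bigr do rewrite expr0 mul1r -exprMn.
    have := subrX1 (u / w) (2 ^ d); rewrite exprMn wL mulr1 => h.
    rewrite -opprB h -mulNr opprB mulrAC.
    have -> : (1 - u / w) * (r%:C%C * w / (r%:C%C * w - a)) = 1.
      by rewrite /u; field; rewrite w0 rC d0.
    by rewrite mul1r.
  rewrite cmean_sum (bigD1 (Ordinal (expn_gt0 2 d : (0 < 2 ^ d)%N)))//= big1 ?addr0.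
    by rewrite cmeanZ cmean_mono ?expn_gt0// expr0 mulr1.
  move=> i i0; rewrite cmeanZ cmean_mono ?expn_gt0//.
  by rewrite eq_sym (negbTE (_ : nat_of_ord i != 0%N)) ?mulr0//; apply: contra i0 => /eqP h; apply/eqP/val_inj.
move=> e e0.
have e1 : 0 < Num.min (1 / 2) (e / 2) by rewrite lt_min !divr_gt0.
have [n0 Hn] := expr_small u1 e1; exists n0 => d dn.
have {}Hn : cabs u ^+ (2 ^ d) <= Num.min (1 / 2) (e / 2).
  by apply: Hn; apply: leq_trans dn (ltnW (ltn_expl _ _)).
move: Hn; rewrite le_min -cabsX => /andP[h1 h2]; rewrite E.
set v := u ^+ _ in h1 h2 *.
have v1 : 1 / 2 <= cabs (1 - v).
  have := cabsD (1 - v) v; rewrite subrK cabs1; lra.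
have v0 : 1 - v != 0 by rewrite -cabs_gt0; lra.
have -> : (1 - v)^-1 - 1 = v / (1 - v) by field.
rewrite cabsM cabsV ler_pdivrMr; last lra.
nra.
Qed.

(** Write g as (g - g a) + g a: the first part has mean tending to 0 by the homotopy, the second is
    a multiple of the kernel mean. *)
Lemma cauchy_circle (g : C^o -> C^o) (r : R) (a : C) :
  (forall z, cabs z <= r -> derivable g z 1) -> cabs a < r ->
  ctends (fun d => cmean d (fun w => g (r%:C%C * w) * ((r%:C%C * w) / (r%:C%C * w - a)))) (g a).
Proof.
move=> dg ar; have r0 : 0 < r by apply: le_lt_trans (cabs_ge0 _) ar.
have := ctendsD (circle_mean_diff dg ar) (ctendsZ (g a) (cmean_kernel r0 ar)).
rewrite add0r mulr1; apply: (@ctends_ext _ _ _ 0%N) => d _.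
rewrite -cmeanZ -cmeanD; apply: eq_cmean => w w1; ring.
Qed.

Lemma derivable_mul_invX (f : C^o -> C^o) (p : C^o) m : derivable f p 1 -> p != 0 ->
  derivable (fun u => f u * u^-1 ^+ m) p 1.
Proof.
move=> df p0.
have d3 : derivable (fun y : C^o => y^-1 : C^o) p 1.
  by apply: (@derivableV C C^o id); [| exact: derivable_id].
have d4 : derivable ((fun y : C^o => y^-1 : C^o) ^+ m) p 1 by exact: derivableX.
have -> : (fun u => f u * u^-1 ^+ m) = f * ((fun y : C^o => y^-1 : C^o) ^+ m) :> (C^o -> C^o).
  by apply/funext => u; rewrite -[RHS]/(f u * _) exprfctE.
exact: (@derivableM C C^o _ _ _ _ df d4).
Qed.

(* Retracting the circle of radius r1 onto the one of radius r0. *)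
Lemma annulus_means (h : C^o -> C^o) (r0 r1 : R) : 0 < r0 -> r0 <= r1 ->
  (forall z, r0 <= cabs z <= r1 -> derivable h z 1) ->
  ctends (fun d => cmean d (fun w => h (r1%:C%C * w) * (r1%:C%C * w))
                 - cmean d (fun w => h (r0%:C%C * w) * (r0%:C%C * w))) 0.
Proof.
move=> r00 r01 dh e e0.
have P0 : 0 < 4 * pi :> R by rewrite mulr_gt0// pi_gt0.
pose lam s : R := r0 + s * (r1 - r0).
pose G s t : C := (lam s)%:C%C * cis t.
have lam01 s : 0 <= s <= 1 -> r0 <= lam s <= r1.
  by move=> /andP[s0 s1]; rewrite /lam; apply/andP; split; nra.
pose K := 1 + r1 + 4 * pi * r1.
have GE s t s' t' : G s t - G s' t' = ((s - s') * (r1 - r0))%:C%C * cis t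
    + (lam s')%:C%C * (cis t - cis t').
  rewrite /G /lam !rmorphD !rmorphM /= !rmorphB /=; ring.
have Pr : 0 < 4 * pi * r1 by rewrite mulr_gt0//; lra.
have Glip s t s' t' : 0 <= s <= 1 -> 0 <= t <= 1 -> 0 <= s' <= 1 -> 0 <= t' <= 1 ->
    cabs (G s t - G s' t') <= K * (`|s - s'| + `|t - t'|).
  move=> _ _ /lam01/andP[l1 l2] _; rewrite GE (le_trans (cabsD _ _))//.
  have A : cabs (((s - s') * (r1 - r0))%:C%C * cis t) <= `|s - s'| * r1.
    rewrite cabsM cabs_real normrM cabs_cis mulr1; apply: ler_wpM2l => //.
    by rewrite ger0_norm; lra.
  have B : cabs ((lam s')%:C%C * (cis t - cis t')) <= r1 * (4 * pi * `|t - t'|).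
    rewrite cabsM cabs_real ger0_norm; last lra.
    by apply: ler_pM; rewrite ?cabs_ge0 ?cis_lip//; lra.
  apply: (le_trans (lerD A B)); rewrite /K.
  have : 0 <= `|s - s'| by []. have : 0 <= `|t - t'| by [].
  nra.
have K1 : 1 <= K by rewrite /K; lra.
have hder s t : 0 <= s <= 1 -> 0 <= t <= 1 -> derivable h (G s t) 1.
  move=> /lam01/andP[l1 l2] _; apply: dh; rewrite /G cabsM cabs_cis mulr1 cabs_real.
  by rewrite ger0_norm ?l1//; lra.
have [d0 Hd0] := goursat K1 Glip hder e0.
exists (maxn d0 2) => d; rewrite geq_max => /andP[/Hd0 Hb d2].
have hsE : hside G h d 0 (0 + 1) 1 = hside G h d 0 0 1.
  by apply: eq_bigr => k _; rewrite /G (add0r 1) cis0 cis1.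
have vE x : vside G h d x 0 1 = (uroot d - (uroot d)^-1) / 2 * (2 ^ d)%:R
   * cmean d (fun w => h ((lam x)%:C%C * w) * ((lam x)%:C%C * w)).
  by rewrite -circle_trap; apply: eq_bigr => k _; rewrite /G !mulr1 !add0r.
have l1 : lam (0 + 1) = r1 by rewrite /lam; ring.
have l0 : lam 0 = r0 by rewrite /lam; ring.
move: Hb; rewrite /boundary hsE !vE l1 l0.
set H := hside _ _ _ _ _ _; set F := (_ * _%:R); set M1 := cmean _ _; set M0 := cmean _ _.
have -> : H + F * M1 - H - F * M0 = F * (M1 - M0) by ring.
rewrite subr0 cabsM; apply: le_trans.
by rewrite -[leLHS]mul1r ler_wpM2r ?cabs_ge0// uroot_factor_ge.
Qed.

End CircleLimits.

(** * Cauchy's formula and Taylor coefficients on a polydisc *)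

Section UltraLimit.
Context {R : realType}.
Local Notation C := (R[i]).

Definition bounded_seq (u : nat -> C) := exists b : R, forall n, cabs (u n) <= b.

(* The constant 2 comes from treating real and imaginary parts separately. *)
Lemma ultra_limit_ex : exists ulim : (nat -> C) -> C,
  [/\ forall a u v, bounded_seq u -> bounded_seq v ->
        ulim (fun n => a * u n + v n) = a * ulim u + ulim v,
      forall u (b : R), (forall n, cabs (u n) <= b) -> cabs (ulim u) <= 2 * b &
      forall u l, ctends u l -> ulim u = l].
Proof.
have [U [UU oU]] := @ultraFilterLemma nat (\oo) _.
have PU : ProperFilter U by exact: ultra_proper.
have cvgU (u : nat -> R) (b : R) : (forall n, `|u n| <= b) -> cvg (u @ U).
  move=> ub.
  have cpt := @segment_compact R (- b) b.
  have FA : (u @ U) (`[- b, b])%classic.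
    by apply: (@filterE _ U _) => n /=; rewrite in_itv /= -ler_norml.
  have [x [_ clx]] := cpt (u @ U) _ FA.
  apply/cvg_ex; exists x => A Ax; have [//|nA] := in_ultra_setVsetC (u @^-1` A) UU.
  have [y [Ay]] := clx (~` A) A nA Ax; exact.
pose ulR (u : nat -> R) : R := lim (u @ U).
exists (fun u => (ulR (fun n => complex.Re (u n)) +i* ulR (fun n => complex.Im (u n)))%C).
have cvgRe (u : nat -> C) : bounded_seq u -> cvg ((fun n => complex.Re (u n)) @ U).
  by move=> [b ub]; apply: (cvgU _ b) => n; rewrite (le_trans (normRe_le _)).
have cvgIm (u : nat -> C) : bounded_seq u -> cvg ((fun n => complex.Im (u n)) @ U).
  by move=> [b ub]; apply: (cvgU _ b) => n; rewrite (le_trans (normIm_le _)).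
have limb (u : nat -> R) (b : R) : (forall n, `|u n| <= b) -> `|ulR u| <= b.
  move=> ub; have uc := cvgU u b ub.
  rewrite ler_norml; apply/andP; split.
    by apply: limr_ge => //; apply: filterE => n; have := ub n; rewrite ler_norml => /andP[].
  by apply: limr_le => //; apply: filterE => n; have := ub n; rewrite ler_norml => /andP[].
split.
- move=> [a1 a2] u v bu bv.
  have ru := cvgRe _ bu; have iu := cvgIm _ bu; have rv := cvgRe _ bv; have iv := cvgIm _ bv.
  apply/eqP; rewrite eq_complex /=; apply/andP; split; apply/eqP.
    rewrite /ulR; apply: cvg_lim => //.
    rewrite (_ : (fun n => _) = fun n => (a1 * complex.Re (u n) - a2 * complex.Im (u n)) + complex.Re (v n)).
      by apply: cvgD => //; apply: cvgB; apply: cvgMr.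
    by apply/funext => n; case: (u n) (v n) => [? ?] [? ?].
  rewrite /ulR; apply: cvg_lim => //.
  rewrite (_ : (fun n => _) = fun n => (a1 * complex.Im (u n) + a2 * complex.Re (u n)) + complex.Im (v n)).
    by apply: cvgD => //; apply: cvgD; apply: cvgMr.
  by apply/funext => n; case: (u n) (v n) => [? ?] [? ?].
- move=> u b ub; rewrite (le_trans (cabs_le_ReIm _))//= mulr_natl mulr2n lerD// limb// => n.
    by rewrite (le_trans (normRe_le _)).
  by rewrite (le_trans (normIm_le _)).
- move=> u l ul; apply/eqP; rewrite eq_complex /=; apply/andP; split; apply/eqP.
    apply: cvg_lim => //; apply: cvg_trans (_ : _ @ \oo --> _).
      by apply: cvg_app.
    apply/cvgrPdist_le => e e0; have [N H] := ul _ e0; exists N => // n /= /H.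
    by apply: le_trans; rewrite distrC -raddfB normRe_le.
  apply: cvg_lim => //; apply: cvg_trans (_ : _ @ \oo --> _).
    by apply: cvg_app.
  apply/cvgrPdist_le => e e0; have [N H] := ul _ e0; exists N => // n /= /H.
  by apply: le_trans; rewrite distrC -raddfB normIm_le.
Qed.

End UltraLimit.

(** * The Cauchy kernel and its derivatives *)

Section Kernel.
Context {R : realType}.
Local Notation C := (R[i]).

(** The j-th derivative in a of the Cauchy kernel, divided by j!. The factor x is the density of dx
    / (2 pi i) with respect to the mean over the circle. *)
Definition kern (j : nat) (x a : C) : C := x * (x - a)^-1 ^+ j.+1.

Lemma cabs_kern_le (r q : R) j (x a : C) : 0 <= q -> q < r -> cabs x = r -> cabs a <= q ->
  cabs (kern j x a) <= r * (r - q)^-1 ^+ j.+1.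
Proof.
move=> q0 qr xr ar; rewrite cabsM xr ler_wpM2l//; first by rewrite -xr cabs_ge0.
rewrite cabsX cabsV lerXn2r ?nnegrE ?invr_ge0 ?cabs_ge0 ?subr_ge0 ?(ltW qr)//.
have h : r - q <= cabs (x - a).
  have := cabsD (x - a) a; rewrite subrK xr; lra.
by rewrite lef_pV2 ?posrE ?subr_gt0//; apply: lt_le_trans h; rewrite subr_gt0.
Qed.

(** For A = 1 / (x - a) and B = 1 / (x - a - t) the relation B - A = t A B contains all that is
    required of the inverse, which keeps the induction on p algebraic. *)
Lemma inv_pow_taylor (c : R) (p : nat) : exists2 M : R, 0 <= M & forall A B t : C,
  cabs A <= c -> cabs B <= c -> B - A = t * A * B ->
  cabs (B ^+ p - A ^+ p - p%:R * t * A ^+ p.+1) <= M * cabs t ^+ 2.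
Proof.
have [c0|c0] := ltP c 0.
  exists 0 => // A B t Ac; have := le_lt_trans Ac c0.
  by rewrite ltNge cabs_ge0.
elim: p => [|p [M M0 H]].
  by exists 0 => // A B t _ _ _; rewrite !expr0 subrr mul0r mul0r subrr cabs0 mul0r.
exists (c * M + p.+1%:R * c ^+ p.+3) => [|A B t Ac Bc BA].
  by apply: addr_ge0; apply: mulr_ge0 => //; apply: exprn_ge0.
have -> : B ^+ p.+1 - A ^+ p.+1 - p.+1%:R * t * A ^+ p.+2 =
   B * (B ^+ p - A ^+ p - p%:R * t * A ^+ p.+1) + p.+1%:R * (t ^+ 2 * A ^+ p.+2 * B).
  apply/eqP; rewrite -subr_eq0 (_ : _ - _ =
    (A ^+ p + p.+1%:R * t * A ^+ p.+1) * ((B - A) - t * A * B)).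
    by rewrite BA subrr mulr0.
  by rewrite -natr1 !exprS; ring.
rewrite (le_trans (cabsD _ _))// mulrDl; apply: lerD.
  by rewrite cabsM -(mulrA c); apply: ler_pM; rewrite ?cabs_ge0//; apply: H.
rewrite 3!cabsM cabs_nat !cabsX -(mulrA p.+1%:R) ler_wpM2l//.
have -> : cabs t ^+ 2 * cabs A ^+ p.+2 * cabs B = cabs A ^+ p.+2 * cabs B * cabs t ^+ 2 by ring.
rewrite ler_wpM2r ?exprn_ge0 ?cabs_ge0// (exprSr c).
apply: ler_pM => //; [by apply: exprn_ge0; exact: cabs_ge0 | exact: cabs_ge0 |].
by apply: lerXn2r; rewrite ?nnegrE ?cabs_ge0.
Qed.

(** The constant is uniform over x on the circle, as differentiation under the torus mean
    demands. *)
Lemma kern_taylor (r q : R) j : 0 <= q -> q < r ->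
  exists2 M : R, 0 <= M & forall x a t : C, cabs x = r -> cabs a <= q -> cabs (a + t) <= q ->
  cabs (kern j x (a + t) - kern j x a - j.+1%:R * t * kern j.+1 x a) <= M * cabs t ^+ 2.
Proof.
move=> q0 qr; have r0 : 0 < r by apply: le_lt_trans qr.
have [M M0 H] := inv_pow_taylor (r - q)^-1 j.+1.
exists (r * M) => [|x a t xr aq atq]; first by rewrite mulr_ge0// ltW.
have far b : cabs b <= q -> r - q <= cabs (x - b).
  move=> bq; have := cabsD (x - b) b; rewrite subrK xr; lra.
have nz b : cabs b <= q -> x - b != 0.
  by move=> /far h; rewrite -cabs_gt0; lra.
have le b : cabs b <= q -> cabs (x - b)^-1 <= (r - q)^-1.
  by move=> bq; rewrite cabsV lef_pV2 ?posrE ?far// ?cabs_gt0 ?nz// subr_gt0.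
have := H (x - a)^-1 (x - (a + t))^-1 t (le _ aq) (le _ atq).
have -> : (x - (a + t))^-1 - (x - a)^-1 = t * (x - a)^-1 * (x - (a + t))^-1.
  by field; rewrite (nz _ aq) opprD addrA; have := nz _ atq; rewrite opprD addrA => ->.
move=> /(_ erefl) h.
have -> : kern j x (a + t) - kern j x a - j.+1%:R * t * kern j.+1 x a =
  x * ((x - (a + t))^-1 ^+ j.+1 - (x - a)^-1 ^+ j.+1 - j.+1%:R * t * (x - a)^-1 ^+ j.+2).
  by rewrite /kern; ring.
by rewrite cabsM xr -(mulrA r); apply: ler_wpM2l; [exact: ltW | exact: h].
Qed.

End Kernel.

(** * Cauchy's formula by iterated means, and the expansion near 0 *)

Section TorusFunctional.
Context {R : realType}.
Local Notation C := (R[i]).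
Variables (n : nat) (r : R).
Hypothesis r0 : 0 < r.
Variable ulim : (nat -> C) -> C.
Hypothesis ulim_lin : forall a u v, bounded_seq u -> bounded_seq v ->
  ulim (fun n => a * u n + v n) = a * ulim u + ulim v.
Hypothesis ulim_le : forall u (b : R), (forall n, cabs (u n) <= b) -> cabs (ulim u) <= 2 * b.
Hypothesis ulim_lim : forall u l, ctends u l -> ulim u = l.

Definition torus : set (@Cn R n) := [set z | forall k, cabs (z 0 k) = r].

Definition upd (z : @Cn R n) (k : 'I_n) (x : C) : @Cn R n :=
  \row_j (if j == k then x else z 0 j).

Definition upds (z : @Cn R n) (s : seq 'I_n) (y : @Cn R n) : @Cn R n :=
  \row_j (if j \in s then y 0 j else z 0 j).

Lemma upd_torus z k w : torus z -> cabs w = 1 -> torus (upd z k (r%:C%C * w)).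
Proof.
move=> zT w1 j; rewrite mxE; case: eqP => // _.
by rewrite cabsM w1 mulr1 cabs_real gtr0_norm.
Qed.

(* The iterated torus mean.  Using a functional defined on all bounded sequences
   avoids proving that the inner limits exist. *)
Fixpoint torus_lim (s : seq 'I_n) (F : @Cn R n -> C) (z : @Cn R n) : C :=
  if s is k :: s' then
    ulim (fun d => cmean d (fun w => torus_lim s' F (upd z k (r%:C%C * w))))
  else F z.

Definition torus_bounded (F : @Cn R n -> C) := exists b : R, forall z, torus z -> cabs (F z) <= b.

Lemma torus_lim_le s F (b : R) z : (forall z, torus z -> cabs (F z) <= b) -> torus z ->
  cabs (torus_lim s F z) <= 2 ^+ size s * b.
Proof.
move=> Fb; elim: s z => [|k s IH] z zT /=; first by rewrite expr0 mul1r Fb.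
rewrite exprS -mulrA; apply: ulim_le => d; apply: cabs_cmean => w w1.
by apply: IH; apply: upd_torus.
Qed.

Lemma torus_lim_bseq s F z k : torus_bounded F -> torus z ->
  bounded_seq (fun d => cmean d (fun w => torus_lim s F (upd z k (r%:C%C * w)))).
Proof.
move=> [b Fb] zT; exists (2 ^+ size s * b) => d; apply: cabs_cmean => w w1.
by apply: torus_lim_le => //; apply: upd_torus.
Qed.

Lemma torus_lim_lin s F G a z : torus_bounded F -> torus_bounded G -> torus z ->
  torus_lim s (fun y => a * F y + G y) z = a * torus_lim s F z + torus_lim s G z.
Proof.
move=> Fb Gb; elim: s z => [//|k s IH] z zT /=.
rewrite -ulim_lin; [|exact: torus_lim_bseq..].
congr ulim; apply/funext => d; rewrite -cmeanZ -cmeanD; apply: eq_cmean => w w1.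
by rewrite IH//; apply: upd_torus.
Qed.

Lemma torus_lim_ext s F G z : (forall z, torus z -> F z = G z) -> torus z ->
  torus_lim s F z = torus_lim s G z.
Proof.
move=> FG; elim: s z => [z zT|k s IH z zT] /=; first exact: FG.
congr ulim; apply/funext => d; apply: eq_cmean => w w1.
by rewrite IH//; apply: upd_torus.
Qed.

Lemma ulim0 : ulim (fun=> 0) = 0.
Proof. exact/ulim_lim/ctends_cst. Qed.

Lemma ulimZ a u : bounded_seq u -> ulim (fun n => a * u n) = a * ulim u.
Proof.
move=> ub; rewrite -[RHS]addr0 -ulim0 -ulim_lin//.
  by congr ulim; apply/funext => d; rewrite addr0.
by exists 0 => d; rewrite cabs0.
Qed.

Lemma torus_lim_factor s F (c : C -> C) k z : k \notin s -> torus_bounded F -> torus z ->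
  torus_lim s (fun y => c (y 0 k) * F y) z = c (z 0 k) * torus_lim s F z.
Proof.
move=> + Fb; elim: s z => [//|j s IH] z; rewrite inE negb_or => /andP[kj ks] zT /=.
rewrite -ulimZ; last exact: torus_lim_bseq.
congr ulim; apply/funext => d; rewrite -cmeanZ; apply: eq_cmean => w w1.
by rewrite IH//; [rewrite mxE (negbTE kj) | apply: upd_torus].
Qed.

Lemma torus_boundedM F G : torus_bounded F -> torus_bounded G -> torus_bounded (fun z => F z * G z).
Proof.
move=> [b Fb] [c Gc]; exists (b * c) => z zT; rewrite cabsM.
by apply: ler_pM; rewrite ?cabs_ge0 ?Fb ?Gc.
Qed.

Lemma torus_boundedD F G : torus_bounded F -> torus_bounded G -> torus_bounded (fun z => F z + G z).
Proof.
move=> [b Fb] [c Gc]; exists (b + c) => z zT; rewrite (le_trans (cabsD _ _))//.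
by rewrite lerD ?Fb ?Gc.
Qed.

Lemma torus_bounded_cst c : torus_bounded (fun=> c).
Proof. by exists (cabs c). Qed.

Lemma torus_bounded_prod (s : seq 'I_n) (P : pred 'I_n) (F : 'I_n -> @Cn R n -> C) :
  (forall k, torus_bounded (F k)) -> torus_bounded (fun z => \prod_(k <- s | P k) F k z).
Proof.
move=> H; elim: s => [|k s [b Hb]].
  by exists 1 => z _; rewrite big_nil cabs1.
have [c Hc] := H k; exists (Num.max 1 c * b) => z zT; rewrite big_cons.
have := Hb z zT; have := Hc z zT; have := cabs_ge0 (F k z).
have := cabs_ge0 (\prod_(j <- s | P j) F j z); case: (P k) => h1 h2 h3 h4.
  by rewrite cabsM; apply: ler_pM => //; rewrite le_max h3 orbT.
by rewrite -[leLHS]mul1r; apply: ler_pM => //; rewrite le_max lexx.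
Qed.

Lemma torus_bounded_sum (I : Type) (s : seq I) (F : I -> @Cn R n -> C) :
  (forall i, torus_bounded (F i)) -> torus_bounded (fun z => \sum_(i <- s) F i z).
Proof.
move=> H; elim: s => [|k s IH].
  by exists 0 => z _; rewrite big_nil cabs0.
have [b Hb] := torus_boundedD (H k) IH; exists b => z zT; rewrite big_cons; exact: Hb.
Qed.

Lemma torus_lim_sum (I : Type) s (t : seq I) (F : I -> @Cn R n -> C) z :
  (forall i, torus_bounded (F i)) -> torus z ->
  torus_lim s (fun y => \sum_(i <- t) F i y) z = \sum_(i <- t) torus_lim s (F i) z.
Proof.
move=> H zT; elim: t => [|i t IH].
  rewrite big_nil; transitivity (torus_lim s (fun y => (-1) * 0 + 0) z).
    by apply: torus_lim_ext => // y _; rewrite big_nil mulr0 addr0.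
  by rewrite (@torus_lim_lin s (fun=> 0) (fun=> 0))//; [ring| exact: torus_bounded_cst..].
rewrite big_cons -IH -[X in X + _]mul1r -torus_lim_lin//; last exact: torus_bounded_sum.
by apply: torus_lim_ext => // y _; rewrite big_cons mul1r.
Qed.

Lemma torus_lim_scale s F a z : torus_bounded F -> torus z ->
  torus_lim s (fun y => a * F y) z = a * torus_lim s F z.
Proof.
move=> Fb zT; transitivity (torus_lim s (fun y => a * F y + 0) z).
  by apply: torus_lim_ext => // y _; rewrite addr0.
rewrite (torus_lim_lin s a Fb (torus_bounded_cst 0) zT).
suff -> : torus_lim s (fun=> 0) z = 0 by rewrite addr0.
have := @torus_lim_sum void s [::] (fun _ _ => 0) z (fun _ => torus_bounded_cst 0) zT.
by rewrite !big_nil.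
Qed.

Lemma torus_bounded_kern j k (a : C) : cabs a < r -> torus_bounded (fun z => kern j (z 0 k) a).
Proof.
move=> ar; exists (r * (r - cabs a)^-1 ^+ j.+1) => z zT.
by apply: cabs_kern_le => //; exact: cabs_ge0.
Qed.

Variable f : @Cn R n -> C^o.
Hypothesis f_der : forall (z : @Cn R n) (k : 'I_n) (x : C), (forall j, cabs (z 0 j) <= r) -> cabs x <= r ->
  derivable ((fun u : C^o => f (upd z k u)) : C^o -> C^o) x 1.
Variable b : R.
Hypothesis f_le : forall z : @Cn R n, (forall j, cabs (z 0 j) <= r) -> cabs (f z) <= b.

Lemma f_bounded : torus_bounded f.
Proof. by exists b => z zT; apply: f_le => j; rewrite zT. Qed.

(** One variable at a time. For this integrand the limit in each variable exists by [cauchy_circle],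
    so [ulim] takes its true value. *)
Lemma torus_cauchy s (z y : @Cn R n) : uniq s -> torus z -> (forall k, cabs (y 0 k) < r) ->
  torus_lim s (fun x => f x * \prod_(k <- s) kern 0 (x 0 k) (y 0 k)) z = f (upds z s y).
Proof.
move=> + + yr; elim: s z => [|k s IH] z.
  move=> _ zT /=; rewrite big_nil mulr1; congr f.
  by apply/rowP => j; rewrite mxE in_nil.
rewrite cons_uniq => /andP[ks us] zT /=.
apply: ulim_lim.
have le z' : torus z' -> forall j, cabs (upds z' s y 0 j) <= r.
  by move=> z'T j; rewrite mxE; case: ifP => _; [rewrite ltW | rewrite z'T].
have := cauchy_circle (fun x => @f_der (upds z s y) k x (le _ zT)) (yr k).
have -> : upd (upds z s y) k (y 0 k) = upds z (k :: s) y.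
  by apply/rowP => j; rewrite !mxE inE; case: eqP => [->|].
apply: (@ctends_ext _ _ _ _ 0%N) => d _.
apply: eq_cmean => w w1.
transitivity (kern 0 (r%:C%C * w) (y 0 k) * torus_lim s (fun x => f x * \prod_(k <- s) kern 0 (x 0 k) (y 0 k))
   (upd z k (r%:C%C * w))); last first.
  have zT' := upd_torus k zT w1.
  have Gb : torus_bounded (fun x => f x * \prod_(k <- s) kern 0 (x 0 k) (y 0 k)).
    apply: torus_boundedM; first exact: f_bounded.
    by apply: torus_bounded_prod => i; apply: torus_bounded_kern.
  have := torus_lim_factor (fun x => kern 0 x (y 0 k)) ks Gb zT'.
  rewrite [upd z k _ 0 k]mxE eqxx => <-.
  by apply: torus_lim_ext => // x xT; rewrite big_cons mulrCA.
rewrite IH//; last exact: upd_torus.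
rewrite mulrC /kern expr1; congr (_ * _); congr f.
by apply/rowP => j; rewrite !mxE; case: eqP => // ->; rewrite (negbTE ks).
Qed.

Definition base : @Cn R n := const_mx r%:C%C.

Lemma base_torus : torus base.
Proof. by move=> k; rewrite mxE cabs_real gtr0_norm. Qed.

Definition cauchy_int (j : 'I_n -> nat) (z : @Cn R n) : C :=
  torus_lim (enum 'I_n) (fun x => f x * \prod_(k < n) kern (j k) (x 0 k) (z 0 k)) base.

Lemma cauchy_int0 (z : @Cn R n) : (forall k, cabs (z 0 k) < r) -> cauchy_int (fun=> 0%N) z = f z.
Proof.
move=> zr; rewrite /cauchy_int.
transitivity (torus_lim (enum 'I_n) (fun x => f x * \prod_(k <- enum 'I_n) kern 0 (x 0 k) (z 0 k)) base).
  by apply: torus_lim_ext; [move=> x _; rewrite big_enum | exact: base_torus].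
rewrite torus_cauchy ?enum_uniq//; last exact: base_torus.
by congr f; apply/rowP => j; rewrite mxE mem_enum.
Qed.

Lemma bounded_integrand j (z : @Cn R n) (P : pred 'I_n) : (forall k, cabs (z 0 k) < r) ->
  torus_bounded (fun x => f x * \prod_(k < n | P k) kern (j k) (x 0 k) (z 0 k)).
Proof.
move=> zr; apply: torus_boundedM; first exact: f_bounded.
by apply: torus_bounded_prod => k; apply: torus_bounded_kern.
Qed.

Definition incr (j : 'I_n -> nat) k m : 'I_n -> nat := fun i => (j i + (i == k) * m)%N.

(** Differentiation under the mean: the second-order remainder of one kernel factor is uniformly
    small and the functional is bounded. Since g is assumed equal to the integral only on the
    polydisc, the lemma can be iterated. *)
Lemma derive_cauchy_int (g : @Cn R n -> C^o) (c : C) (j : 'I_n -> nat) (k : 'I_n) (z : @Cn R n) :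
  (forall z : @Cn R n, (forall k, cabs (z 0 k) < r) -> g z = c * cauchy_int j z) ->
  (forall k, cabs (z 0 k) < r) ->
  pderiv n k g z = c * ((j k).+1)%:R * cauchy_int (incr j k 1) z.
Proof.
move=> gE zr; apply: derive_approx => e e0.
pose q := (cabs (z 0 k) + r) / 2.
have zk0 := cabs_ge0 (z 0 k); have zkr := zr k.
have q0 : 0 <= q by rewrite /q; lra.
have qr : q < r by rewrite /q; lra.
have [M M0 HM] := kern_taylor (j k) q0 qr.
have [B HB] := bounded_integrand j (fun i => i != k) zr.
have B0 : 0 <= B by apply: le_trans (cabs_ge0 _) (HB _ base_torus).
(* The coefficient of |t|^2 in the remainder, plus 1 so that one may divide by it; 2^n is the norm
   bound of the n-fold mean. *)
pose E := cabs c * (2 ^+ n * (B * M)) + 1.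
have E0 : 0 < E by rewrite ltr_wpDl// !mulr_ge0 ?cabs_ge0 ?exprn_ge0.
exists (Num.min (q - cabs (z 0 k)) (e / E)).
  by rewrite lt_min divr_gt0// andbT /q; lra.
move=> t; rewrite lt_min => /andP[t1]; rewrite ltr_pdivlMr// => t2.
set y : @Cn R n := t *: delta_mx 0 k + z.
have yE i : y 0 i = if i == k then z 0 k + t else z 0 i.
  rewrite !mxE eqxx /=; case: eqP => [->|]; first by rewrite mulr1 addrC.
  by rewrite mulr0 add0r.
clearbody y.
have zt : cabs (z 0 k + t) <= q by have := cabsD (z 0 k) t; lra.
have yr i : cabs (y 0 i) < r by rewrite yE; case: eqP => // _; apply: le_lt_trans qr.
rewrite !gE//.
have -> : c * cauchy_int j y - c * cauchy_int j z - c * (j k).+1%:R * cauchy_int (incr j k 1) z * t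
   = c * (cauchy_int j y - cauchy_int j z - (j k).+1%:R * t * cauchy_int (incr j k 1) z).
  by move: (cauchy_int j y) (cauchy_int j z) (cauchy_int _ z) => *; ring.
pose W x := f x * \prod_(i < n | i != k) kern (j i) (x 0 i) (z 0 i).
pose I1 x := f x * \prod_(i < n) kern (j i) (x 0 i) (y 0 i).
pose I2 x := f x * \prod_(i < n) kern (j i) (x 0 i) (z 0 i).
pose I3 x := f x * \prod_(i < n) kern (incr j k 1 i) (x 0 i) (z 0 i).
have b1 : torus_bounded I1 by exact: bounded_integrand.
have b2 : torus_bounded I2 by exact: bounded_integrand.
have b3 : torus_bounded I3 by exact: bounded_integrand.
have b12 : torus_bounded (fun x => -1 * I2 x + I1 x).
  by apply: torus_boundedD => //; apply: torus_boundedM => //; apply: torus_bounded_cst.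
have -> : cauchy_int j y - cauchy_int j z - (j k).+1%:R * t * cauchy_int (incr j k 1) z =
  torus_lim (enum 'I_n) (fun x => W x * (kern (j k) (x 0 k) (z 0 k + t) - kern (j k) (x 0 k) (z 0 k)
     - (j k).+1%:R * t * kern (j k).+1 (x 0 k) (z 0 k))) base.
  transitivity (torus_lim (enum 'I_n) (fun x => (- ((j k).+1%:R * t)) * I3 x + (-1 * I2 x + I1 x)) base).
    rewrite torus_lim_lin//; last exact: base_torus.
    rewrite (torus_lim_lin _ _ b2 b1); last exact: base_torus.
    rewrite -/(cauchy_int j y) -/(cauchy_int j z) -/(cauchy_int (incr j k 1) z).
    by move: (cauchy_int j y) (cauchy_int j z) (cauchy_int _ z) => *; ring.
  apply: torus_lim_ext; last exact: base_torus.
  move=> x _; rewrite /I1 /I2 /I3 /W.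
  have -> : \prod_(i < n) kern (j i) (x 0 i) (y 0 i) = kern (j k) (x 0 k) (z 0 k + t) *
     \prod_(i < n | i != k) kern (j i) (x 0 i) (z 0 i).
    rewrite (bigD1 k)// yE eqxx; congr (_ * _).
    by apply: eq_bigr => i ik; rewrite yE (negbTE ik).
  have -> : \prod_(i < n) kern (incr j k 1 i) (x 0 i) (z 0 i) = kern (j k).+1 (x 0 k) (z 0 k) *
     \prod_(i < n | i != k) kern (j i) (x 0 i) (z 0 i).
    rewrite (bigD1 k)// /incr eqxx mul1n addn1; congr (_ * _).
    by apply: eq_bigr => i ik; rewrite (negbTE ik) mul0n addn0.
  have -> : \prod_(i < n) kern (j i) (x 0 i) (z 0 i) = kern (j k) (x 0 k) (z 0 k) *
     \prod_(i < n | i != k) kern (j i) (x 0 i) (z 0 i) by rewrite (bigD1 k).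
  move: (\prod_(i < n | i != k) _) (f x) (kern _ _ (z 0 k + t)) (kern (j k) _ (z 0 k)) (kern (j k).+1 _ _) => *.
  ring.
rewrite cabsM.
have : cabs (torus_lim (enum 'I_n) (fun x => W x * (kern (j k) (x 0 k) (z 0 k + t) - kern (j k) (x 0 k) (z 0 k)
     - (j k).+1%:R * t * kern (j k).+1 (x 0 k) (z 0 k))) base) <= 2 ^+ n * (B * (M * cabs t ^+ 2)).
  rewrite -[X in 2 ^+ X]card_ord cardE; apply: torus_lim_le; last exact: base_torus.
  move=> x xT; rewrite cabsM; apply: ler_pM; rewrite ?cabs_ge0//; first exact: HB.
  by apply: HM => //; rewrite /q; lra.
set U := cabs (torus_lim _ _ _) => hU.
apply: le_trans (ler_wpM2l (cabs_ge0 c) hU) _.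
have -> : cabs c * (2 ^+ n * (B * (M * cabs t ^+ 2))) = cabs c * (2 ^+ n * (B * M)) * cabs t * cabs t by ring.
rewrite ler_wpM2r ?cabs_ge0// ltW//; apply: le_lt_trans t2.
by rewrite mulrC ler_wpM2l ?cabs_ge0// /E lerDl.
Qed.

Lemma iter_pderiv (g : @Cn R n -> C^o) (c : C) (j : 'I_n -> nat) (k : 'I_n) m :
  (forall z : @Cn R n, (forall k, cabs (z 0 k) < r) -> g z = c * cauchy_int j z) -> j k = 0%N ->
  forall z : @Cn R n, (forall k, cabs (z 0 k) < r) ->
  iter m (pderiv n k) g z = c * (m`!)%:R * cauchy_int (incr j k m) z.
Proof.
move=> gE jk; elim: m => [|m IH] z zr /=.
  rewrite fact0 mulr1 gE//; congr (_ * cauchy_int _ _).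
  by apply/funext => i; rewrite /incr muln0 addn0.
rewrite (derive_cauchy_int k IH zr) factS natrM {1}/incr jk eqxx mul1n add0n.
have -> : incr (incr j k m) k 1 = incr j k m.+1.
  by apply/funext => i; rewrite /incr; case: eqP => //=; rewrite ?mul1n ?mul0n; lia.
by move: (cauchy_int _ z) => F; ring.
Qed.

Lemma taylor_coef_int (a : mindex) : taylor_coef n a f = cauchy_int (fun i => a i) 0.
Proof.
have H (s : seq 'I_n) : uniq s -> forall z : @Cn R n, (forall k, cabs (z 0 k) < r) ->
   foldr (fun (k : 'I_n) h => iter (a k) (pderiv n k) h) f s z =
   (\prod_(k <- s) (a k)`!)%N%:R * cauchy_int (fun i => if i \in s then a i else 0%N) z.
  elim: s => [_|k s IH] /=; first by move=> z zr; rewrite big_nil mul1r cauchy_int0.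
  move=> /andP[ks us] z zr.
  rewrite (@iter_pderiv _ _ (fun i => if i \in s then a i else 0%N) k (a k) (IH us))//; last first.
    by rewrite (negbTE ks).
  rewrite big_cons mulnC natrM; congr (_ * cauchy_int _ _); apply/funext => i.
  rewrite /incr inE; case: eqP => [->|_] /=; first by rewrite (negbTE ks) mul1n add0n.
  by rewrite mul0n addn0.
rewrite /taylor_coef /dmulti H ?enum_uniq//; last by move=> k; rewrite mxE cabs0.
rewrite /mfact big_enum /= mulrC mulKf.
  by congr cauchy_int; apply/funext => i; rewrite mem_enum.
by rewrite pnatr_eq0 -lt0n prodn_gt0// => k; rewrite fact_gt0.
Qed.

(** Exponents below N form a finite type, so power series are handled through finite sums over
    boxes. *)
Definition mext N (a : {ffun 'I_n -> 'I_N}) : mindex :=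
  fun k => if insub k is Some i then a i else 0%N.

Lemma mextE N (a : {ffun 'I_n -> 'I_N}) (i : 'I_n) : mext a i = a i.
Proof. by rewrite /mext valK. Qed.

Lemma one_sub_prod (s : seq 'I_n) (x : 'I_n -> C) (d : R) : d <= 1 -> (forall k, cabs (x k) <= d) ->
  cabs (1 - \prod_(k <- s) (1 - x k)) <= (size s)%:R * 2 ^+ size s * d
  /\ cabs (\prod_(k <- s) (1 - x k)) <= 2 ^+ size s.
Proof.
move=> d1 xd; elim: s => [|k s [IH1 IH2]].
  by rewrite big_nil subrr cabs0 cabs1 !mul0r.
have xk := xd k; have xk0 := cabs_ge0 (x k).
rewrite big_cons /= exprS; set Q := \prod_(j <- s) _ in IH1 IH2 *.
have Q0 := cabs_ge0 Q.
split.
  have -> : 1 - (1 - x k) * Q = (1 - Q) + x k * Q by ring.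
  rewrite (le_trans (cabsD _ _))// cabsM -natr1.
  have s0 : 0 <= (size s)%:R :> R by [].
  have p0 : 0 <= 2 ^+ size s :> R by rewrite exprn_ge0.
  have m1 : 0 <= (size s)%:R * 2 ^+ size s * d by rewrite !mulr_ge0//; lra.
  have m2 : cabs (x k) * cabs Q <= d * 2 ^+ size s by apply: ler_pM.
  have m3 : 0 <= d * 2 ^+ size s by rewrite mulr_ge0//; lra.
  nra.
rewrite cabsM; apply: ler_pM; rewrite ?cabs_ge0//.
by rewrite (le_trans (cabsB _ _))// cabs1; lra.
Qed.

(** The box sum of the kernel expansion is a product of geometric sums, hence the full kernel times
    the product of the 1 - (z_k / x_k)^N. For |z_k| <= r / 2 these ratios have modulus at most
    1/2. *)
Lemma small_expansion (e : R) : 0 < e -> exists N0, forall N, (N0 <= N)%N ->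
  forall z : @Cn R n, (forall k, cabs (z 0 k) <= r / 2) ->
  cabs (f z - \sum_(a : {ffun 'I_n -> 'I_N}) taylor_coef n (mext a) f * monom n z (mext a)) <= e.
Proof.
move=> e0.
have b0 : 0 <= b by apply: le_trans (cabs_ge0 _) (f_le (z := base) _) => j; rewrite base_torus.
(* In order: the norm bound of the iterated mean, the bound of f, a factor 2 for each kernel, and
   the constant of [one_sub_prod]. *)
pose A := 2 ^+ n * (b * (2 ^+ n * (n%:R * 2 ^+ n))) + 1 : R.
have A0 : 0 < A by rewrite ltr_wpDl// !mulr_ge0// ?mulr_ge0 ?exprn_ge0.
have [N0 HN] := @expr_small _ (2^-1 : R) (e / A) ltac:(apply/andP; split; lra) (divr_gt0 e0 A0).
exists N0 => N /HN {}HN z zr.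
have zr' k : cabs (z 0 k) < r by apply: le_lt_trans (zr k) _; have := r0; lra.
pose T (a : {ffun 'I_n -> 'I_N}) (x : @Cn R n) : C := f x * \prod_(k < n) (z 0 k / x 0 k) ^+ a k.
have bT a : torus_bounded (T a).
  apply: torus_boundedM; first exact: f_bounded.
  apply: torus_bounded_prod => k; exists ((cabs (z 0 k) / r) ^+ a k) => x xT.
  by rewrite cabsX cabsM cabsV xT.
have tE a : taylor_coef n (mext a) f * monom n z (mext a) = torus_lim (enum 'I_n) (T a) base.
  rewrite taylor_coef_int /cauchy_int mulrC -torus_lim_scale; last 2 first.
  - by apply: bounded_integrand => k; rewrite mxE cabs0.
  - exact: base_torus.
  apply: torus_lim_ext; last exact: base_torus.
  move=> x xT; rewrite mulrCA; congr (_ * _); rewrite /monom -big_split; apply: eq_bigr => k _ /=.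
  have x0 : x 0 k != 0 by rewrite -cabs_gt0 xT.
  by rewrite mextE /kern mxE subr0 exprMn exprS; congr (_ * _); rewrite mulrA divff// mul1r.
under eq_bigr do rewrite tE.
rewrite -big_enum /= -torus_lim_sum//; last exact: base_torus.
rewrite -{1}(cauchy_int0 zr').
have bI := bounded_integrand (fun=> 0%N) xpredT zr'.
have -> (X Y : @Cn R n -> C) : torus_bounded X -> torus_bounded Y ->
    torus_lim (enum 'I_n) X base - torus_lim (enum 'I_n) Y base
    = torus_lim (enum 'I_n) (fun x => -1 * Y x + X x) base.
  by move=> bX bY; rewrite torus_lim_lin//; [ring | exact: base_torus].
2: exact: bI. 2: exact: torus_bounded_sum.
have step : cabs (torus_lim (enum 'I_n) (fun x => -1 * (\sum_(i <- enum {ffun 'I_n -> 'I_N}) T i x)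
      + f x * \prod_(k < n) kern 0 (x 0 k) (z 0 k)) base)
   <= 2 ^+ n * (b * (2 ^+ n * (n%:R * 2 ^+ n * 2^-1 ^+ N))).
  rewrite -[X in 2 ^+ X * (b * _)]card_ord cardE; apply: torus_lim_le; last exact: base_torus.
  move=> x xT.
  have -> : -1 * (\sum_(i <- enum {ffun 'I_n -> 'I_N}) T i x) + f x * \prod_(k < n) kern 0 (x 0 k) (z 0 k)
     = f x * (\prod_(k < n) kern 0 (x 0 k) (z 0 k) *
          (1 - \prod_(k <- enum 'I_n) (1 - (z 0 k / x 0 k) ^+ N))).
    rewrite big_enum /= /T -mulr_sumr.
    rewrite -(bigA_distr_bigA (fun (k : 'I_n) (i : 'I_N) => (z 0 k / x 0 k) ^+ i)) big_enum /=.
    have -> : \prod_(i < n) \sum_(j < N) (z 0 i / x 0 i) ^+ j =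
      \prod_(i < n) kern 0 (x 0 i) (z 0 i) * \prod_(i < n) (1 - (z 0 i / x 0 i) ^+ N).
      rewrite -big_split; apply: eq_bigr => k _ /=.
      have x0 : x 0 k != 0 by rewrite -cabs_gt0 xT.
      have xz : x 0 k - z 0 k != 0.
        rewrite subr_eq0; apply/negP => /eqP /(congr1 cabs); rewrite xT => h.
        by have := zr' k; rewrite -h ltxx.
      have := subrX1 (z 0 k / x 0 k) N; set S := \sum_(j < N) _ => h.
      rewrite -opprB h /kern expr1; field; rewrite x0 xz //.
    ring.
  rewrite !cabsM; apply: ler_pM; rewrite ?mulr_ge0 ?cabs_ge0//.
    by apply: f_le => j; rewrite xT.
  apply: ler_pM; rewrite ?cabs_ge0//.
    rewrite cabs_prod -[X in 2 ^+ X]card_ord -prodr_const.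
    apply: ler_prod => k _; rewrite cabs_ge0 /=.
    apply: le_trans (cabs_kern_le (q := r / 2) 0 _ _ (xT k) (zr k)) _; [have := r0; lra | have := r0; lra |].
    have -> : r - r / 2 = r / 2 by field.
    by rewrite expr1 le_eqVlt; apply/orP; left; apply/eqP; field; rewrite gt_eqF.
  have q1 : 2^-1 ^+ N <= 1 :> R by rewrite exprn_ile1//; lra.
  have qk k : cabs ((z 0 k / x 0 k) ^+ N) <= 2^-1 ^+ N.
    rewrite cabsX cabsM cabsV xT; apply: lerXn2r; rewrite ?nnegrE ?divr_ge0 ?cabs_ge0 ?(ltW r0)//.
    by rewrite ler_pdivrMr//; have := zr k; lra.
  by have [] := one_sub_prod (enum 'I_n) q1 qk; rewrite -cardE card_ord.
apply: (le_trans step).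
move: HN; rewrite ler_pdivlMr// => h; apply: le_trans h.
have -> : 2 ^+ n * (b * (2 ^+ n * (n%:R * 2 ^+ n * 2^-1 ^+ N))) =
   2^-1 ^+ N * (2 ^+ n * (b * (2 ^+ n * (n%:R * 2 ^+ n)))) by ring.
by rewrite ler_wpM2l ?exprn_ge0 ?invr_ge0// /A lerDl.
Qed.

End TorusFunctional.

(** * Homogeneous parts *)

Section LatticeNorm.
Context {R : realType}.
Local Notation C := (R[i]).
Variables (Xs : set (nat -> C)) (Xn : (nat -> C) -> R).
Hypothesis XL : banach_seq_lattice Xs Xn.

Let Xs0 : Xs (fun=> 0). Proof. by case: XL => -[]. Qed.
Let XsD x y : Xs x -> Xs y -> Xs (fun k => x k + y k). Proof. by case: XL => -[? + _] *; apply. Qed.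
Let XsZ a x : Xs x -> Xs (fun k => a * x k). Proof. by case: XL => -[? ? +] *; apply. Qed.
Let Xn0 x : Xs x -> 0 <= Xn x. Proof. by case: XL => _ [+ _ _ _] _ _ _ => /[apply]. Qed.
Let Xn_eq0 x : Xs x -> Xn x = 0 -> x = fun=> 0. Proof. by case: XL => _ [_ + _ _] _ _ _ => /[apply]. Qed.
Let XnZ a x : Xs x -> Xn (fun k => a * x k) = cabs a * Xn x.
Proof. by case: XL => _ [_ _ + _] _ _ _ => /[apply]. Qed.
Let XnD x y : Xs x -> Xs y -> Xn (fun k => x k + y k) <= Xn x + Xn y.
Proof. by case: XL => _ [_ _ _ +] _ _ _ => H hx hy; apply: H. Qed.
Let Xideal x y : Xs y -> (forall k, cabs (x k) <= cabs (y k)) -> Xs x /\ Xn x <= Xn y.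
Proof. by case: XL => _ _ _ + _; apply. Qed.
Let Xunit k : Xs (seq_unit k). Proof. by case: XL. Qed.

Lemma Xn_unit_gt0 k : 0 < Xn (seq_unit k).
Proof.
rewrite lt0r Xn0// andbT; apply/eqP => /(Xn_eq0 (Xunit k)) /(congr1 (fun u => u k)).
by rewrite /seq_unit eqxx => /eqP; rewrite oner_eq0.
Qed.

Definition emb n (z : @Cn R n) : nat -> C := fun j => \sum_(k < n) (cabs (z 0 k))%:C%C * seq_unit k j.

Lemma emb_ord n (z : @Cn R n) (k : 'I_n) : emb z k = (cabs (z 0 k))%:C%C.
Proof.
rewrite /emb (bigD1 k)//= /seq_unit eqxx mulr1 big1 ?addr0// => i ik.
by case: eqP => [e|]; rewrite ?mulr0//; case/eqP: ik; exact/val_inj.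
Qed.

Lemma emb_out n (z : @Cn R n) j : (n <= j)%N -> emb z j = 0.
Proof.
move=> nj; rewrite /emb big1// => i _; rewrite /seq_unit; case: eqP => [e|]; rewrite ?mulr0//.
by have := ltn_ord i; rewrite -e ltnNge nj.
Qed.

Lemma emb_Xs n (z : @Cn R n) : Xs (emb z).
Proof.
suff H (s : seq 'I_n) : Xs (fun j => \sum_(k <- s) (cabs (z 0 k))%:C%C * seq_unit k j).
  have := H (enum 'I_n); congr Xs; apply/funext => j.
  by rewrite /emb big_enum.
elim: s => [|k s IH].
  by rewrite (_ : (fun j => _) = fun=> 0)//; apply/funext => j; rewrite big_nil.
rewrite (_ : (fun j => _) = fun j => (cabs (z 0 k))%:C%C * seq_unit k j + \sum_(k <- s) (cabs (z 0 k))%:C%C * seq_unit k j).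
  by apply: (XsD (x := fun j => (cabs (z 0 k))%:C%C * seq_unit k j)) => //; apply: XsZ.
by apply/funext => j; rewrite big_cons.
Qed.

Lemma Xn_normE n (z : @Cn R n) : Xn_norm Xn n z = Xn (emb z).
Proof. by []. Qed.

Lemma Xn_norm_ge0 n (z : @Cn R n) : 0 <= Xn_norm Xn n z.
Proof. by apply: Xn0; apply: emb_Xs. Qed.

Lemma Xn_normZ n (a : C) (z : @Cn R n) : Xn_norm Xn n (a *: z) = cabs a * Xn_norm Xn n z.
Proof.
have -> : cabs a = cabs (cabs a)%:C%C by rewrite cabs_real ger0_norm ?cabs_ge0.
rewrite !Xn_normE -XnZ; last exact: emb_Xs.
congr Xn; apply/funext => j; rewrite /emb mulr_sumr; apply: eq_bigr => k _.
by rewrite mxE cabsM rmorphM mulrA.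
Qed.

Lemma Xn_norm_mono n (z y : @Cn R n) : (forall k, cabs (z 0 k) <= cabs (y 0 k)) ->
  Xn_norm Xn n z <= Xn_norm Xn n y.
Proof.
move=> zy; rewrite !Xn_normE; apply: (Xideal (emb_Xs y) _).2 => j.
case: (ltnP j n) => jn; last by rewrite !emb_out ?lexx.
by rewrite -[j]/(val (Ordinal jn)) !emb_ord !cabs_real !ger0_norm ?cabs_ge0.
Qed.

Lemma coord_le_norm n (z : @Cn R n) (k : 'I_n) :
  cabs (z 0 k) * Xn (seq_unit k) <= Xn_norm Xn n z.
Proof.
have -> : cabs (z 0 k) = cabs (cabs (z 0 k))%:C%C by rewrite cabs_real ger0_norm ?cabs_ge0.
rewrite -XnZ// Xn_normE; apply: (Xideal (emb_Xs z) _).2 => j.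
rewrite /seq_unit; case: eqP => [->|_]; last by rewrite mulr0 cabs0 cabs_ge0.
by rewrite mulr1 emb_ord.
Qed.

Lemma Xn_norm_le_sum n (z : @Cn R n) (r : R) : (forall k, cabs (z 0 k) <= r) ->
  Xn_norm Xn n z <= r * \sum_(k < n) Xn (seq_unit k).
Proof.
move=> zr.
suff H (s : seq 'I_n) : Xs (fun j => \sum_(k <- s) (cabs (z 0 k))%:C%C * seq_unit k j) /\
   Xn (fun j => \sum_(k <- s) (cabs (z 0 k))%:C%C * seq_unit k j) <= r * \sum_(k <- s) Xn (seq_unit k).
  have [_] := H (enum 'I_n); rewrite !big_enum; congr (Xn _ <= _); apply/funext => j.
  by rewrite big_enum.
elim: s => [|k s [IH1 IH2]].
  rewrite (_ : (fun j => _) = fun=> 0); last by apply/funext => j; rewrite big_nil.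
  split => //; rewrite big_nil mulr0.
  have := XnZ 0 Xs0; rewrite cabs0 (mul0r (Xn _)) => <-.
  by rewrite (_ : (fun k => _) = fun=> 0)//; apply/funext => j; rewrite mulr0.
rewrite (_ : (fun j => _) = fun j => (cabs (z 0 k))%:C%C * seq_unit k j + \sum_(k <- s) (cabs (z 0 k))%:C%C * seq_unit k j); last first.
  by apply/funext => j; rewrite big_cons.
split; first by apply: (XsD (x := fun j => (cabs (z 0 k))%:C%C * seq_unit k j)) => //; apply: XsZ.
rewrite big_cons mulrDr; apply: le_trans (XnD (x := fun j => (cabs (z 0 k))%:C%C * seq_unit k j) _ _) _ => //.
  exact: XsZ.
apply: lerD => //; rewrite XnZ// cabs_real ger0_norm ?cabs_ge0//.
by rewrite ler_wpM2r// Xn0.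
Qed.

End LatticeNorm.

(** * Homogeneous parts as Fourier coefficients of slices *)

Section HomogeneousParts.
Context {R : realType}.
Local Notation C := (R[i]).

Lemma derivable_line (V : normedModType C) (f : V -> C^o) (g : C^o -> C^o) (a v : V) (x : C^o) :
  (forall h : C, g (h + x) = f (h *: v + a)) -> derivable f a v -> derivable g x 1.
Proof.
move=> gf; rewrite /derivable.
suff -> : (fun h : C => h^-1 *: ((g \o shift x) (h *: (1 : C^o)) - g x)) =
   (fun h : C => h^-1 *: ((f \o shift a) (h *: v) - f a)) by [].
apply/funext => h /=; rewrite -gf; congr (_ *: (g (_ + _) - _)).
  by rewrite /GRing.scale /= mulr1.
by rewrite -[in LHS](add0r x) gf scale0r add0r.
Qed.

Definition mdeg n N (a : {ffun 'I_n -> 'I_N}) : nat := (\sum_(k < n) a k)%N.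

(** N only bounds the single exponents; every N > m gives the whole homogeneous part
    ([hpart_widen]). *)
Definition hpart n (f : @Cn R n -> C^o) (m N : nat) (z : @Cn R n) : C :=
  \sum_(a : {ffun 'I_n -> 'I_N} | mdeg a == m) taylor_coef n (mext a) f * monom n z (mext a).

Lemma hpart_widen n (f : @Cn R n -> C^o) m N N' z : (m < N)%N -> (N <= N')%N ->
  hpart f m N' z = hpart f m N z.
Proof.
move=> mN NN'; rewrite /hpart.
pose w (a : {ffun 'I_n -> 'I_N}) : {ffun 'I_n -> 'I_N'} := [ffun k => widen_ord NN' (a k)].
have N0 : (0 < N)%N by apply: leq_ltn_trans mN.
pose w' (a : {ffun 'I_n -> 'I_N'}) : {ffun 'I_n -> 'I_N} := [ffun k => insubd (Ordinal N0) (val (a k))].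
have wE a : mext (w a) = mext a.
  apply/funext => k; rewrite /mext; case: insub => // i; by rewrite ffunE.
rewrite (reindex_onto w w'); last first.
  move=> a /eqP am; apply/ffunP => k; apply/val_inj; rewrite !ffunE /= val_insubd.
  case: ltnP => // h; exfalso; have : (a k <= mdeg a)%N by rewrite /mdeg (bigD1 k)//= leq_addr.
  by rewrite am leqNgt (leq_trans mN h).
apply: eq_big => [a|a _]; last by rewrite wE.
rewrite (_ : w' (w a) == a) ?andbT.
  by congr (_ == _); apply: eq_bigr => k _; rewrite ffunE.
by apply/eqP/ffunP => k; apply/val_inj; rewrite !ffunE val_insubd /= ltn_ord.
Qed.

Lemma monomZ n (z : @Cn R n) (w : C) N (a : {ffun 'I_n -> 'I_N}) :
  monom n (w *: z) (mext a) = w ^+ mdeg a * monom n z (mext a).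
Proof.
rewrite /monom /mdeg.
under eq_bigr do rewrite mxE exprMn.
rewrite big_split /= prodrXr; congr (_ ^+ _ * _); apply: eq_bigr => k _; by rewrite mextE.
Qed.

Variables (Xs : set (nat -> C)) (Xn : (nat -> C) -> R).
Hypothesis XL : banach_seq_lattice Xs Xn.
Variables (n : nat) (f : @Cn R n -> C^o).
Hypothesis f_hol : holomorphic_on n (Xball Xn n 1) f.
Variable b : R.
Hypothesis f_le : forall z, Xball Xn n 1 z -> cabs (f z) <= b.

Lemma ball_disc z (u : C) : Xball Xn n 1 z -> cabs u <= 1 -> Xball Xn n 1 (u *: z).
Proof.
rewrite /Xball /= => z1 u1; rewrite (Xn_normZ XL); apply: le_lt_trans z1.
by rewrite ler_piMl// (Xn_norm_ge0 XL).
Qed.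

Lemma slice_derivable z (u : C^o) : Xball Xn n 1 z -> cabs u <= 1 ->
  derivable ((fun x : C^o => f (x *: z)) : C^o -> C^o) u 1.
Proof.
move=> z1 u1; apply: (derivable_line (f := f) (v := z) (a := u *: z)) => [h|].
  by rewrite scalerDl.
by apply: diff_derivable; apply: f_hol; apply: ball_disc.
Qed.

Lemma hpart_small (r : R) : 0 < r -> (forall z : @Cn R n, (forall k, cabs (z 0 k) <= r) -> Xball Xn n 1 z) ->
  forall (z : @Cn R n) m N, (m < N)%N -> (forall k, cabs (z 0 k) <= r / 2) ->
  ctends (fun d => cmean d (fun w => f (w *: z) * w^-1 ^+ m)) (hpart f m N z).
Proof.
move=> r0 rB z m N mN zr e e0.
have [ulim [l1 l2 l3]] := @ultra_limit_ex R.
have fd (y : @Cn R n) (k : 'I_n) (x : C) : (forall j, cabs (y 0 j) <= r) -> cabs x <= r ->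
    derivable ((fun u : C^o => f (upd y k u)) : C^o -> C^o) x 1.
  move=> yr xr; apply: (derivable_line (f := f) (v := delta_mx 0 k) (a := upd y k x)) => [h|].
    congr f; apply/rowP => j; rewrite !mxE eqxx /=; case: eqP => _; first by rewrite mulr1.
    by rewrite mulr0 add0r.
  apply: diff_derivable; apply: f_hol; apply: rB => j; rewrite mxE.
  by case: eqP.
have fb (y : @Cn R n) : (forall j, cabs (y 0 j) <= r) -> cabs (f y) <= b.
  by move=> yr; apply/f_le/rB.
have [N0 HN] := small_expansion r0 l1 l2 l3 fd fb e0.
pose N' := maxn N0 N.
have {}HN := HN N' (leq_maxl _ _).
(* Beyond this order all exponents of the truncated series stay below 2^d, so no two degrees are
   confused by the mean. *)
have [d0 Hd] := pow2_gt_ex (n * N' + m).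
exists d0 => d /Hd dd.
pose S (w : C) := \sum_(a : {ffun 'I_n -> 'I_N'}) taylor_coef n (mext a) f * monom n (w *: z) (mext a).
have ES : cmean d (fun w => S w * w^-1 ^+ m) = hpart f m N z.
  transitivity (cmean d (fun w => \sum_(a : {ffun 'I_n -> 'I_N'})
     (taylor_coef n (mext a) f * monom n z (mext a)) * (w ^+ mdeg a * w^-1 ^+ m))).
    apply: eq_cmean => w _; rewrite /S mulr_suml; apply: eq_bigr => a _.
    by rewrite monomZ; ring.
  rewrite cmean_sum -(@hpart_widen n f m N N')// ?leq_maxr// /hpart big_mkcond /=.
  rewrite [RHS]big_mkcond /=; apply: eq_bigr => a _.
  rewrite cmeanZ cmean_mono; last 2 first.
  - apply: leq_ltn_trans dd; apply: leq_trans (leq_addr _ _).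
    rewrite /mdeg -[X in (_ <= X * _)%N]card_ord -sum_nat_const.
    by apply: leq_sum => k _; exact: ltnW.
  - by apply: leq_ltn_trans dd; rewrite leq_addl.
  by case: eqP; rewrite ?mulr1 ?mulr0.
rewrite -ES -cmeanB; apply: cabs_cmean => w w1.
rewrite -mulrBl cabsM cabsX cabsV w1 invr1 expr1n mulr1.
by apply: HN => k; rewrite mxE cabsM w1 mul1r.
Qed.

Lemma hpartZ (z : @Cn R n) (u : C) m N : hpart f m N (u *: z) = u ^+ m * hpart f m N z.
Proof.
rewrite /hpart mulr_sumr; apply: eq_bigr => a /eqP am; rewrite monomZ am; ring.
Qed.

(** The expansion is available only near 0. On the slice through z, [annulus_means] moves the mean
    from radius 1 to a radius t at which t z is small, and homogeneity restores the factor t^m. *)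
Lemma hpart_limit z m N : Xball Xn n 1 z -> (m < N)%N ->
  ctends (fun d => cmean d (fun w => f (w *: z) * w^-1 ^+ m)) (hpart f m N z).
Proof.
move=> z1 mN.
pose sg : R := \sum_(k < n) Xn (seq_unit k).
have sg0 : 0 <= sg by apply: sumr_ge0 => k _; rewrite ltW// (Xn_unit_gt0 XL).
pose r : R := (1 + sg)^-1 / 2.
have r0 : 0 < r by rewrite divr_gt0// invr_gt0; lra.
have rB (y : @Cn R n) : (forall k, cabs (y 0 k) <= r) -> Xball Xn n 1 y.
  move=> yr; rewrite /Xball /=; apply: le_lt_trans (Xn_norm_le_sum XL yr) _.
  rewrite -/sg /r mulrAC ltr_pdivrMr// mulrC -ltr_pdivlMr ?invr_gt0; last lra.
  rewrite invrK; lra.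
clearbody r; pose sz : R := \sum_(k < n) cabs (z 0 k).
have sz0 : 0 <= sz by apply: sumr_ge0 => k _; exact: cabs_ge0.
pose t := (r / 2) / (r + sz).
have t0 : 0 < t by apply: divr_gt0; lra.
have t1 : t <= 1 by rewrite ler_pdivrMr; lra.
have tz k : cabs ((t%:C%C *: z) 0 k) <= r / 2.
  rewrite mxE cabsM cabs_real gtr0_norm// /t mulrAC ler_pdivrMr; last lra.
  rewrite ler_wpM2l//; first lra.
  have S0 : 0 <= \sum_(i < n | i != k) cabs (z 0 i) by apply: sumr_ge0 => i _; exact: cabs_ge0.
  by rewrite (_ : sz = cabs (z 0 k) + \sum_(i < n | i != k) cabs (z 0 i)); [lra | rewrite /sz (bigD1 k)].
have H1 := hpart_small r0 rB mN tz.
have tC : t%:C%C != 0 :> C by rewrite -cabs_gt0 cabs_real normr_gt0 gt_eqF.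
(* One power more than m, because [annulus_means] multiplies by the variable. *)
pose h : C^o -> C^o := fun u => f (u *: z) * u^-1 ^+ m.+1.
have hd u : t <= cabs u <= 1 -> derivable h u 1.
  move=> /andP[u1 u2]; apply: (derivable_mul_invX (f := fun u => f (u *: z))).
    exact: slice_derivable.
  by rewrite -cabs_gt0; apply: lt_le_trans u1.
have H2 := annulus_means t0 t1 hd.
have := ctendsD H2 (ctendsZ (t%:C%C^-1 ^+ m) H1).
rewrite hpartZ add0r mulrA -exprMn mulVf// expr1n mul1r.
apply: (@ctends_ext _ _ _ _ 0%N) => d _.
rewrite -cmeanZ.
have e1 : cmean d (fun w => h (1%:C%C * w) * (1%:C%C * w)) = cmean d (fun w => f (w *: z) * w^-1 ^+ m).
  apply: eq_cmean => w w1; have w0 : w != 0 by rewrite -cabs_gt0 w1.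
  by rewrite /h rmorph1 mul1r exprSr; rewrite -!mulrA mulVf// mulr1.
have e2 : cmean d (fun w => h (t%:C%C * w) * (t%:C%C * w)) =
   cmean d (fun w => t%:C%C^-1 ^+ m * (f (w *: (t%:C%C *: z)) * w^-1 ^+ m)).
  apply: eq_cmean => w w1; have w0 : w != 0 by rewrite -cabs_gt0 w1.
  rewrite /h exprSr scalerA [w * _]mulrC -!mulrA mulVf ?mulf_neq0// mulr1.
  rewrite invfM exprMn; ring.
by rewrite e1 e2 subrK.
Qed.

(** Cauchy's formula at 0 for u |-> f (u z) u^m, which vanishes there. It removes the conjugate term
    in [hpart_le_gap]. *)
Lemma neg_limit z m : Xball Xn n 1 z -> (0 < m)%N ->
  ctends (fun d => cmean d (fun w => f (w *: z) * w ^+ m)) 0.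
Proof.
move=> z1 m0; pose g : C^o -> C^o := (fun x : C^o => f (x *: z) : C^o) * (id ^+ m : C^o -> C^o).
have gE u : g u = f (u *: z) * u ^+ m by rewrite -[LHS]/(f (u *: z) * _) exprfctE.
have gd u : cabs u <= 1 -> derivable g u 1.
  move=> u1; apply: (@derivableM C C^o); first exact: slice_derivable.
  by apply: derivableX; exact: derivable_id.
have := @cauchy_circle _ g 1 0 gd; rewrite cabs0 ltr01 => /(_ isT).
rewrite gE expr0n gtn_eqF//= mulr0; apply: (@ctends_ext _ _ _ _ 0%N) => d _.
apply: eq_cmean => w w1; have w0 : w != 0 by rewrite -cabs_gt0 w1.
by rewrite rmorph1 mul1r subr0 divff// mulr1 gE.
Qed.

Lemma hpart_le z m N : Xball Xn n 1 z -> (m < N)%N -> cabs (hpart f m N z) <= b.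
Proof.
move=> z1 mN; apply: (ctends_le (N := 0%N) (hpart_limit z1 mN)) => d _.
apply: cabs_cmean => w w1.
rewrite cabsM cabsX cabsV w1 invr1 expr1n mulr1; apply: f_le; apply: ball_disc => //.
by rewrite w1.
Qed.

Lemma cabs_cmean_Re l (F G : C -> C) : (forall w, cabs w = 1 -> cabs (F w) <= complex.Re (G w)) ->
  cabs (cmean l F) <= complex.Re (cmean l G).
Proof.
move=> FG; rewrite /cmean.
have -> : (2 ^ l)%:R^-1 = ((2 ^ l)%:R^-1 : R)%:C%C by rewrite fmorphV rmorph_nat.
rewrite cabsM cabs_real ger0_norm// [in leRHS]mulrC Re_realM mulrC ler_wpM2l//.
rewrite (le_trans (cabs_sum _ _ _))// Re_sum; apply: ler_sum => k _.
by apply: FG; rewrite cabsX cabs_uroot expr1n.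
Qed.

(* A function with nonnegative real part has Taylor coefficients bounded by
   twice the real part of its value at the centre; apply this to b - eta f. *)
Lemma hpart_le_gap z m N : Xball Xn n 1 z -> (0 < m)%N -> (m < N)%N ->
  cabs (hpart f m N z) <= 2 * (b - cabs (hpart f 0 N z)).
Proof.
move=> z1 m0 mN.
have L0 := hpart_limit z1 (leq_ltn_trans (leq0n m) mN).
have Lm := hpart_limit z1 mN.
have Ln := neg_limit z1 m0.
set P0 := hpart f 0 N z in L0 *; set Pm := hpart f m N z in Lm *.
have [eta eta1 etaP] : exists2 eta : C, cabs eta = 1 & eta * P0 = (cabs P0)%:C%C.
  have [P00|P00] := eqVneq P0 0.
    by exists 1; rewrite ?cabs1// P00 mulr0 cabs0.
  exists ((P0^*)%C / (cabs P0)%:C%C).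
    by rewrite cabsM cabsV cabs_real ger0_norm ?cabs_ge0// cabs_conj divff// cabs_eq0.
  have cC : (cabs P0)%:C%C != 0 :> C by rewrite -cabs_gt0 cabs_real normr_gt0 cabs_eq0.
  rewrite mulrAC [_ * P0]mulrC conj_mul_cabs rmorphXn expr2 mulfK//.
pose h w := b%:C%C - eta * f (w *: z).
have hRe w : cabs w = 1 -> 0 <= complex.Re (h w).
  move=> w1; have fw : cabs (eta * f (w *: z)) <= b.
    by rewrite cabsM eta1 mul1r; apply: f_le; apply: ball_disc; rewrite ?w1.
  have := Re_le_cabs (eta * f (w *: z)); rewrite /h raddfB /=; lra.
have [d0 Hd0] := pow2_gt_ex m.
have key d : (d0 <= d)%N ->
  cabs (- eta * cmean d (fun w => f (w *: z) * w^-1 ^+ m) - ((eta * cmean d (fun w => f (w *: z) * w ^+ m))^*)%C)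
   <= 2 * (b - complex.Re (eta * cmean d (fun w => f (w *: z) * w^-1 ^+ 0))).
  move=> /Hd0 dd.
  have E1 : cmean d (fun w => h w * w^-1 ^+ m) = - eta * cmean d (fun w => f (w *: z) * w^-1 ^+ m).
    transitivity (cmean d (fun w => b%:C%C * (w ^+ 0 * w^-1 ^+ m) - eta * (f (w *: z) * w^-1 ^+ m))).
      by apply: eq_cmean => w _; rewrite /h expr0; ring.
    rewrite cmeanB cmeanZ [X in _ - X]cmeanZ cmean_mono ?expn_gt0//.
    by rewrite (_ : (0%N == m) = false) ?mulr0 ?sub0r ?mulNr// eq_sym gtn_eqF.
  have E2 : cmean d (fun w => ((h w * w ^+ m)^*)%C) = - ((eta * cmean d (fun w => f (w *: z) * w ^+ m))^*)%C.
    rewrite cmean_conj -rmorphN; congr (_^*)%C.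
    transitivity (cmean d (fun w => b%:C%C * (w ^+ m * w^-1 ^+ 0) - eta * (f (w *: z) * w ^+ m))).
      by apply: eq_cmean => w _; rewrite /h expr0; ring.
    rewrite cmeanB cmeanZ [X in _ - X]cmeanZ cmean_mono ?expn_gt0//.
    by rewrite (gtn_eqF m0) mulr0 sub0r.
  have E3 : complex.Re (cmean d (fun w => 2%:R * h w)) = 2 * (b - complex.Re (eta * cmean d (fun w => f (w *: z) * w^-1 ^+ 0))).
    rewrite -cmeanZ -[X in X - _]/(complex.Re (b%:C%C)) -raddfB.
    rewrite -[b%:C%C](cmean_cst d) -cmeanB -[2](ger0_norm (ler0n _ 2)) -Re_realM.
    rewrite ger0_norm// rmorph_nat -cmeanZ; congr (complex.Re _); apply: eq_cmean => w _.
    by rewrite /h expr0 mulr1.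
  rewrite -E1 -E2 -E3 -cmeanD; apply: cabs_cmean_Re => w w1.
  (* On the circle conj (w^m) = w^-m, so adding the conjugate replaces h by twice its nonnegative
     real part, whose modulus is itself. *)
  have -> : h w * w^-1 ^+ m + ((h w * w ^+ m)^*)%C = (2 * complex.Re (h w))%:C%C * w^-1 ^+ m.
    have -> : ((h w * w ^+ m)^*)%C = ((h w)^*)%C * w^-1 ^+ m.
      by rewrite [LHS]rmorphM rmorphXn /= cabs1V.
    by rewrite -mulrDl addcJ; congr (_ * _); rewrite rmorphM rmorph_nat.
  rewrite cabsM cabsX cabsV w1 invr1 expr1n mulr1 cabs_real ger0_norm ?mulr_ge0 ?hRe//.
  have := Re_realM 2 (h w); rewrite rmorph_nat => ->; exact: lexx.
apply/ler_addgt0Pr => e e0; have e4 : 0 < e / 4 by rewrite divr_gt0.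
have [n1 H1] := L0 _ e4; have [n2 H2] := Lm _ e4; have [n3 H3] := Ln _ e4.
pose d := maxn (maxn n1 n2) (maxn n3 d0).
have {}H1 := H1 d ltac:(rewrite /d; lia); have {}H2 := H2 d ltac:(rewrite /d; lia).
have {}H3 := H3 d ltac:(rewrite /d; lia); have {}key := key d ltac:(rewrite /d; lia).
set A := cmean d _ in H1 key; set B := cmean d _ in H2 key; set D := cmean d _ in H3 key.
have k1 : cabs P0 - e / 4 <= complex.Re (eta * A).
  have -> : eta * A = eta * P0 + eta * (A - P0) by ring.
  have := normRe_le (eta * (A - P0)); rewrite cabsM eta1 mul1r ler_norml => /andP[+ _].
  rewrite raddfD etaP /=; lra.
have k2 : cabs Pm <= cabs (- eta * B - ((eta * D)^*)%C) + e / 4 + e / 4.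
  have := cabsB (- eta * B - ((eta * D)^*)%C) (- eta * (B - Pm) - ((eta * (D - 0))^*)%C).
  have -> : - eta * B - ((eta * D)^*)%C - (- eta * (B - Pm) - ((eta * (D - 0))^*)%C) = - eta * Pm.
    rewrite subr0; ring.
  rewrite cabsM cabsN eta1 mul1r.
  have := cabsB (- eta * (B - Pm)) ((eta * (D - 0))^*)%C.
  rewrite cabs_conj !cabsM cabsN eta1 !mul1r; lra.
lra.
Qed.

End HomogeneousParts.

(** * The Sidon-type estimate *)

Section FiniteSums.
Context {R : realType}.

Lemma cauchy_schwarz_sum (I : Type) (s : seq I) (P : pred I) (x y : I -> R) :
  (\sum_(i <- s | P i) x i * y i) ^+ 2 <=
  (\sum_(i <- s | P i) x i ^+ 2) * (\sum_(i <- s | P i) y i ^+ 2).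
Proof.
set X := \sum_(i <- s | P i) x i ^+ 2; set Y := \sum_(i <- s | P i) y i ^+ 2.
set Z := \sum_(i <- s | P i) x i * y i.
have X0 : 0 <= X by apply: sumr_ge0 => i _; rewrite sqr_ge0.
have H t : 0 <= t ^+ 2 * X - 2 * t * Z + Y.
  have -> : t ^+ 2 * X - 2 * t * Z + Y = \sum_(i <- s | P i) (t * x i - y i) ^+ 2.
    rewrite /X /Y /Z !mulr_sumr -sumrN -!big_split; apply: eq_bigr => i _ /=; ring.
  by apply: sumr_ge0 => i _; rewrite sqr_ge0.
have [X00|X00] := eqVneq X 0.
  rewrite X00 mul0r; have := H ((Y + 1) / Z / 2); rewrite X00 mulr0 add0r.
  have [->|Z0] := eqVneq Z 0; first by rewrite expr0n.
  have -> : 2 * ((Y + 1) / Z / 2) * Z = Y + 1 by field.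
  by lra.
have Xp : 0 < X by rewrite lt0r X00.
have := H (Z / X); have -> : (Z / X) ^+ 2 * X - 2 * (Z / X) * Z + Y = Y - Z ^+ 2 / X by field.
by rewrite subr_ge0 ler_pdivrMr// mulrC.
Qed.

Lemma sqr_sum_le_card (I : finType) (P : pred I) (x : I -> R) :
  (\sum_(i | P i) x i) ^+ 2 <= #|P|%:R * \sum_(i | P i) x i ^+ 2.
Proof.
have := cauchy_schwarz_sum (index_enum I) P (fun=> 1) x.
under eq_bigr do rewrite mul1r.
under [X in _ <= X * _]eq_bigr do rewrite expr1n.
by rewrite sumr_const.
Qed.

Lemma geom_sum_le (x : R) N : 0 <= x < 1 -> \sum_(i < N) x ^+ i <= (1 - x)^-1.
Proof.
move=> /andP[x0 x1]; have h : 0 < 1 - x by lra.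
rewrite -[leRHS]mul1r ler_pdivlMr// mulrC -opprB mulNr -subrX1 opprB.
by rewrite gerBl exprn_ge0.
Qed.

(** Give each monomial the weight x^(m-1), one power of z_j having been removed, and bound the total
    by (1 - x)^-n. The choice x = m / (n + m) makes this (1 + m/n)^n <= e^m. *)
Lemma mono_count (n m N : nat) (j : 'I_n) : (0 < m)%N ->
  (#|[pred a : {ffun 'I_n -> 'I_N} | (mdeg a == m) && (0 < a j)%N]|%:R : R)
  <= expR m%:R * ((n + m)%:R / m%:R) ^+ m.-1.
Proof.
move=> m0; have n0 : (0 < n)%N by apply: leq_ltn_trans (ltn_ord j).
have nR : 0 < n%:R :> R by rewrite ltr0n.
have mR : 0 < m%:R :> R by rewrite ltr0n.
have nmR : 0 < (n + m)%:R :> R by rewrite ltr0n addn_gt0 n0.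
pose x : R := m%:R / (n + m)%:R.
have x0 : 0 < x by rewrite divr_gt0.
have x1 : x < 1 by rewrite ltr_pdivrMr// mul1r ltr_nat -{1}[m]add0n ltn_add2r.
rewrite -[(n + m)%:R / m%:R]invf_div -/x exprVn -[leRHS]/(_ / _) ler_pdivlMr ?exprn_gt0//.
pose g (k : 'I_n) (i : 'I_N) : R := if k == j then (0 < i)%N%:R * x ^+ i.-1 else x ^+ i.
have g0 k i : 0 <= g k i by rewrite /g; case: eqP => _; [apply: mulr_ge0 => // |]; apply: exprn_ge0; exact: ltW.
apply: (@le_trans _ _ (\sum_(a : {ffun 'I_n -> 'I_N}) \prod_(k < n) g k (a k))).
  rewrite -sum1_card natr_sum mulr_suml.
  rewrite [leLHS]big_mkcond; apply: ler_sum => a _.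
  case: ifP => [/andP[/eqP am aj]|_]; last by apply: prodr_ge0.
  rewrite mul1r (bigD1 j)//= {1}/g eqxx aj mul1r.
  have -> : \prod_(k < n | k != j) g k (a k) = x ^+ (\sum_(k < n | k != j) a k)%N.
    by rewrite -prodrXr; apply: eq_bigr => k kj; rewrite /g (negbTE kj).
  rewrite -exprD le_eqVlt; apply/orP; left; apply/eqP; congr (_ ^+ _).
  by rewrite -am /mdeg (bigD1 j)//=; case: (nat_of_ord (a j)) aj.
rewrite -(bigA_distr_bigA g).
apply: (@le_trans _ _ (\prod_(k < n) (1 - x)^-1)).
  apply: ler_prod => k _; apply/andP; split; first exact: sumr_ge0.
  have x01 : 0 <= x < 1 by rewrite ltW.
  rewrite /g; case: eqP => _; last exact: geom_sum_le.
  apply: le_trans (geom_sum_le N.-1 x01).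
  case: N g g0 => [|N'] _ _; first by rewrite big_ord0 /= big_ord0.
  by rewrite big_ord_recl /= mul0r add0r ler_sum// => i _; rewrite /= mul1r.
rewrite prodr_const card_ord.
have -> : (1 - x)^-1 = 1 + m%:R / n%:R.
  by rewrite /x natrD; field; rewrite -natrD !gt_eqF.
have -> : expR m%:R = expR (m%:R / n%:R) ^+ n :> R.
  by rewrite -expRM_natl; congr expR; field; rewrite gt_eqF.
by apply: lerXn2r; rewrite ?nnegrE ?expR_ge0 ?expR_ge1Dx// addr_ge0// divr_ge0// ltW.
Qed.

End FiniteSums.

(** * Norms of homogeneous polynomials on finite subgroups of the torus *)

Section TorusPolynomials.
Context {R : realType}.
Local Notation C := (R[i]).
Variables (n l : nat).
Local Notation L := (2 ^ l)%N.

Definition tpt (t : {ffun 'I_n -> 'I_(2 ^ l)}) (k : 'I_n) : C := uroot l ^+ t k.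

Definition mono N (a : {ffun 'I_n -> 'I_N}) (w : 'I_n -> C) : C := \prod_(k < n) w k ^+ a k.

Definition tpoly N (A : {ffun 'I_n -> 'I_N} -> C) (w : 'I_n -> C) : C := \sum_a A a * mono a w.

Lemma cabs_tpt t k : cabs (tpt t k) = 1.
Proof. by rewrite cabsX cabs_uroot expr1n. Qed.

Lemma mono_orth N (a c : {ffun 'I_n -> 'I_N}) : (N <= L)%N ->
  \sum_t mono a (tpt t) * ((mono c (tpt t))^*)%C = ((L ^ n)%N * (a == c))%:R.
Proof.
move=> NL.
have E t : mono a (tpt t) * ((mono c (tpt t))^*)%C =
   \prod_(k < n) ((uroot l ^+ t k) ^+ a k * (uroot l ^+ t k)^-1 ^+ c k).
  rewrite /mono rmorph_prod -big_split; apply: eq_bigr => k _ /=.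
  by rewrite rmorphXn /= -cabs1V// cabs_tpt.
under eq_bigr do rewrite E.
rewrite -(bigA_distr_bigA (fun (k : 'I_n) (i : 'I_(2 ^ l)) => (uroot l ^+ i) ^+ a k * (uroot l ^+ i)^-1 ^+ c k)).
have S k : \sum_(i < L) ((uroot l ^+ i) ^+ a k * (uroot l ^+ i)^-1 ^+ c k) = (L%:R * (a k == c k)%:R : C).
  have := @cmean_mono R l (a k) (c k) (leq_trans (ltn_ord _) NL) (leq_trans (ltn_ord _) NL).
  rewrite /cmean => /(congr1 (fun u => u * L%:R)); rewrite divfK ?Lneq0// => ->.
  by rewrite mulrC.
under eq_bigr do rewrite S.
rewrite big_split /= prodr_const card_ord -natrX natrM; congr (_ * _).
case: eqP => [->|ac]; first by rewrite big1// => k _; rewrite eqxx.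
have [k kac] : exists k, a k != c k.
  apply/existsP; rewrite -negb_forall; apply/negP => /forallP h; apply: ac.
  by apply/ffunP => k; apply/eqP.
by rewrite (bigD1 k)//= -[a k == c k]/(a k == c k :> 'I_N) (negbTE kac) mul0r.
Qed.

Lemma tpoly_parseval N (A : {ffun 'I_n -> 'I_N} -> C) : (N <= L)%N ->
  \sum_t cabs (tpoly A (tpt t)) ^+ 2 = (L ^ n)%:R * \sum_a cabs (A a) ^+ 2.
Proof.
move=> NL; apply: (@complexI R).
rewrite rmorph_sum rmorphM rmorph_nat rmorph_sum /=.
under eq_bigr do rewrite -conj_mul_cabs.
under [in RHS]eq_bigr do rewrite -conj_mul_cabs.
transitivity (\sum_a \sum_c A a * ((A c)^*)%C * \sum_t mono a (tpt t) * ((mono c (tpt t))^*)%C).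
  under [RHS]eq_bigr do under eq_bigr do rewrite mulr_sumr.
  under [RHS]eq_bigr do rewrite exchange_big.
  rewrite [RHS]exchange_big /=; apply: eq_bigr => t _.
  rewrite /tpoly rmorph_sum /= mulr_suml; apply: eq_bigr => a _.
  rewrite mulr_sumr; apply: eq_bigr => c _; rewrite rmorphM /=; ring.
rewrite [RHS]mulr_sumr; apply: eq_bigr => a _.
rewrite (bigD1 a)//= [X in _ + X]big1 ?addr0.
  by rewrite mono_orth// eqxx muln1 mulrC.
by move=> c ca; rewrite mono_orth// eq_sym (negbTE ca) muln0 mulr0.
Qed.

(** The number of divisors of a monomial is a product of the g_k + 1, and g_k + 1 <= 2^(g_k). *)
Lemma ffun_le_count N (g : 'I_n -> nat) :
  (#|[pred a : {ffun 'I_n -> 'I_N} | [forall k, (a k <= g k)%N]]| <= 2 ^ (\sum_(k < n) g k))%N.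
Proof.
rewrite -sum1_card big_mkcond /=.
have E (a : {ffun 'I_n -> 'I_N}) : (if a \in [pred a : {ffun 'I_n -> 'I_N} | [forall k, (a k <= g k)%N]] then 1%N else 0%N)
   = (\prod_(k < n) (a k <= g k)%N)%N.
  rewrite inE; case: ifP => [/forallP h|/negbT]; first by rewrite big1// => k _; rewrite h.
  by rewrite negb_forall => /existsP[k /negbTE h]; rewrite (bigD1 k)//= h.
under eq_bigr do rewrite E.
rewrite -(bigA_distr_bigA (fun (k : 'I_n) (i : 'I_N) => (i <= g k)%N : nat)).
rewrite expn_sum; apply: leq_prod => k _.
apply: (@leq_trans (g k).+1); last exact: ltn_expl.
rewrite -big_mkcond /= sum1_card.
rewrite -(card_ord (g k).+1).
pose h (i : 'I_N) : 'I_(g k).+1 := inord i.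
rewrite -(card_in_imset (f := h) (D := [pred i : 'I_N | (i <= g k)%N])); last first.
  move=> i j /=; rewrite !inE => ig jg /(congr1 val) /=; rewrite !inordK// => ij.
  exact/val_inj.
exact: max_card.
Qed.

(* Parseval for A^2: a monomial of degree 2m factors in at most 4^m ways. *)
Lemma tpoly_l4 N m (A : {ffun 'I_n -> 'I_N.+1} -> C) : (N.+1 + N.+1 <= L)%N ->
  (forall a, mdeg a != m -> A a = 0) ->
  \sum_t cabs (tpoly A (tpt t)) ^+ 4 <= (L ^ n)%:R * (4 ^+ m * (\sum_a cabs (A a) ^+ 2) ^+ 2).
Proof.
move=> NL A0.
pose add (a c : {ffun 'I_n -> 'I_N.+1}) : {ffun 'I_n -> 'I_(N + N).+2} :=
  [ffun k => inord (a k + c k)].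
have addE a c k : add a c k = (a k + c k)%N :> nat.
  by rewrite ffunE inordK//; have := ltn_ord (a k); have := ltn_ord (c k); lia.
pose B (g : {ffun 'I_n -> 'I_(N + N).+2}) : C := \sum_(p | add p.1 p.2 == g) A p.1 * A p.2.
have sq w : tpoly A w ^+ 2 = tpoly B w.
  rewrite /tpoly expr2 mulr_suml.
  under eq_bigr do rewrite mulr_sumr.
  rewrite pair_big /=.
  rewrite (partition_big (fun p => add p.1 p.2) xpredT)//=; apply: eq_bigr => g _.
  rewrite /B mulr_suml; apply: eq_bigr => p /eqP <-.
  have -> : mono (add p.1 p.2) w = mono p.1 w * mono p.2 w.
    by rewrite /mono -big_split; apply: eq_bigr => k _; rewrite addE exprD.
  by rewrite mulrACA.
under eq_bigr do rewrite (exprM _ 2 2) -cabsX sq.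
rewrite tpoly_parseval; last by apply: leq_trans NL; lia.
rewrite ler_wpM2l//.
have -> : (\sum_a cabs (A a) ^+ 2) ^+ 2 =
  \sum_g \sum_(p | add p.1 p.2 == g) (cabs (A p.1) * cabs (A p.2)) ^+ 2.
  rewrite expr2 mulr_suml.
  under eq_bigr do rewrite mulr_sumr.
  rewrite pair_big /= (partition_big (fun p => add p.1 p.2) xpredT)//=.
  by apply: eq_bigr => g _; apply: eq_bigr => p _; rewrite exprMn.
rewrite mulr_sumr; apply: ler_sum => g _.
pose D := [pred p : {ffun 'I_n -> 'I_N.+1} * {ffun 'I_n -> 'I_N.+1} |
   (add p.1 p.2 == g) && ((mdeg p.1 == m) && (mdeg p.2 == m))].
have restr (S : zmodType) (F : {ffun 'I_n -> 'I_N.+1} * {ffun 'I_n -> 'I_N.+1} -> S) :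
    (forall p, A p.1 * A p.2 = 0 -> F p = 0) ->
    \sum_(p | add p.1 p.2 == g) F p = \sum_(p | D p) F p.
  move=> F0; rewrite big_mkcond [RHS]big_mkcond; apply: eq_bigr => p _ /=.
  case: eqP => //= _; case: eqP => [_|/eqP h] /=; last by rewrite F0// A0 ?mul0r.
  by case: eqP => // /eqP h; rewrite F0// (A0 p.2) ?mulr0.
rewrite (restr R) => [|p h]; last by rewrite -cabsM h cabs0 expr0n.
apply: (@le_trans _ _ ((\sum_(p | D p) cabs (A p.1) * cabs (A p.2)) ^+ 2)).
  apply: lerXn2r; rewrite ?nnegrE; [exact: cabs_ge0 | |].
    by apply: sumr_ge0 => p _; rewrite mulr_ge0 ?cabs_ge0.
  rewrite /B (restr C)// (le_trans (cabs_sum _ _ _))//.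
  by apply: ler_sum => p _; rewrite cabsM.
apply: (le_trans (sqr_sum_le_card _ _)).
apply: ler_wpM2r; first by apply: sumr_ge0 => p _; rewrite sqr_ge0.
rewrite -natrX ler_nat.
have [->|[p0 Dp0]] : #|D| = 0%N \/ exists p, D p.
- by case: (pickP D) => [p h|h]; [right; exists p | left; rewrite eq_card0].
- by [].
move: Dp0 => /andP[/eqP ag /andP[/eqP d1 /eqP d2]].
have -> : (4 ^ m = 2 ^ (\sum_(k < n) g k))%N.
  rewrite -[4%N]/(2 ^ 2)%N -expnM mul2n -addnn; congr (2 ^ _)%N.
  rewrite -{1}d1 -d2 /mdeg -big_split; apply: eq_bigr => k _ /=.
  by rewrite -ag addE.
apply: leq_trans (ffun_le_count N.+1 (fun k => g k)).
(* A factorisation is determined by its first factor, a divisor of g. *)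
rewrite -(card_in_imset (f := fst) (D := D)).
  apply: subset_leq_card; apply/fintype.subsetP => a /imsetP[p /andP[/eqP pg _] ->].
  by rewrite inE; apply/forallP => k; rewrite -pg addE leq_addr.
move=> [a c] [a' c'] /andP[/eqP /= h1 _] /andP[/eqP /= h2 _] aa; rewrite -aa in h2 *.
congr (_, _); apply/ffunP => k; apply/val_inj => /=.
by apply: (@addnI (a k)); rewrite -!addE h1 h2.
Qed.

(* L2 interpolates between L1 and L4; pointwise, |x|^2 <= u |x| + |x|^4 / u^2. *)
Lemma tpoly_l2_l1 N m (A : {ffun 'I_n -> 'I_N.+1} -> C) : (N.+1 + N.+1 <= L)%N ->
  (forall a, mdeg a != m -> A a = 0) ->
  (L ^ n)%:R * Num.sqrt (\sum_a cabs (A a) ^+ 2) <= 4 * 2 ^+ m * \sum_t cabs (tpoly A (tpt t)).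
Proof.
move=> NL A0.
have h4 := tpoly_l4 NL A0.
have := @tpoly_parseval N.+1 A (leq_trans (leq_addr _ _) NL).
set X := \sum_a cabs (A a) ^+ 2 in h4 *; set E := \sum_t cabs (tpoly A (tpt t)); set LL := (L ^ n)%:R => h2.
have X0 : 0 <= X by apply: sumr_ge0 => a _; rewrite sqr_ge0.
have E0 : 0 <= E by apply: sumr_ge0 => a _; rewrite cabs_ge0.
have L0 : 0 < LL by rewrite ltr0n expn_gt0 expn_gt0.
have [X00|X00] := eqVneq X 0.
  by rewrite X00 sqrtr0 mulr0 mulr_ge0// mulr_ge0// exprn_ge0.
have S0 : 0 < Num.sqrt X by rewrite sqrtr_gt0 lt0r X00.
set S := Num.sqrt X in S0 *.
have SX : X = S ^+ 2 by rewrite sqr_sqrtr.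
have p0 : 0 < 2 ^+ m :> R by rewrite exprn_gt0.
(* Chosen so that the fourth-power term is at most a quarter of the squared L2 norm and can be
   absorbed. *)
pose u := 2 ^+ m * 2 * S.
have u0 : 0 < u by rewrite !mulr_gt0.
have pt (a : R) : 0 <= a -> a ^+ 2 <= u * a + a ^+ 4 / u ^+ 2.
  move=> a0; case: (leP a u) => au.
    have h : a ^+ 2 <= u * a by rewrite expr2 ler_wpM2r.
    by apply: (le_trans h); rewrite lerDl divr_ge0 ?exprn_ge0// ltW.
  have h : a ^+ 2 <= a ^+ 4 / u ^+ 2.
    rewrite ler_pdivlMr ?exprn_gt0// (exprD a 2 2) ler_wpM2l ?sqr_ge0//.
    by apply: lerXn2r; rewrite ?nnegrE//; exact: ltW.
  by apply: (le_trans h); rewrite lerDr mulr_ge0// ltW.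
have : \sum_t cabs (tpoly A (tpt t)) ^+ 2 <=
   u * E + (\sum_t cabs (tpoly A (tpt t)) ^+ 4) / u ^+ 2.
  rewrite mulr_sumr mulr_suml -big_split; apply: ler_sum => t _ /=.
  by apply: pt; rewrite cabs_ge0.
rewrite h2 => h.
have : (\sum_t cabs (tpoly A (tpt t)) ^+ 4) / u ^+ 2 <= LL * S ^+ 2 / 4.
  rewrite ler_pdivrMr ?exprn_gt0// (le_trans h4)// SX /u.
  rewrite le_eqVlt; apply/orP; left; apply/eqP.
  have -> : 4 ^+ m = (2 ^+ m) ^+ 2 :> R by rewrite -exprM mulnC exprM; congr (_ ^+ _); ring.
  by field.
move: h; rewrite SX /u => h h'.
have {h h'} : LL * S ^+ 2 * 3 / 4 <= 2 ^+ m * 2 * S * E by lra.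
have -> : LL * S ^+ 2 * 3 / 4 = (LL * S * 3 / 4) * S by field.
have -> : 2 ^+ m * 2 * S * E = (2 ^+ m * 2 * E) * S by ring.
rewrite ler_pM2r// => h.
have : 0 <= 2 ^+ m * E by rewrite mulr_ge0// ltW.
lra.
Qed.

End TorusPolynomials.

(** * Euler derivatives and the sum of the coefficients *)

Section Sidon.
Context {R : realType}.
Local Notation C := (R[i]).

Lemma cmean_horner1 l (q : {poly C}) : (size q <= 2 ^ l)%N -> (1 < 2 ^ l)%N ->
  cmean l (fun x => q.[x] * x^-1) = q`_1.
Proof.
move=> sq l1.
transitivity (cmean l (fun x => \sum_(i < size q) q`_i * (x ^+ i * x^-1 ^+ 1))).
  apply: eq_cmean => x _; rewrite horner_coef mulr_suml.
  by apply: eq_bigr => i _; rewrite expr1 mulrA.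
rewrite cmean_sum.
have E (i : 'I_(size q)) : cmean l (fun x => q`_i * (x ^+ i * x^-1 ^+ 1)) = if nat_of_ord i == 1%N then q`_1 else 0.
  rewrite cmeanZ cmean_mono//; last exact: leq_trans (ltn_ord i) sq.
  by case: eqP => [->|]; rewrite ?mulr1 ?mulr0.
under eq_bigr do rewrite E.
rewrite -big_mkcond /=; case: (ltnP 1 (size q)) => q1.
  by rewrite (big_pred1 (Ordinal q1)).
rewrite nth_default// big1// => i /eqP i1; by move: (ltn_ord i); rewrite i1 ltnNge q1.
Qed.

Lemma prod_linear_coef (I : Type) (s : seq I) (z : I -> C) (a : I -> nat) :
  let q := \prod_(k <- s) (1 + (z k)%:P * 'X) ^+ a k in
  [/\ q`_0 = 1, q`_1 = \sum_(k <- s) (a k)%:R * z k & (size q <= (\sum_(k <- s) a k).+1)%N].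
Proof.
pose ok (q : {poly C}) (c : C) d := [/\ q`_0 = 1, q`_1 = c & (size q <= d.+1)%N].
have okM p q c c' d d' : ok p c d -> ok q c' d' -> ok (p * q) (c + c') (d + d')%N.
  move=> [p0 p1 sp] [q0 q1 sq]; split.
  - by rewrite coef0M p0 q0 mulr1.
  - by rewrite coefM !big_ord_recl big_ord0 /= p0 q1 p1 q0 mul1r mulr1 addr0 addrC.
  - apply: leq_trans (size_polyMleq _ _) _; lia.
have ok1 : ok 1 0 0%N by split; rewrite ?coef1// size_poly1.
have okX (y : C) e : ok ((1 + y%:P * 'X) ^+ e) (e%:R * y) e.
  elim: e => [|e IH]; first by rewrite expr0 mul0r.
  rewrite exprSr -addn1 natrD mulrDl; apply: okM => //; split.
  - by rewrite coefD coef1 coefCM coefX mulr0 addr0.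
  - by rewrite coefD coef1 coefCM coefX mulr1 add0r mul1r.
  - apply: leq_trans (size_polyD _ _) _; rewrite size_poly1 geq_max /= mul_polyC.
    by apply: leq_trans (size_scale_leq _ _) _; rewrite size_polyX.
rewrite /=; elim: s => [|k s IH]; first by rewrite !big_nil.
by rewrite !big_cons; apply: okM.
Qed.

Variables (n m N : nat) (a : {ffun 'I_n -> 'I_N.+1} -> C) (b : R).
Hypothesis m0 : (0 < m)%N.
Hypothesis a_deg : forall i, mdeg i != m -> a i = 0.
Hypothesis a_le : forall w : 'I_n -> C, (forall k, cabs (w k) <= 1) -> cabs (tpoly a w) <= b.

Lemma tpolyZ (c : C) (w : 'I_n -> C) : tpoly a (fun k => c * w k) = c ^+ m * tpoly a w.
Proof.
rewrite /tpoly mulr_sumr; apply: eq_bigr => i _.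
have [/eqP im|/a_deg ->] := boolP (mdeg i == m); last by rewrite !mul0r mulr0.
rewrite /mono; under eq_bigr do rewrite exprMn.
rewrite big_split /= prodrXr -/(mdeg i) im; ring.
Qed.

(* The coefficient of x in x |-> P (w_k (1 + x zeta_k)) is the zeta-weighted sum
   of the Euler derivatives of P. *)
Lemma euler_sum_le (w : 'I_n -> C) : (forall k, cabs (w k) = 1) ->
  \sum_(k < n) cabs (tpoly (fun i => (i k)%:R * a i) w) <= 2 ^+ m * b.
Proof.
move=> w1.
pose q k := tpoly (fun i => (i k)%:R * a i) w.
have /choice[z zP] : forall k, exists z : C, cabs z = 1 /\ z * q k = (cabs (q k))%:C%C.
  move=> k.
  have [->|qk] := eqVneq (q k) 0.
    by exists 1; rewrite cabs1 mulr0 cabs0.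
  exists (((q k)^*)%C / (cabs (q k))%:C%C); split.
    by rewrite cabsM cabsV cabs_real ger0_norm ?cabs_ge0// cabs_conj divff// cabs_eq0.
  have cC : (cabs (q k))%:C%C != 0 :> C by rewrite -cabs_gt0 cabs_real normr_gt0 cabs_eq0.
  rewrite mulrAC [_ * q k]mulrC conj_mul_cabs rmorphXn expr2 mulfK//.
have [l0 Hl] := pow2_gt_ex m.+1.
have ml := Hl l0 (leqnn _).
have key : cmean l0 (fun x => tpoly a (fun k => w k * (1 + x * z k)) * x^-1) = \sum_(k < n) z k * q k.
  transitivity (cmean l0 (fun x => \sum_i (a i * mono i w) *
     ((\prod_(k < n) (1 + (z k)%:P * 'X) ^+ i k).[x] * x^-1))).
    apply: eq_cmean => x _; rewrite /tpoly mulr_suml; apply: eq_bigr => i _.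
    rewrite horner_prod mulrA; congr (_ * _); rewrite -mulrA; congr (_ * _).
    rewrite /mono -big_split; apply: eq_bigr => k _ /=.
    by rewrite exprMn horner_exp hornerD hornerC hornerCM hornerX [x * _]mulrC.
  rewrite cmean_sum.
  transitivity (\sum_i (a i * mono i w) * (\sum_(k < n) (i k)%:R * z k)).
    apply: eq_bigr => i _; rewrite cmeanZ.
    have [/eqP im|/a_deg ->] := boolP (mdeg i == m); last by rewrite !mul0r.
    have [_ c1 sz] := prod_linear_coef (index_enum 'I_n) z (fun k => i k : nat).
    rewrite cmean_horner1; last 2 first.
    - by apply: leq_trans sz _; rewrite -/(mdeg i) im ltnW.
    - by apply: leq_trans ml.
    by rewrite c1.
  under eq_bigr do rewrite mulr_sumr.
  rewrite exchange_big; apply: eq_bigr => k _.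
  rewrite /q /tpoly mulr_sumr; apply: eq_bigr => i _ /=; ring.
have : cabs (\sum_(k < n) z k * q k) <= 2 ^+ m * b.
  rewrite -key; apply: cabs_cmean => x x1; rewrite cabsM cabsV x1 invr1 mulr1.
  (* The points 1 + x z_k have modulus at most 2; halving returns to the polydisc, and homogeneity
     pays for it with 2^m. *)
  have -> : (fun k => w k * (1 + x * z k)) = (fun k => 2 * (w k * (1 + x * z k) / 2)).
    by apply/funext => k; field.
  rewrite tpolyZ cabsM cabsX (cabs_nat 2) ler_wpM2l ?exprn_ge0//; apply: a_le => k.
  rewrite !cabsM cabsV (cabs_nat 2) w1 mul1r ler_pdivrMr// mul1r.
  by rewrite (le_trans (cabsD _ _))// cabs1 cabsM x1 (zP k).1 mul1r.
apply: le_trans; rewrite (eq_bigr (fun k => (cabs (q k))%:C%C)); last by move=> k _; rewrite (zP k).2.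
have -> : \sum_(k < n) (cabs (q k))%:C%C = (\sum_(k < n) cabs (q k))%:C%C by rewrite rmorph_sum.
rewrite cabs_real ger0_norm//.
by apply: sumr_ge0 => k _; exact: cabs_ge0.
Qed.

Lemma sidon : \sum_i cabs (a i) <=
  4 ^+ m.+1 * Num.sqrt (expR m%:R * ((n + m)%:R / m%:R) ^+ m.-1) * b.
Proof.
set D := expR _ * _.
have b0 : 0 <= b.
  by apply: le_trans (cabs_ge0 _) (a_le (w := fun=> 0) _) => k; rewrite cabs0.
have mR : 1 <= m%:R :> R by rewrite ler1n.
have D0 : 0 <= D by rewrite mulr_ge0 ?expR_ge0// exprn_ge0// divr_ge0.
pose S (k : 'I_n) := Num.sqrt (\sum_(i : {ffun 'I_n -> 'I_N.+1}) cabs ((i k)%:R * a i) ^+ 2).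
have [l0 Hl] := pow2_gt_ex (N.+1 + N.+1).
have NL : (N.+1 + N.+1 <= 2 ^ l0)%N by rewrite ltnW// Hl.
have SS : \sum_(k < n) S k <= 4 ^+ m.+1 * b.
  have L0 : 0 < ((2 ^ l0) ^ n)%:R :> R by rewrite ltr0n !expn_gt0.
  rewrite -(ler_pM2l L0) mulr_sumr.
  apply: (@le_trans _ _ (\sum_(k < n) (4 * 2 ^+ m * \sum_t cabs (tpoly (fun i => (i k)%:R * a i) (@tpt R n l0 t))))).
    apply: ler_sum => k _; apply: tpoly_l2_l1 => // i /a_deg ->; exact: mulr0.
  rewrite -mulr_sumr exchange_big /=.
  apply: (@le_trans _ _ (4 * 2 ^+ m * \sum_(t : {ffun 'I_n -> 'I_(2 ^ l0)}) (2 ^+ m * b))).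
    rewrite ler_wpM2l ?mulr_ge0 ?exprn_ge0//; apply: ler_sum => t _.
    by apply: euler_sum_le => k; exact: cabs_tpt.
  rewrite sumr_const card_ffun !card_ord -(mulr_natr (2 ^+ m * b)).
  have -> : 4 ^+ m.+1 = 4 * (2 ^+ m * 2 ^+ m) :> R.
    by rewrite exprS -exprMn; congr (_ * _ ^+ _); ring.
  by rewrite le_eqVlt; apply/orP; left; apply/eqP; ring.
have term k : \sum_(i : {ffun 'I_n -> 'I_N.+1}) (i k)%:R * cabs (a i) <= Num.sqrt D * S k.
  have H := cauchy_schwarz_sum (index_enum {ffun 'I_n -> 'I_N.+1})
    (fun i => (mdeg i == m) && (0 < i k)%N) (fun=> 1) (fun i => (i k)%:R * cabs (a i)).
  have E : \sum_(i : {ffun 'I_n -> 'I_N.+1}) (i k)%:R * cabs (a i) = \sum_(i | (mdeg i == m) && (0 < i k)%N) 1 * ((i k)%:R * cabs (a i)).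
    rewrite [RHS]big_mkcond; apply: eq_bigr => i _; rewrite mul1r.
    case: eqP => [_|/eqP /a_deg ->]; last by rewrite cabs0 mulr0.
    rewrite andTb.
    by case: (posnP (i k)) => [->|]; rewrite ?mul0r.
  have T0 : 0 <= \sum_(i : {ffun 'I_n -> 'I_N.+1}) (i k)%:R * cabs (a i).
    by apply: sumr_ge0 => i _; rewrite mulr_ge0// cabs_ge0.
  rewrite -E in H; rewrite -sqrtrM// -[leLHS]ger0_norm// -sqrtr_sqr ler_wsqrtr//.
  apply: (le_trans H); apply: ler_pM; rewrite ?sumr_ge0//.
  - by move=> i _; rewrite sqr_ge0.
  - under eq_bigr do rewrite expr1n.
    by rewrite sumr_const; apply: mono_count.
  - rewrite big_mkcond; apply: ler_sum => i _; rewrite cabsM cabs_nat.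
    by case: ifP => // _; rewrite sqr_ge0.
(* Summed over k, the weights i_k add up to m on each monomial. *)
have : m%:R * \sum_i cabs (a i) <= Num.sqrt D * (4 ^+ m.+1 * b).
  apply: (@le_trans _ _ (\sum_(k < n) \sum_(i : {ffun 'I_n -> 'I_N.+1}) (i k)%:R * cabs (a i))).
    rewrite exchange_big mulr_sumr; apply: ler_sum => i _ /=.
    rewrite -mulr_suml -natr_sum.
    by have [/eqP <-|/a_deg ->] := boolP (mdeg i == m); rewrite // cabs0 !mulr0.
  apply: (@le_trans _ _ (\sum_(k < n) Num.sqrt D * S k)); first exact: ler_sum.
  by rewrite -mulr_sumr ler_wpM2l// sqrtr_ge0.
move=> h; have T0 : 0 <= \sum_i cabs (a i) by apply: sumr_ge0 => i _; exact: cabs_ge0.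
have : \sum_i cabs (a i) <= Num.sqrt D * (4 ^+ m.+1 * b).
  by apply: le_trans h; rewrite -[leLHS]mul1r ler_wpM2r.
by rewrite mulrA [Num.sqrt D * _]mulrC.
Qed.

End Sidon.

(** * Lower bounds *)

Section EsumMultiindex.
Context {R : realType}.
Variables (n : nat).

Lemma mext_inj N : injective (@mext n N).
Proof.
move=> a c ac; apply/ffunP => k; apply/val_inj => /=.
by rewrite -!mextE ac.
Qed.

Lemma mext_supp N (a : {ffun 'I_n -> 'I_N}) : supp_le n (mext a).
Proof.
move=> k nk; rewrite /mext; case: insubP => // i _ ik.
by have := ltn_ord i; rewrite -[nat_of_ord i]/(val i) ik ltnNge nk.
Qed.

Lemma mdeg_isE N (a : {ffun 'I_n -> 'I_N}) m : mdeg_is (mext a) m -> mdeg a = m.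
Proof.
move=> [N' [sN <-]].
pose F k := mext a k.
have E M M' : supp_le M (mext a) -> (M <= M')%N -> (\sum_(k < M') F k = \sum_(k < M) F k)%N.
  move=> sM MM'; rewrite -(big_mkord xpredT F) -(big_mkord xpredT F) (big_cat_nat (n := M))//=.
  rewrite [X in (_ + X)%N]big1_seq ?addn0// => i /andP[_]; rewrite mem_index_iota => /andP[Mi _].
  exact: sM.
have -> : mdeg a = (\sum_(k < n) F k)%N by apply: eq_bigr => k _; rewrite /F mextE.
case: (leqP n N') => nN; first by rewrite -(E n N')//; exact: mext_supp.
by rewrite (E N' n)// ltnW.
Qed.

(** A finite set of multi-indices has bounded total degree M, so it lies in one box; [N0] lets the
    box exceed a prescribed degree. *)
Lemma esum_le_mext (I : set mindex) (F : mindex -> R) (B : R) (N0 : nat) :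
  (forall a, 0 <= F a) ->
  (forall N, (N0 <= N)%N ->
    \sum_(a : {ffun 'I_n -> 'I_N.+1} | `[< I (mext a) >] && (mdeg a <= N)%N) F (mext a) <= B) ->
  (\esum_(a in [set a | I a /\ supp_le n a]) (F a)%:E <= B%:E)%E.
Proof.
move=> F0 H; apply: ge_ereal_sup => _ [X [finX XI] <-].
pose M := (N0 + \max_(a <- finmap.enum_fset (fset_set X)) \sum_(k < n) a k)%N.
pose Y : set {ffun 'I_n -> 'I_M.+1} := [set a | X (mext a)].
have degM a : X a -> (\sum_(k < n) a k <= M)%N.
  move=> Xa; apply: leq_trans (leq_addl _ _).
  by apply: (@leq_bigmax_seq _ _ xpredT (fun a : mindex => \sum_(k < n) a k)%N) => //; rewrite in_fset_set// inE.
have XM a k : X a -> (k < n)%N -> (a k <= M)%N.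
  move=> Xa kn; apply: leq_trans (degM a Xa).
  by rewrite (bigD1 (Ordinal kn))//= leq_addr.
have XY : X = @mext n M.+1 @` Y.
  apply/seteqP; split => [a Xa|_ [a Ya <-]//].
  have E : mext ([ffun k : 'I_n => inord (a k)] : {ffun 'I_n -> 'I_M.+1}) = a.
    apply/funext => k; rewrite /mext; case: insubP => [i _ <-|]/=.
      by rewrite ffunE inordK// ltnS XM.
    by rewrite -leqNgt => nk; have [_ ->] := XI _ Xa.
  by exists [ffun k : 'I_n => inord (a k)]; rewrite /Y /= E.
rewrite {1}XY fsbig_image; last by move=> a c _ _; exact: mext_inj.
rewrite (fsbigE [seq a <- enum {ffun 'I_n -> 'I_M.+1} | a \in Y]); last 3 first.
- by rewrite filter_uniq// enum_uniq.
- by move=> a /=; rewrite mem_filter => /andP[aY _]; exact: set_mem aY.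
- by move=> a Ya; rewrite mem_filter (mem_set Ya) mem_enum.
rewrite (eq_bigr (fun a => (F (mext a))%:E))// sumEFin lee_fin big_filter_cond /= big_enum_cond /=.
apply: le_trans (H M (leq_addr _ _)).
rewrite big_mkcond [leRHS]big_mkcond; apply: ler_sum => a _.
rewrite andbb; case: (boolP (a \in Y)) => aY; last by case: ifP.
rewrite inE in aY; have [Ia _] := XI _ aY.
have -> : (mdeg a <= M)%N.
  by apply: leq_trans (degM _ aY); rewrite leq_eqVlt; apply/orP; left; apply/eqP;
    apply: eq_bigr => k _; rewrite mextE.
by case: asboolP.
Qed.

End EsumMultiindex.

Section LowerBounds.
Context {R : realType}.
Local Notation C := (R[i]).
Variables (Xs : set (nat -> C)) (Xn : (nat -> C) -> R).
Hypothesis XL : banach_seq_lattice Xs Xn.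

Definition sidon_const (n m : nat) : R :=
  4 ^+ m.+1 * Num.sqrt (expR m%:R * ((n + m)%:R / m%:R) ^+ m.-1).

Lemma hpart_abs_sum n (f : @Cn R n -> C^o) m N (z : @Cn R n) (B r : R) :
  (0 < m)%N -> (m < N.+1)%N -> 0 <= r ->
  (forall z, Xball Xn n 1 z -> cabs (hpart f m N.+1 z) <= B) -> Xball Xn n 1 z ->
  \sum_(a : {ffun 'I_n -> 'I_N.+1} | mdeg a == m)
     cabs (taylor_coef n (mext a) f * monom n (r%:C%C *: z) (mext a)) <= r ^+ m * (sidon_const n m * B).
Proof.
move=> m0 mN r0 HB z1.
pose A (a : {ffun 'I_n -> 'I_N.+1}) : C :=
  if mdeg a == m then taylor_coef n (mext a) f * monom n z (mext a) else 0.
have Adeg a : mdeg a != m -> A a = 0 by rewrite /A => /negbTE ->.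
have Ale (w : 'I_n -> C) : (forall k, cabs (w k) <= 1) -> cabs (tpoly A w) <= B.
  move=> w1; pose y : @Cn R n := \row_k (z 0 k * w k).
  have y1 : Xball Xn n 1 y.
    rewrite /Xball /=; apply: le_lt_trans z1; apply: (Xn_norm_mono XL) => k.
    by rewrite mxE cabsM ler_piMr ?cabs_ge0.
  apply: le_trans (HB y y1); rewrite le_eqVlt; apply/orP; left; apply/eqP; congr cabs.
  rewrite /tpoly /hpart [RHS]big_mkcond; apply: eq_bigr => a _; rewrite /A.
  case: eqP => _; last by rewrite mul0r.
  rewrite -mulrA; congr (_ * _); rewrite /monom /mono -big_split; apply: eq_bigr => k _ /=.
  by rewrite mxE exprMn mextE.
have := sidon m0 Adeg Ale; rewrite -/(sidon_const n m) => h.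
apply: le_trans (ler_wpM2l (exprn_ge0 m r0) h).
rewrite mulr_sumr big_mkcond; apply: ler_sum => a _; rewrite /A.
case: eqP => [am|_]; last by rewrite mulr_ge0 ?exprn_ge0 ?cabs_ge0.
by rewrite monomZ am (mulrCA (taylor_coef _ _ _)) (cabsM (r%:C%C ^+ m)) cabsX cabs_real ger0_norm.
Qed.

Lemma Xball0 n : Xball Xn n 1 0.
Proof.
by rewrite /Xball /= -(scale0r 0) (Xn_normZ XL) cabs0 mul0r.
Qed.

Lemma ball_scale n (z : @Cn R n) (r : R) : 0 < r -> Xball Xn n r z ->
  exists2 z', Xball Xn n 1 z' & z = r%:C%C *: z'.
Proof.
move=> r0 zr; have rC : r%:C%C != 0 :> C by rewrite -cabs_gt0 cabs_real normr_gt0 gt_eqF.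
exists (r%:C%C^-1 *: z); last by rewrite scalerA mulfV// scale1r.
by rewrite /Xball /= (Xn_normZ XL) cabsV cabs_real gtr0_norm// mulrC ltr_pdivrMr// mul1r.
Qed.

Lemma ball_sup_real n (f : @Cn R n -> C^o) : bounded_on n (Xball Xn n 1) f ->
  exists2 s : R, ereal_sup [set (cabs (f z))%:E | z in Xball Xn n 1] = s%:E &
    forall z, Xball Xn n 1 z -> cabs (f z) <= s.
Proof.
move=> [b fb].
set S := ereal_sup _.
have S1 : (S <= b%:E)%E by apply: ge_ereal_sup => _ [z zB <-]; rewrite lee_fin fb.
have S2 z : Xball Xn n 1 z -> ((cabs (f z))%:E <= S)%E.
  by move=> zB; apply: ereal_sup_ubound; exists z.
have := S2 0 (Xball0 n); move: S1 S2; case: S => [s| |] // _ S2 _.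
by exists s => // z zB; have := S2 z zB; rewrite lee_fin.
Qed.

Lemma bohr_radius_ge n (I : set mindex) (r : R) (N0 : nat) : 0 < r < 1 ->
  (forall (f : @Cn R n -> C^o) (s : R), holomorphic_on n (Xball Xn n 1) f ->
    (forall z, Xball Xn n 1 z -> cabs (f z) <= s) ->
    forall z, Xball Xn n 1 z -> forall N, (N0 <= N)%N ->
    \sum_(a : {ffun 'I_n -> 'I_N.+1} | `[< I (mext a) >] && (mdeg a <= N)%N)
       cabs (taylor_coef n (mext a) f * monom n (r%:C%C *: z) (mext a)) <= s) ->
  r <= bohr_radius Xn n I.
Proof.
move=> /andP[r0 r1] H; apply: ub_le_sup.
  by exists 1 => x [/andP[_ /ltW]].
split; first by rewrite r0 r1.
move=> f fh fb _; have [s -> fs] := ball_sup_real fb.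
apply: ge_ereal_sup => _ [z /(ball_scale r0) [z' z1 ->] <-].
apply: (@esum_le_mext _ n _ (fun a => cabs (taylor_coef n a f * monom n (r%:C%C *: z') a)) _ N0).
  by move=> a; exact: cabs_ge0.
by move=> N NN; exact: H.
Qed.

Lemma bohr_radius_m_ge n (J : set mindex) m (r : R) : (0 < m)%N -> 0 < r < 1 ->
  r ^+ m * sidon_const n m <= 1 -> r <= bohr_radius_m Xn n J m.
Proof.
move=> m0 r01 rm; apply: (@bohr_radius_ge _ _ _ m) => // f s fh fs z z1 N mN.
have s0 : 0 <= s by apply: le_trans (cabs_ge0 _) (fs _ z1).
move: r01 => /andP[r0 _].
have : \sum_(a : {ffun 'I_n -> 'I_N.+1} | mdeg a == m)
     cabs (taylor_coef n (mext a) f * monom n (r%:C%C *: z) (mext a)) <= s.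
  apply: le_trans (hpart_abs_sum (B := s) m0 _ (ltW r0) _ z1) _ => //.
    by move=> y y1; apply: (hpart_le XL fh fs).
  by rewrite mulrA -[leRHS]mul1r ler_wpM2r.
apply: le_trans.
rewrite big_mkcond [leRHS]big_mkcond; apply: ler_sum => a _.
case: asboolP => [[_ /mdeg_isE ->]|_] /=; last by case: ifP => // _; exact: cabs_ge0.
by rewrite eqxx; case: ifP => // _; exact: cabs_ge0.
Qed.

(** Degree m contributes at most (s - |f(0)|) 2^-m, and these add up to at most s - |f(0)|. The
    exponent m + 1 in the hypothesis absorbs the factor 2 of [hpart_le_gap]. *)
Lemma bohr_radius_full_ge n (I : set mindex) (r : R) : 0 < r < 1 ->
  (forall m, (0 < m)%N -> r ^+ m * sidon_const n m <= 2^-1 ^+ m.+1) ->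
  r <= bohr_radius Xn n I.
Proof.
move=> r01 rm; apply: (@bohr_radius_ge _ _ _ 0%N) => // f s fh fs z z1 N _.
have s0 : 0 <= s by apply: le_trans (cabs_ge0 _) (fs _ z1).
move: r01 => /andP[r0 _].
pose F (a : {ffun 'I_n -> 'I_N.+1}) := cabs (taylor_coef n (mext a) f * monom n (r%:C%C *: z) (mext a)).
have F0 a : 0 <= F a by exact: cabs_ge0.
pose c0 := cabs (taylor_coef n (fun=> 0%N) f).
have mext0 : mext ([ffun=> ord0] : {ffun 'I_n -> 'I_N.+1}) = (fun=> 0%N).
  by apply/funext => k; rewrite /mext; case: insub => // i; rewrite ffunE.
have deg0 (a : {ffun 'I_n -> 'I_N.+1}) : (mdeg a == 0%N) = (a == [ffun=> ord0]).
  rewrite /mdeg sum_nat_eq0; apply/forallP/eqP => [h|-> k]; last by rewrite ffunE.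
  by apply/ffunP => k; apply/val_inj; rewrite ffunE /=; apply/eqP; have := h k.
have h0 y : hpart f 0 N.+1 y = taylor_coef n (fun=> 0%N) f.
  rewrite /hpart (big_pred1 [ffun=> ord0])//.
  by rewrite mext0 /monom big1 ?mulr1// => k _; rewrite expr0.
have c0s : c0 <= s.
  by have := hpart_le XL fh fs z1 (ltn0Sn N); rewrite h0.
have part0 : \sum_(a | mdeg a == 0%N) F a = c0.
  rewrite (big_pred1 [ffun=> ord0])// /F mext0.
  by rewrite /monom big1 ?mulr1// => k _; rewrite expr0.
have part m : (0 < m)%N -> (m < N.+1)%N ->
    \sum_(a | mdeg a == m) F a <= (s - c0) * 2^-1 ^+ m.
  move=> m0 mN.
  apply: le_trans (hpart_abs_sum (B := 2 * (s - c0)) m0 mN (ltW r0) _ z1) _.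
    by move=> y y1; have := hpart_le_gap XL fh fs y1 m0 mN; rewrite h0.
  rewrite mulrA; apply: le_trans (ler_wpM2r _ (rm m m0)) _; first by rewrite mulr_ge0// subr_ge0.
  by rewrite le_eqVlt; apply/orP; left; apply/eqP; rewrite exprS; field.
apply: (@le_trans _ _ (\sum_(a | (mdeg a <= N)%N) F a)).
  rewrite big_mkcond [leRHS]big_mkcond; apply: ler_sum => a _.
  by case: (mdeg a <= N)%N; rewrite ?andbF// andbT; case: ifP.
rewrite (partition_big (fun a => inord (mdeg a) : 'I_N.+1) xpredT)//=.
have E (m : 'I_N.+1) : \sum_(a | (mdeg a <= N)%N && (inord (mdeg a) == m)) F a = \sum_(a | mdeg a == m) F a.
  apply: eq_bigl => a; apply/andP/eqP => [[aN /eqP <-]|am]; first by rewrite inordK.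
  by rewrite am -ltnS ltn_ord; split => //; apply/eqP/val_inj; rewrite /= inordK.
under eq_bigr do rewrite E.
rewrite big_ord_recl part0.
apply: (@le_trans _ _ (c0 + \sum_(i < N) (s - c0) * 2^-1 ^+ i.+1)).
  by rewrite lerD2l; apply: ler_sum => i _; apply: part; rewrite // lift0 ltnS.
have -> : \sum_(i < N) (s - c0) * 2^-1 ^+ i.+1 = (s - c0) * 2^-1 * \sum_(i < N) 2^-1 ^+ i.
  by rewrite mulr_sumr; apply: eq_bigr => i _; rewrite exprS mulrA.
have := @geom_sum_le R 2^-1 N; have -> : (1 - 2^-1)^-1 = 2 :> R by field.
move=> /(_ _) h; have {}h := h ltac:(apply/andP; split; lra).
nra.
Qed.

End LowerBounds.

(** * Explicit constants in the lower bounds *)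

Section NumericLower.
Context {R : realType}.
Local Notation C := (R[i]).
Variables (Xs : set (nat -> C)) (Xn : (nat -> C) -> R).
Hypothesis XL : banach_seq_lattice Xs Xn.

Lemma le_of_sqr (a b : R) : 0 <= b -> a ^+ 2 <= b ^+ 2 -> a <= b.
Proof.
move=> b0 ab; have [a0|a0] := leP a 0; first exact: le_trans b0.
by rewrite -(@ler_pXn2r _ 2)// nnegrE ltW.
Qed.

Lemma rate_powX (n m : nat) : (0 < m)%N ->
  powR (m%:R / (n + m)%:R) (m.-1%:R / (2 * m)%:R) ^+ (2 * m) = (m%:R / (n + m)%:R) ^+ m.-1 :> R.
Proof.
move=> m0; rewrite -powR_mulrn ?powR_ge0// -powRrM divfK; last first.
  by rewrite pnatr_eq0; lia.
by rewrite powR_mulrn// divr_ge0.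
Qed.

Lemma rate_gt0 (n m : nat) : (0 < m)%N -> 0 < powR (m%:R / (n + m)%:R) (m.-1%:R / (2 * m)%:R) :> R.
Proof. by move=> m0; rewrite powR_gt0// divr_gt0// ltr0n// addn_gt0 m0 orbT. Qed.

Lemma rate_le1 (n m : nat) : (0 < m)%N -> powR (m%:R / (n + m)%:R) (m.-1%:R / (2 * m)%:R) <= 1 :> R.
Proof.
move=> m0; rewrite -[leRHS](powRr0 (m%:R / (n + m)%:R)); apply: ger_powR; last by rewrite divr_ge0.
rewrite divr_gt0 ?ltr0n ?addn_gt0 ?m0 ?orbT//= ler_pdivrMr ?ltr0n ?addn_gt0 ?m0 ?orbT// mul1r.
by rewrite ler_nat leq_addl.
Qed.

Lemma sidon_const_sqr n m : (0 < m)%N ->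
  sidon_const n m ^+ 2 = 16 ^+ m.+1 * (expR 1 ^+ m * ((n + m)%:R / m%:R) ^+ m.-1) :> R.
Proof.
move=> m0; rewrite /sidon_const exprMn sqr_sqrtr; last first.
  by rewrite mulr_ge0 ?expR_ge0// exprn_ge0// divr_ge0.
rewrite -expRM_natl mulr1; congr (_ * _).
by rewrite -exprM mulnC exprM; congr (_ ^+ _); ring.
Qed.

Lemma expR1_ge1 : 1 <= expR 1 :> R.
Proof. by apply: le_trans (expR_ge1Dx 1); rewrite lerDl. Qed.

Lemma bohr_radius_m_lower (J : set mindex) (m n : nat) : (0 < m)%N -> (0 < n)%N ->
  (16 * expR 1)^-1 * powR (m%:R / (n + m)%:R) (m.-1%:R / (2 * m)%:R) <= bohr_radius_m Xn n J m.
Proof.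
move=> m0 n0; have K1 := expR1_ge1.
have K0 : 0 < expR 1 :> R by apply: expR_gt0.
have c0 : 0 < (16 * expR 1)^-1 :> R by rewrite invr_gt0 mulr_gt0.
have c1 : (16 * expR 1)^-1 < 1 :> R by rewrite invf_lt1 ?mulr_gt0//; lra.
have p0 := rate_gt0 n m0; have p1 := rate_le1 n m0; have pX := rate_powX n m0.
set p := powR _ _ in p0 p1 pX *.
apply: (bohr_radius_m_ge XL J m0).
  by rewrite mulr_gt0//= (le_lt_trans _ c1)// ler_piMr// ltW.
(* After squaring, the powers of m / (n + m) cancel and 16^(m+1) e^m <= (16 e)^(2m) remains, true
   because m + 1 <= 2 m. *)
apply: le_of_sqr => //; rewrite exprMn sidon_const_sqr// -exprM mulnC exprMn pX.
have nm : 0 < (n + m)%:R :> R by rewrite ltr0n addn_gt0 n0.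
have mR : 0 < m%:R :> R by rewrite ltr0n.
set x := m%:R / (n + m)%:R.
have -> : (n + m)%:R / m%:R = x^-1 by rewrite invf_div.
have x0 : x != 0 by rewrite mulf_neq0 ?invr_eq0 ?gt_eqF.
rewrite exprVn.
have -> : (16 * expR 1)^-1 ^+ (2 * m) * x ^+ m.-1 * (16 ^+ m.+1 * (expR 1 ^+ m * (x ^+ m.-1)^-1))
  = (16 * expR 1)^-1 ^+ (2 * m) * (16 ^+ m.+1 * expR 1 ^+ m) :> R.
  by field; rewrite expf_neq0.
rewrite exprVn mulrC ler_pdivrMr ?exprn_gt0 ?mulr_gt0// expr1n mul1r exprMn.
have i1 : 16 ^+ m.+1 <= 16 ^+ (2 * m) :> R by rewrite ler_weXn2l//; [lra | lia].
have i2 : expR 1 ^+ m <= expR 1 ^+ (2 * m) :> R by apply: ler_weXn2l; [exact: K1 | exact: leq_pmull].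
by apply: ler_pM; rewrite ?exprn_ge0// ltW.
Qed.

(** For m <= n the point is (ln n / m)^m <= n, an instance of u <= e^u with u = ln n / m; together
    with (n + m) / m <= 2 n / m it leaves 2^(m-1) m. For m > n both factors are bounded directly. *)
Lemma log_rate_le (n m : nat) : (0 < m)%N -> (2 <= n)%N ->
  (ln n%:R / n%:R) ^+ m * ((n + m)%:R / m%:R) ^+ m.-1 <= 4 ^+ m :> R.
Proof.
move=> m0 n2; have nR : 0 < n%:R :> R by rewrite ltr0n; lia.
have n1 : 1 <= n%:R :> R by rewrite ler1n; lia.
have mR : 0 < m%:R :> R by rewrite ltr0n.
have l0 : 0 <= ln n%:R :> R by rewrite ln_ge0.
have mle : m%:R <= 2 ^+ m :> R by rewrite -natrX ler_nat ltnW// ltn_expl.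
have p2 : 0 < 2 ^+ m :> R by rewrite exprn_gt0.
have four : 4 ^+ m = 2 ^+ m * 2 ^+ m :> R by rewrite -exprMn; congr (_ ^+ _); ring.
have h2 : 2 ^+ m.-1 <= 2 ^+ m :> R by rewrite ler_weXn2l ?leq_pred//; lra.
have [mn|nm] := leqP m n.
  have lnm : (ln n%:R / m%:R) ^+ m <= n%:R :> R.
    have E : n%:R = expR (ln n%:R / m%:R) ^+ m :> R.
      by rewrite -expRM_natl mulrC divfK ?gt_eqF// lnK.
    rewrite [leRHS]E lerXn2r ?nnegrE ?divr_ge0 ?expR_ge0// ?(ltW mR)//.
    by apply: le_trans (expR_ge1Dx _); rewrite lerDr.
  have nm2 : (n + m)%:R / m%:R <= 2 * (n%:R / m%:R) :> R.
    rewrite ler_pdivrMr// -mulrA divfK ?gt_eqF// natrD.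
    have : m%:R <= n%:R :> R by rewrite ler_nat.
    lra.
  have : ((n + m)%:R / m%:R) ^+ m.-1 <= (2 * (n%:R / m%:R)) ^+ m.-1 :> R.
    by rewrite lerXn2r ?nnegrE ?divr_ge0 ?mulr_ge0// ?divr_ge0// ltW.
  move=> h; apply: le_trans (ler_wpM2l _ h) _; first by rewrite exprn_ge0// divr_ge0// ltW.
  have -> : (ln n%:R / n%:R) ^+ m * (2 * (n%:R / m%:R)) ^+ m.-1 =
     2 ^+ m.-1 * ((ln n%:R / m%:R) ^+ m * (m%:R / n%:R)) :> R.
    have gen (u x y : R) k : x != 0 -> y != 0 ->
        (u / x) ^+ k.+1 * (2 * (x / y)) ^+ k = 2 ^+ k * ((u / y) ^+ k.+1 * (y / x)).
      by move=> x0 y0; rewrite !exprS !exprMn !exprVn; field; rewrite x0 y0 !expf_neq0.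
    by have := gen (ln n%:R) n%:R m%:R m.-1; rewrite prednK// !gt_eqF//; apply.
  have q0 : 0 <= (ln n%:R / m%:R) ^+ m :> R by apply: exprn_ge0; apply: divr_ge0 => //; exact: ltW.
  have q1 : 0 <= m%:R / n%:R :> R by apply: divr_ge0.
  have q2 : 0 <= 2 ^+ m.-1 :> R by apply: exprn_ge0.
  rewrite four; apply: ler_pM => //; first exact: mulr_ge0.
  apply: le_trans mle; apply: le_trans (ler_wpM2r q1 lnm) _.
  by rewrite mulrCA divff ?gt_eqF// mulr1.
have i1 : (ln n%:R / n%:R) ^+ m <= 1 :> R.
  apply: exprn_ile1; first by apply: divr_ge0 => //; exact: ltW.
  rewrite ler_pdivrMr// mul1r.
  by have := @ln_sublinear R n%:R nR; exact: ltW.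
have i2 : ((n + m)%:R / m%:R) ^+ m.-1 <= 2 ^+ m.-1 :> R.
  apply: lerXn2r; rewrite ?nnegrE ?divr_ge0// ler_pdivrMr// natrD.
  have : n%:R <= m%:R :> R by rewrite ler_nat ltnW.
  lra.
apply: (@le_trans _ _ (1 * 2 ^+ m.-1)).
  by apply: ler_pM => //; apply: exprn_ge0; apply: divr_ge0.
rewrite mul1r four; apply: (le_trans h2); apply: ler_peMr; first exact: ltW.
by apply: exprn_ege1; lra.
Qed.

Lemma bohr_radius_lower (J : set mindex) (n : nat) : (2 <= n)%N ->
  (128 * expR 1)^-1 * Num.sqrt (ln n%:R / n%:R) <= bohr_radius Xn n J.
Proof.
move=> n2; have K1 := expR1_ge1.
have K0 : 0 < expR 1 :> R by apply: expR_gt0.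
have c0 : 0 < (128 * expR 1)^-1 :> R by rewrite invr_gt0 mulr_gt0.
have c1 : (128 * expR 1)^-1 < 1 :> R by rewrite invf_lt1 ?mulr_gt0//; lra.
have nR : 0 < n%:R :> R by rewrite ltr0n; lia.
have l0 : 0 < ln n%:R :> R by rewrite ln_gt0// ltr1n.
set p := Num.sqrt _.
have p0 : 0 < p by rewrite sqrtr_gt0 divr_gt0.
have p1 : p <= 1.
  rewrite -sqrtr1 ler_wsqrtr// ler_pdivrMr// mul1r.
  by have := @ln_sublinear R n%:R nR; exact: ltW.
apply: (bohr_radius_full_ge XL).
  by rewrite mulr_gt0//= (le_lt_trans _ c1)// ler_piMr// ltW.
move=> m m0; apply: le_of_sqr; first by rewrite exprn_ge0.
rewrite exprMn sidon_const_sqr// exprMn exprMn -!exprM ![(_ * 2)%N]mulnC !exprM.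
have -> : p ^+ 2 = ln n%:R / n%:R by rewrite sqr_sqrtr// divr_ge0// ltW.
have h := log_rate_le m0 n2.
set A := (_ / _) ^+ m in h *; set B := (_ / _) ^+ m.-1 in h *.
have -> : (128 * expR 1)^-1 ^+ 2 ^+ m * A * (16 ^+ m.+1 * (expR 1 ^+ m * B)) =
   (128 * expR 1)^-1 ^+ 2 ^+ m * (16 ^+ m.+1 * expR 1 ^+ m) * (A * B) by ring.
apply: le_trans (ler_wpM2l _ h) _; first by rewrite !mulr_ge0// ?exprn_ge0// ?sqr_ge0// ltW.
(* Origin of 128: the base of the m-th power becomes at most 1/256 = 1/4 * 1/64, and 16 * 64^-m <=
   1/4 is sharp at m = 1. *)
have -> : (128 * expR 1)^-1 ^+ 2 ^+ m * (16 ^+ m.+1 * expR 1 ^+ m) * 4 ^+ m =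
   16 * ((128 * expR 1)^-1 ^+ 2 * (16 * (expR 1 * 4))) ^+ m :> R.
  by rewrite !(exprMn m) (exprS 16 m); ring.
have -> : (128 * expR 1)^-1 ^+ 2 * (16 * (expR 1 * 4)) = 256^-1 * (expR 1)^-1 :> R.
  by field; rewrite gt_eqF.
have -> : 2^-1 ^+ 2 ^+ m.+1 = 4^-1 * 4^-1 ^+ m :> R.
  by rewrite -exprS; congr (_ ^+ _); field.
have i1 : (256^-1 * (expR 1)^-1) ^+ m <= 256^-1 ^+ m :> R.
  have k0 : 0 <= (expR 1)^-1 :> R by rewrite invr_ge0 ltW.
  have k1 : (expR 1)^-1 <= 1 :> R by rewrite invf_le1.
  have k2 : 0 <= 256^-1 :> R by rewrite invr_ge0 ler0n.
  apply: lerXn2r; [by rewrite nnegrE mulr_ge0 | by rewrite nnegrE | exact: ler_piMr].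
apply: le_trans (ler_wpM2l _ i1) _ => //.
have -> : 256^-1 = 4^-1 * 64^-1 :> R by field.
rewrite exprMn.
have i2 : 64^-1 ^+ m <= 64^-1 :> R.
  rewrite -[leRHS]expr1 ler_wiXn2l//; lra.
have q0 : 0 <= 4^-1 ^+ m :> R by rewrite exprn_ge0.
nra.
Qed.

End NumericLower.

(** * Weights from 2-convexity *)

Section Weights.
Context {R : realType}.
Local Notation C := (R[i]).
Variables (Xs : set (nat -> C)) (Xn : (nat -> C) -> R).
Hypothesis XL : banach_seq_lattice Xs Xn.

Lemma bernoulli_le (t : R) n : 0 <= t <= 1 -> 1 - n%:R * t <= (1 - t) ^+ n.
Proof.
move=> /andP[t0 t1]; elim: n => [|n IH]; first by rewrite mul0r subr0 expr0.
rewrite exprS -natr1.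
have : (1 - t) * (1 - n%:R * t) <= (1 - t) * (1 - t) ^+ n by rewrite ler_wpM2l// subr_ge0.
apply: le_trans; have : 0 <= n%:R * t * t by rewrite !mulr_ge0.
nra.
Qed.

Lemma prod_1D_ge (I : Type) (s : seq I) (a : I -> R) : (forall i, 0 <= a i) ->
  1 + \sum_(i <- s) a i <= \prod_(i <- s) (1 + a i).
Proof.
move=> a0; elim: s => [|i s IH]; first by rewrite !big_nil addr0.
rewrite !big_cons; have := a0 i; have : 0 <= \sum_(j <- s) a j by apply: sumr_ge0.
nra.
Qed.

Variable M : R.
Hypothesis cvxM : forall (N : nat) (x : 'I_N -> (nat -> C)), (forall j, Xs (x j)) ->
    Xn (fun k => ((Num.sqrt (\sum_(j < N) cabs (x j k) ^+ 2))%:C)%C)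
      <= M * Num.sqrt (\sum_(j < N) Xn (x j) ^+ 2).

(* [sqr_hull] is the convex hull of the squared moduli of the unit ball. *)
Definition sqr_hull n : set ('I_n -> R) :=
  [set y | exists (N : nat) (x : 'I_N -> @Cn R n),
     \sum_(j < N) Xn_norm Xn n (x j) ^+ 2 <= 1 /\ forall k, y k = \sum_(j < N) cabs (x j 0 k) ^+ 2].

(** Here 2-convexity enters, applied to the vectors that represent y. Its constant may be any real;
    the maximum with 1 makes it positive. *)
Lemma sqr_hull_norm n y : sqr_hull (n := n) y ->
  Xn_norm Xn n (\row_k (Num.sqrt (y k))%:C%C) <= Num.max M 1.
Proof.
move=> [N [x [xN yE]]].
have := cvxM (fun j => emb_Xs XL (x j)).
have -> : (fun k => (Num.sqrt (\sum_(j < N) cabs (emb (x j) k) ^+ 2))%:C%C) =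
    emb (\row_k (Num.sqrt (y k))%:C%C : @Cn R n).
  apply/funext => k; case: (ltnP k n) => kn; last first.
    rewrite emb_out// big1 ?sqrtr0// => j _.
    by rewrite emb_out// cabs0 expr0n.
  rewrite -[k]/(val (Ordinal kn)) emb_ord mxE cabs_real ger0_norm ?sqrtr_ge0// yE.
  congr (Num.sqrt _)%:C%C; apply: eq_bigr => j _.
  by rewrite emb_ord cabs_real ger0_norm ?cabs_ge0.
move=> h; apply: (le_trans h).
have s0 : 0 <= Num.sqrt (\sum_(j < N) Xn (emb (x j)) ^+ 2) by rewrite sqrtr_ge0.
have s1 : Num.sqrt (\sum_(j < N) Xn (emb (x j)) ^+ 2) <= 1.
  by rewrite -[leRHS]sqrtr1 ler_wsqrtr.
apply: (@le_trans _ _ (Num.max M 1 * Num.sqrt (\sum_(j < N) Xn (emb (x j)) ^+ 2))).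
  by rewrite ler_wpM2r// le_max lexx.
by rewrite ler_piMr// le_max ler01 orbT.
Qed.

Lemma sqr_hull_mix n y (z : @Cn R n) (t : R) : sqr_hull y -> Xn_norm Xn n z <= 1 -> 0 <= t <= 1 ->
  sqr_hull (fun k => t * cabs (z 0 k) ^+ 2 + (1 - t) * y k).
Proof.
move=> [N [x [xN yE]]] z1 /andP[t0 t1].
have t'0 : 0 <= 1 - t by rewrite subr_ge0.
exists N.+1, (fun i => if unlift ord0 i is Some j then (Num.sqrt (1 - t))%:C%C *: x j
   else (Num.sqrt t)%:C%C *: z); split.
  rewrite big_ord_recl unlift_none.
  under eq_bigr do rewrite liftK (Xn_normZ XL) cabs_real ger0_norm ?sqrtr_ge0// exprMn sqr_sqrtr//.
  rewrite (Xn_normZ XL) cabs_real ger0_norm ?sqrtr_ge0// exprMn sqr_sqrtr// -mulr_sumr.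
  have : Xn_norm Xn n z ^+ 2 <= 1 by rewrite exprn_ile1// (Xn_norm_ge0 XL).
  nra.
move=> k; rewrite big_ord_recl unlift_none.
under eq_bigr do rewrite liftK mxE cabsM cabs_real ger0_norm ?sqrtr_ge0// exprMn sqr_sqrtr//.
by rewrite mxE cabsM cabs_real ger0_norm ?sqrtr_ge0// exprMn sqr_sqrtr// -mulr_sumr yE.
Qed.

(* Near-maximising the product of the coordinates over [sqr_hull] gives weights p
   for which the unit ball lies in an ellipsoid of radius O(sqrt n). *)
Lemma ellipsoid_weights n : (0 < n)%N -> exists p : 'I_n -> R,
  [/\ forall k, 0 < p k,
      Xn_norm Xn n (\row_k (p k)%:C%C) <= Num.max M 1 &
      forall z : @Cn R n, Xn_norm Xn n z <= 1 ->
        \sum_(k < n) cabs (z 0 k) ^+ 2 / p k ^+ 2 <= 6 * n%:R].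
Proof.
move=> n0; have nR : 0 < n%:R :> R by rewrite ltr0n.
pose nu (k : 'I_n) := Xn (seq_unit k).
have nu0 k : 0 < nu k by exact: Xn_unit_gt0 XL _.
pose S := [set \prod_(k < n) y k | y in @sqr_hull n].
have yge0 y k : @sqr_hull n y -> 0 <= y k.
  by move=> [N [x [_ ->]]]; apply: sumr_ge0 => j _; rewrite sqr_ge0.
have Sub : has_ubound S.
  exists (\prod_(k < n) (nu k)^-1 ^+ 2) => _ [y hy <-].
  apply: ler_prod => k _; rewrite yge0//=.
  case: hy => N [x [xN ->]].
  rewrite exprVn -[leRHS]mul1r ler_pdivlMr ?exprn_gt0// mulr_suml.
  apply: le_trans xN; apply: ler_sum => j _.
  rewrite -exprMn; apply: lerXn2r; rewrite ?nnegrE.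
  - by rewrite mulr_ge0 ?cabs_ge0// ltW.
  - exact: Xn_norm_ge0 XL _ _.
  - exact: (coord_le_norm XL).
have S0 : exists2 v, S v & 0 < v.
  pose sg := \sum_(k < n) nu k.
  have sg0 : 0 < sg.
    rewrite /sg (bigD1 (Ordinal n0))//=; apply: ltr_wpDr => //.
    by apply: sumr_ge0 => k _; exact: ltW.
  exists (\prod_(k < n) (sg^-1 ^+ 2)); last by apply: prodr_gt0 => k _; rewrite exprn_gt0// invr_gt0.
  exists (fun=> sg^-1 ^+ 2) => //; exists 1%N, (fun=> const_mx (sg^-1)%:C%C); split.
    rewrite big_ord1 exprn_ile1 ?(Xn_norm_ge0 XL)//.
    have := @Xn_norm_le_sum R Xs Xn XL n (const_mx (sg^-1)%:C%C) sg^-1.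
    rewrite mulVf ?gt_eqF//; apply => k.
    by rewrite mxE cabs_real ger0_norm// invr_ge0 ltW.
  by move=> k; rewrite big_ord1 mxE cabs_real ger0_norm// invr_ge0 ltW.
have [v Sv v0] := S0.
have V0 : 0 < sup S by apply: lt_le_trans v0 _; apply: ub_le_sup.
(* Half of the supremum suffices and avoids a compactness argument: mixing y with any point of the
   ball multiplies the product by at most 2. *)
have [_ [y hy <-] yV] : exists2 w, S w & sup S / 2 < w.
  apply: sup_gt; first by exists v.
  by rewrite ltr_pdivrMr// ltr_pMr// ltr1n.
have Y0 : 0 < \prod_(k < n) y k by apply: lt_trans yV; rewrite divr_gt0.
have y0 k : 0 < y k.
  rewrite lt0r yge0// andbT; apply/negP => /eqP yk.
  by move: Y0; rewrite (bigD1 k)//= yk mul0r ltxx.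
exists (fun k => Num.sqrt (y k)); split.
- by move=> k; rewrite sqrtr_gt0.
- exact: sqr_hull_norm.
move=> z z1.
under eq_bigr do rewrite sqr_sqrtr ?(ltW (y0 _))//.
(* With this t, Bernoulli gives (1 - t)^n >= 1/2, hence t times the sum is at most 3, and 3 / t = 6
   n. *)
pose t : R := (2 * n%:R)^-1.
have t0 : 0 < t by rewrite invr_gt0 mulr_gt0.
have tn : n%:R * t = 1 / 2 by rewrite /t; field; rewrite gt_eqF.
have t1 : t <= 1 / 2 by rewrite -tn ler_peMl ?(ltW t0)// ler1n.
have tI : 0 <= t <= 1 by apply/andP; split; lra.
have hmix := sqr_hull_mix hy z1 tI.
have : \prod_(k < n) (t * cabs (z 0 k) ^+ 2 + (1 - t) * y k) <= sup S.
  by apply: ub_le_sup => //; exists (fun k => t * cabs (z 0 k) ^+ 2 + (1 - t) * y k).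
pose u k := cabs (z 0 k) ^+ 2 / y k.
have u0 k : 0 <= u k by rewrite divr_ge0 ?sqr_ge0// ltW.
have E : \prod_(k < n) (t * cabs (z 0 k) ^+ 2 + (1 - t) * y k) =
   \prod_(k < n) (t * u k + (1 - t)) * \prod_(k < n) y k.
  rewrite -big_split; apply: eq_bigr => k _ /=.
  by rewrite [RHS]mulrDl /u -(mulrA t) divfK// gt_eqF.
rewrite E => hV.
have h2 : \prod_(k < n) (t * u k + (1 - t)) <= 2.
  rewrite -(ler_pM2r Y0); apply: (le_trans hV).
  by move: yV; rewrite ltr_pdivrMr// mulrC => /ltW.
have h3 : (1 - t) ^+ n * (1 + \sum_(k < n) t * u k) <= 2.
  apply: le_trans h2.
  apply: (@le_trans _ _ (\prod_(k < n) ((1 - t) * (1 + t * u k)))).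
    rewrite big_split /= prodr_const card_ord ler_wpM2l ?exprn_ge0 ?subr_ge0//; first lra.
    by apply: prod_1D_ge => k; rewrite mulr_ge0// ltW.
  apply: ler_prod => k _; have tu : 0 <= t * u k by rewrite mulr_ge0// ltW.
  by apply/andP; split; nra.
have h4 := bernoulli_le n tI; rewrite tn in h4.
rewrite -mulr_sumr in h3; rewrite -/u.
have T0 : 0 <= \sum_(k < n) u k by apply: sumr_ge0.
have h5 : t * \sum_(k < n) u k <= 3.
  have : 0 <= t * \sum_(k < n) u k by rewrite mulr_ge0// ltW.
  nra.
have -> : 6 * n%:R = 3 / t :> R by rewrite /t; field; rewrite gt_eqF.
by rewrite ler_pdivlMr// mulrC.
Qed.

End Weights.

(** * Multilinear forms with random signs *)

Section LatticeNet.
Context {R : realType}.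
Local Notation C := (R[i]).
Variable N : nat.
Hypothesis N0 : (0 < N)%N.
Local Notation code := {ffun 'I_N -> bool * 'I_(4 * N).+1}.

(** Codes, by sign and modulus, of the points of the lattice (2 sqrt N)^-1 Z^N in the euclidean unit
    ball. A zero coordinate has two codes, which only enlarges the count. *)
Definition net : pred code := fun s => (\sum_(i < N) (s i).2 ^ 2 <= 4 * N)%N.

Definition net_pt (s : code) (i : 'I_N) : R :=
  (-1) ^+ (s i).1 * ((s i).2 : nat)%:R / (2 * Num.sqrt N%:R).

Let sN0 : 0 < Num.sqrt N%:R :> R. Proof. by rewrite sqrtr_gt0 ltr0n. Qed.

Lemma net_pt_norm s : net s -> \sum_(i < N) net_pt s i ^+ 2 <= 1.
Proof.
move=> sN; have e i : net_pt s i ^+ 2 = ((s i).2 ^ 2)%N%:R / (4 * N%:R).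
  rewrite /net_pt !exprMn exprVn sqrr_sign mul1r natrX exprMn sqr_sqrtr//.
  by congr (_ / (_ * _)); ring.
under eq_bigr do rewrite e.
rewrite -mulr_suml -natr_sum ler_pdivrMr ?mulr_gt0 ?ltr0n// mul1r -natrM ler_nat.
exact: sN.
Qed.

(** On the net the moduli add up to at most 4 N, so 1 is at most 16^N times the product of the 2^-(s
    i).2; each coordinate then sums to at most 4, counting both signs. *)
Lemma card_net : #|net|%:R <= 64 ^+ N :> R.
Proof.
apply: (@le_trans _ _ (\sum_(s : code) 16 ^+ N * \prod_(i < N) 2^-1 ^+ (s i).2)).
  rewrite -sum1_card natr_sum [leLHS]big_mkcond; apply: ler_sum => s _.
  have p0 : 0 <= \prod_(i < N) (2^-1 : R) ^+ (s i).2 by apply: prodr_ge0.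
  case: ifP => [sN|_]; last by rewrite mulr_ge0.
  rewrite prodrXr exprVn -[leRHS]/(_ / _) ler_pdivlMr ?exprn_gt0// mul1r.
  have -> : 16 ^+ N = 2 ^+ (4 * N) :> R by rewrite exprM; congr (_ ^+ _); ring.
  rewrite ler_weXn2l ?ler1n//; apply: leq_trans sN; apply: leq_sum => i _.
  by case: (nat_of_ord (s i).2) => // k; rewrite expnS expn1 leq_pmulr.
rewrite -mulr_sumr -(bigA_distr_bigA (fun (_ : 'I_N) (x : bool * 'I_(4 * N).+1) => 2^-1 ^+ x.2)).
rewrite prodr_const card_ord.
have -> : \sum_(x : bool * 'I_(4 * N).+1) 2^-1 ^+ x.2 = 2 * \sum_(k < (4 * N).+1) 2^-1 ^+ k :> R.
  rewrite -(pair_bigA _ (fun (_ : bool) (k : 'I_(4 * N).+1) => 2^-1 ^+ k : R)) /=.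
  by rewrite big_const card_bool /= addr0 mulr_natl mulr2n.
rewrite -exprMn; apply: lerXn2r; rewrite ?nnegrE// ?mulr_ge0 ?sumr_ge0//.
have h : 0 <= (2^-1 : R) < 1 by lra.
have := geom_sum_le (4 * N).+1 h; have -> : (1 - 2^-1)^-1 = 2 :> R by field.
lra.
Qed.

(** Rounding towards 0 stays in the ball, and each coordinate moves by at most 1 / (2 sqrt N), so
    twice the error lies in the ball again and can itself be rounded. *)
Lemma net_round (v : 'I_N -> R) : \sum_(i < N) v i ^+ 2 <= 1 ->
  exists2 s, net s & \sum_(i < N) (2 * (v i - net_pt s i)) ^+ 2 <= 1.
Proof.
move=> v1; pose q := 2 * Num.sqrt N%:R : R.
have q0 : 0 < q by rewrite mulr_gt0.
have q2 : q ^+ 2 = 4 * N%:R by rewrite exprMn sqr_sqrtr//; ring.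
pose a i := Num.truncn (q * `|v i|).
have aP i : (a i)%:R <= q * `|v i| < (a i)%:R + 1.
  by rewrite natr1; apply: truncn_itv; rewrite mulr_ge0// ltW.
have aN : (\sum_(i < N) a i ^ 2 <= 4 * N)%N.
  rewrite -(ler_nat R) natrM -q2 natr_sum.
  apply: (@le_trans _ _ (\sum_(i < N) q ^+ 2 * v i ^+ 2)).
    apply: ler_sum => i _; rewrite natrX -(real_normK (num_real (v i))) -exprMn.
    have /andP[h _] := aP i.
    by apply: lerXn2r; rewrite ?nnegrE// mulr_ge0// ltW.
  by rewrite -mulr_sumr ler_piMr// sqr_ge0.
have ai i : (a i <= 4 * N)%N.
  apply: leq_trans aN; rewrite (bigD1 i)//=; apply: leq_trans (leq_addr _ _).
  by case: (a i) => // k; rewrite expnS expn1 leq_pmulr.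
exists [ffun i => (v i < 0, inord (a i))].
  rewrite /net; apply: leq_trans aN; rewrite leq_eqVlt; apply/orP; left; apply/eqP.
  by apply: eq_bigr => i _; rewrite ffunE /= inordK// ltnS.
apply: (@le_trans _ _ (\sum_(i < N) N%:R^-1)); last first.
  by rewrite sumr_const card_ord -(mulr_natr N%:R^-1) mulVf// pnatr_eq0 -lt0n.
apply: ler_sum => i _; rewrite /net_pt ffunE /= inordK ?ltnS// -/q.
have vE : v i = (-1) ^+ (v i < 0)%R * `|v i| by rewrite [LHS]realEsign// num_real.
have -> : 2 * (v i - (-1) ^+ (v i < 0)%R * (a i)%:R / q) = (-1) ^+ (v i < 0)%R * (2 * (q * `|v i| - (a i)%:R) / q).
  by rewrite {1}vE; field; rewrite gt_eqF.
rewrite exprMn sqrr_sign mul1r exprMn exprVn q2 ler_pdivrMr ?mulr_gt0 ?ltr0n//.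
have -> : N%:R^-1 * (4 * N%:R) = 4 :> R by field; rewrite pnatr_eq0 -lt0n.
by have /andP[h1 h2] := aP i; nra.
Qed.

Lemma net_linear_real (L : 'I_N -> C) (b : R) :
  (forall s, net s -> cabs (\sum_(i < N) (net_pt s i)%:C%C * L i) <= b) ->
  forall v : 'I_N -> R, cabs (\sum_(i < N) (v i)%:C%C * L i) <= 2 * b * Num.sqrt (\sum_(i < N) v i ^+ 2).
Proof.
move=> Hb.
pose l (v : 'I_N -> R) := \sum_(i < N) (v i)%:C%C * L i.
pose B := \sum_(i < N) cabs (L i).
have B0 : 0 <= B by apply: sumr_ge0 => i _; exact: cabs_ge0.
(* Iterated rounding writes v as net points with weights 1, 1/2, 1/4, ...; the trivial bound B for
   the last error is halved q times. *)
have step q : forall v, \sum_(i < N) v i ^+ 2 <= 1 -> cabs (l v) <= 2 * b + B / 2 ^+ q.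
  elim: q => [|q IH] v v1.
    have b0 : 0 <= b.
      have [s sN _] := net_round v1; exact: le_trans (cabs_ge0 _) (Hb s sN).
    rewrite expr0 divr1; apply: (@le_trans _ _ B); last by rewrite lerDr mulr_ge0.
    rewrite (le_trans (cabs_sum _ _ _))//; apply: ler_sum => i _.
    rewrite cabsM cabs_real ler_piMl ?cabs_ge0// -(@ler_pXn2r _ 2) ?nnegrE//.
    rewrite expr1n real_normK ?num_real//; apply: le_trans v1.
    by rewrite (bigD1 i)//= lerDl sumr_ge0// => j _; rewrite sqr_ge0.
  have [s sN /IH h] := net_round v1.
  have -> : l v = l (net_pt s) + (2^-1)%:C%C * l (fun i => 2 * (v i - net_pt s i)).
    rewrite /l mulr_sumr -big_split; apply: eq_bigr => i _ /=.
    by rewrite mulrA -mulrDl -rmorphM -rmorphD; congr (_%:C%C * _); field.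
  rewrite (le_trans (cabsD _ _))// cabsM cabs_real ger0_norm//.
  have := Hb s sN; rewrite -/(l _) exprS invfM.
  move: h; set y := cabs _; set x := cabs _; set p := B / _; have -> : B * (2^-1 / 2 ^+ q) = p / 2 by rewrite /p; field; rewrite expf_neq0.
  lra.
have unit v : \sum_(i < N) v i ^+ 2 <= 1 -> cabs (l v) <= 2 * b.
  move=> v1; apply/ler_addgt0Pr => e e0.
  have h : 0 <= (2^-1 : R) < 1 by lra.
  have [q Hq] := expr_small h (divr_gt0 e0 (ltr_wpDl B0 ltr01)).
  apply: (le_trans (step q v v1)); rewrite lerD2l -exprVn.
  have := Hq q (leqnn q); rewrite ler_pdivlMr ?ltr_wpDl//.
  have : 0 <= 2^-1 ^+ q :> R by rewrite exprn_ge0.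
  nra.
move=> v; set S := \sum_(i < N) v i ^+ 2.
have S0 : 0 <= S by apply: sumr_ge0 => i _; rewrite sqr_ge0.
have [Sz|Sn] := eqVneq S 0.
  rewrite Sz sqrtr0 mulr0 big1 ?cabs0// => i _.
  have : v i ^+ 2 = 0.
    by move/eqP: Sz; rewrite psumr_eq0 => [/allP /(_ i) /(_ (mem_index_enum _)) /eqP|j _]; rewrite ?sqr_ge0.
  by move/eqP; rewrite sqrf_eq0 => /eqP ->; rewrite mul0r.
have r0 : 0 < Num.sqrt S by rewrite sqrtr_gt0 lt0r Sn.
have := unit (fun i => v i / Num.sqrt S).
have -> : \sum_(i < N) (v i / Num.sqrt S) ^+ 2 = 1.
  under eq_bigr do rewrite exprMn exprVn sqr_sqrtr//.
  by rewrite -mulr_suml divff.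
move=> /(_ (lexx _)).
have -> : l (fun i => v i / Num.sqrt S) = (Num.sqrt S)^-1%:C%C * \sum_(i < N) (v i)%:C%C * L i.
  rewrite /l mulr_sumr; apply: eq_bigr => i _.
  by rewrite rmorphM mulrA [(_^-1)%:C%C * _]mulrC.
by rewrite cabsM cabs_real ger0_norm ?invr_ge0 ?(ltW r0)// [X in X <= _]mulrC ler_pdivrMr.
Qed.

Lemma net_linear (L : 'I_N -> C) (b : R) : 0 <= b ->
  (forall s, net s -> cabs (\sum_(i < N) (net_pt s i)%:C%C * L i) <= b) ->
  forall x : 'I_N -> C, cabs (\sum_(i < N) x i * L i) <= 4 * b * Num.sqrt (\sum_(i < N) cabs (x i) ^+ 2).
Proof.
move=> b0 Hb x; have H := net_linear_real Hb.
have -> : \sum_(i < N) x i * L i = \sum_(i < N) (complex.Re (x i))%:C%C * L i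
    + 'i%C * \sum_(i < N) (complex.Im (x i))%:C%C * L i.
  rewrite mulr_sumr -big_split; apply: eq_bigr => i _ /=.
  by rewrite mulrA -mulrDl -complexE.
have ci : cabs ('i%C : C) = 1 by rewrite /cabs /= expr0n expr1n add0r sqrtr1.
rewrite (le_trans (cabsD _ _))// cabsM ci mul1r.
have h1 := H (fun i => complex.Re (x i)); have h2 := H (fun i => complex.Im (x i)).
have s1 : Num.sqrt (\sum_(i < N) complex.Re (x i) ^+ 2) <= Num.sqrt (\sum_(i < N) cabs (x i) ^+ 2).
  by rewrite ler_wsqrtr//; apply: ler_sum => i _; rewrite cabs_sqr lerDl sqr_ge0.
have s2 : Num.sqrt (\sum_(i < N) complex.Im (x i) ^+ 2) <= Num.sqrt (\sum_(i < N) cabs (x i) ^+ 2).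
  by rewrite ler_wsqrtr//; apply: ler_sum => i _; rewrite cabs_sqr lerDr sqr_ge0.
nra.
Qed.

End LatticeNet.

(** * Exponential moments and the choice of signs *)

Section RandomForm.
Context {R : realType}.
Local Notation C := (R[i]).

(** A subgaussian bound for a random sign. For x > 1/2 it follows from x <= 2 x^2, for smaller x
    from e^x (1 - x) <= 1. *)
Lemma expR_sym_le (x : R) : expR x + expR (- x) <= 2 * expR (2 * x ^+ 2).
Proof.
wlog x0 : x / 0 <= x => [H|].
  case: (leP 0 x) => [|/ltW x0]; first exact: H.
  by have := H (- x); rewrite oppr_ge0 opprK sqrrN addrC; apply.
have [x1|x1] := leP x (1 / 2).
  have e1 : expR x <= 1 + x + 2 * x ^+ 2.
    have h := expR_ge1Dx (- x); have p := expR_gt0 x.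
    have : expR x * expR (- x) = 1 by rewrite -expRD subrr expR0.
    move=> E; have : expR x * (1 - x) <= 1 by rewrite -[leRHS]E; apply: ler_wpM2l => //; exact: ltW.
    have : 0 <= x ^+ 2 * (1 - 2 * x) by rewrite mulr_ge0 ?sqr_ge0//; lra.
    nra.
  have e2 : expR (- x) <= 1 - x + 2 * x ^+ 2.
    have h := expR_ge1Dx x; have p := expR_gt0 (- x).
    have : expR x * expR (- x) = 1 by rewrite -expRD subrr expR0.
    move=> E; have : (1 + x) * expR (- x) <= 1 by rewrite -[leRHS]E; apply: ler_wpM2r => //; exact: ltW.
    nra.
  have := expR_ge1Dx (2 * x ^+ 2); lra.
have e1 : expR x <= expR (2 * x ^+ 2) by rewrite ler_expR; nra.
have e2 : expR (- x) <= expR (2 * x ^+ 2) by rewrite ler_expR; nra.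
lra.
Qed.

Lemma expR7_ge : 128 <= expR 7 :> R.
Proof.
have e2 : 2 <= expR 1 :> R by have := expR_ge1Dx (1 : R); lra.
have -> : expR 7 = expR 1 ^+ 7 :> R by rewrite -expRM_natl mulr1.
have -> : 128 = 2 ^+ 7 :> R by ring.
by apply: lerXn2r; rewrite ?nnegrE ?expR_ge0.
Qed.

Variables (m N : nat).
Hypothesis m0 : (0 < m)%N.
Hypothesis N0 : (0 < N)%N.
Local Notation idx := {ffun 'I_m -> 'I_N}.
Local Notation code := {ffun 'I_N -> bool * 'I_(4 * N).+1}.

Definition sgform (e : {ffun idx -> bool}) (x : 'I_m -> 'I_N -> C) : C :=
  \sum_(p : idx) (-1) ^+ e p * \prod_(j < m) x j (p j).

Definition rsgform (e : {ffun idx -> bool}) (x : 'I_m -> 'I_N -> R) : R :=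
  \sum_(p : idx) (-1) ^+ e p * \prod_(j < m) x j (p j).

Lemma sgform_real e x : sgform e (fun j i => (x j i)%:C%C) = (rsgform e x)%:C%C.
Proof.
rewrite /sgform /rsgform rmorph_sum; apply: eq_bigr => p _.
by rewrite rmorphM rmorph_prod /= rmorphXn rmorphN1.
Qed.

(** The sum over signs factorises over the index tuples, and the squared coefficients sum to la^2
    times a product of squared l2 norms. *)
Lemma sum_expR_form (x : 'I_m -> 'I_N -> R) (la : R) :
  (forall j, \sum_(i < N) x j i ^+ 2 <= 1) ->
  \sum_(e : {ffun idx -> bool}) expR (la * rsgform e x) <= 2 ^+ #|{: idx}| * expR (2 * la ^+ 2).
Proof.
move=> x1.
pose c (p : idx) := la * \prod_(j < m) x j (p j).
have E e : expR (la * rsgform e x) = \prod_(p : idx) expR ((-1) ^+ e p * c p).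
  rewrite -expR_sum /rsgform mulr_sumr; congr expR; apply: eq_bigr => p _.
  by rewrite mulrCA.
under eq_bigr do rewrite E.
rewrite -(bigA_distr_bigA (fun (p : idx) (s : bool) => expR ((-1) ^+ s * c p))) /=.
apply: (@le_trans _ _ (\prod_(p : idx) (2 * expR (2 * c p ^+ 2)))).
  apply: ler_prod => p _; rewrite big_bool /= expr1 expr0 mul1r mulN1r.
  by rewrite addr_ge0 ?expR_ge0//= addrC expR_sym_le.
rewrite big_split /= prodr_const ler_wpM2l ?exprn_ge0//.
rewrite -expR_sum ler_expR -mulr_sumr ler_wpM2l//.
have -> : \sum_(p : idx) c p ^+ 2 = la ^+ 2 * \prod_(j < m) \sum_(i < N) x j i ^+ 2.
  rewrite (bigA_distr_bigA (fun j i => x j i ^+ 2)) mulr_sumr; apply: eq_bigr => p _.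
  by rewrite /c exprMn prodrXl.
rewrite ler_piMr ?sqr_ge0//.
rewrite [leRHS](_ : 1 = \prod_(j < m) 1); last by rewrite big1.
by apply: ler_prod => j _; rewrite x1 andbT; apply: sumr_ge0 => i _; rewrite sqr_ge0.
Qed.

Definition nets : pred {ffun 'I_m -> code} := fun s => [forall j, net (s j)].

Lemma card_nets : #|nets|%:R <= 64 ^+ (N * m) :> R.
Proof.
have -> : #|nets| = (#|@net N| ^ m)%N.
  have -> : #|nets| = #|(ffun_on (@net N) : simpl_pred {ffun 'I_m -> code})| by apply: eq_card => s; rewrite !inE.
  by rewrite card_ffun_on card_ord.
rewrite natrX exprM; apply: lerXn2r; rewrite ?nnegrE ?exprn_ge0//; exact: card_net.
Qed.

(* Union bound over the net for the exponential moments of [sum_expR_form]. *)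
Lemma good_signs_net : exists e : {ffun idx -> bool}, forall s, nets s ->
  `|rsgform e (fun j => net_pt (s j))| <= 9 * Num.sqrt (N * m)%:R.
Proof.
pose K := (N * m)%:R : R.
have K1 : 1 <= K by rewrite ler1n muln_gt0 N0.
(* This balances the moment exponent 2 la^2 = 2 K against the logarithm of the net size, of order
   K. *)
pose la := Num.sqrt K.
have la2 : la ^+ 2 = K by rewrite sqr_sqrtr//; lra.
have la0 : 0 < la by rewrite sqrtr_gt0; lra.
pose f (e : {ffun idx -> bool}) : R := \sum_(s | nets s)
   (expR (la * rsgform e (fun j => net_pt (s j))) + expR (- la * rsgform e (fun j => net_pt (s j)))).
pose B : R := 2 * 64 ^+ (N * m) * expR (2 * K).
have tot : \sum_e f e <= 2 ^+ #|{: idx}| * B.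
  rewrite /f exchange_big /=.
  apply: (@le_trans _ _ (\sum_(s | nets s) 2 ^+ #|{: idx}| * (2 * expR (2 * K)))).
    apply: ler_sum => s /forallP sN; rewrite big_split /=.
    have x1 j : \sum_(i < N) (net_pt (s j) i : R) ^+ 2 <= 1 by apply: net_pt_norm.
    have := sum_expR_form la x1; have := sum_expR_form (- la) x1.
    rewrite sqrrN la2 => h1 h2; rewrite (mulrCA _ 2) mulr_natl mulr2n; exact: lerD.
  rewrite sumr_const -(mulr_natr (2 ^+ _ * _)) -mulrA ler_wpM2l ?exprn_ge0// /B.
  rewrite [leRHS]mulrAC; apply: ler_wpM2l; [by rewrite mulr_ge0 ?expR_ge0 | exact: card_nets].
have [e fe] : exists e, f e <= B.
  apply: contrapT => h; move: tot; rewrite leNgt => /negP; apply.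
  have -> : 2 ^+ #|{: idx}| * B = \sum_(e : {ffun idx -> bool}) B.
    have cE : #|{: {ffun idx -> bool}}| = (2 ^ #|{: idx}|)%N by rewrite (@card_ffun idx bool) card_bool.
    by rewrite sumr_const cE mulrC -natrX mulr_natr.
  apply: ltr_sum; last by move=> e _; rewrite ltNge; apply/negP => he; apply: h; exists e.
  apply/hasP; exists [ffun=> true] => //; exact: mem_index_enum.
exists e => s sN; set A := rsgform _ _.
have hB : expR (la * `|A|) <= B.
  apply: le_trans fe; rewrite /f (bigD1 s)//= -/A.
  apply: (@le_trans _ _ (expR (la * A) + expR (- la * A))); last first.
    by rewrite lerDl sumr_ge0// => s' _; rewrite addr_ge0 ?expR_ge0.
  case: (leP 0 A) => A0.
    by rewrite ger0_norm// lerDl expR_ge0.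
  by rewrite ltr0_norm// mulrN -mulNr lerDr expR_ge0.
(* 9 = 7 + 2: the count satisfies 2 * 64^K <= 128^K <= e^(7K), the moment gives e^(2K). *)
have B9 : B <= expR (9 * K).
  have -> : 9 * K = (N * m)%:R * 7 + 2 * K by rewrite /K; ring.
  rewrite expRD /B ler_wpM2r ?expR_ge0// expRM_natl.
  apply: (@le_trans _ _ (128 ^+ (N * m))); last first.
    by apply: lerXn2r; rewrite ?nnegrE ?expR_ge0// expR7_ge.
  have -> : 128 = 2 * 64 :> R by ring.
  rewrite exprMn ler_wpM2r ?exprn_ge0//.
  rewrite -[leLHS]expr1 ler_weXn2l ?ler1n// muln_gt0 N0//.
have := le_trans hB B9; rewrite ler_expR -la2 expr2 mulrCA.
by rewrite ler_pM2l.
Qed.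

Lemma sgform_linear e (x : 'I_m -> 'I_N -> C) (k : 'I_m) :
  exists L : 'I_N -> C, forall v,
    sgform e (fun j => if j == k then v else x j) = \sum_(i < N) v i * L i.
Proof.
exists (fun i => \sum_(p : idx | p k == i) (-1) ^+ e p * \prod_(j < m | j != k) x j (p j)) => v.
rewrite /sgform (partition_big (fun p : idx => p k) xpredT)//=; apply: eq_bigr => i _.
rewrite mulr_sumr; apply: eq_bigr => p /eqP pk.
rewrite (bigD1 k)//= eqxx pk mulrCA; congr (_ * (_ * _)).
by apply: eq_bigr => j /negbTE ->.
Qed.

Definition l2norm (x : 'I_N -> C) : R := Num.sqrt (\sum_(i < N) cabs (x i) ^+ 2).

(** The slots are released from the net one by one: the form is linear in each slot, so [net_linear]
    applies and costs a factor 4. In the induction the slots from k on still hold net points. *)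
Lemma sgform_extend e (b : R) : 0 <= b ->
  (forall s, nets s -> `|rsgform e (fun j => net_pt (s j))| <= b) ->
  forall x : 'I_m -> 'I_N -> C, cabs (sgform e x) <= 4 ^+ m * b * \prod_(j < m) l2norm (x j).
Proof.
move=> b0 Hb.
have H k : (k <= m)%N -> forall x : 'I_m -> 'I_N -> C,
    (forall j : 'I_m, (k <= j)%N -> exists2 s, net s & x j = fun i => (net_pt s i)%:C%C) ->
    cabs (sgform e x) <= 4 ^+ k * b * \prod_(j < m | (j < k)%N) l2norm (x j).
  elim: k => [|k IH] km x xk.
    rewrite expr0 mul1r big_pred0 // mulr1.
    have /choice[s sP] : forall j : 'I_m, exists s, net s /\ x j = fun i => (net_pt s i)%:C%C.
      by move=> j; have [s s1 s2] := xk j (leq0n j); exists s.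
    have -> : x = fun j i => (net_pt ([ffun j => s j] j) i)%:C%C.
      by apply/funext => j; rewrite ffunE (sP j).2.
    rewrite sgform_real cabs_real.
    by apply: Hb; apply/forallP => j; rewrite ffunE; exact: (sP j).1.
  pose k' : 'I_m := Ordinal km.
  have [L LE] := sgform_linear e x k'.
  have xE : x = fun j => if j == k' then x k' else x j.
    by apply/funext => j; case: eqP => [->|].
  rewrite {1}xE LE.
  have -> : 4 ^+ k.+1 * b * \prod_(j < m | (j < k.+1)%N) l2norm (x j) =
     4 * (4 ^+ k * b * \prod_(j < m | (j < k)%N) l2norm (x j)) * Num.sqrt (\sum_(i < N) cabs (x k' i) ^+ 2).
    rewrite (bigD1 k')//= -/(l2norm (x k')) exprS.
    rewrite (eq_bigl (fun j : 'I_m => (j < k)%N)); first ring.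
    by move=> j; rewrite [RHS]ltn_neqAle andbC ltnS -val_eqE.
  apply: net_linear => //.
    by rewrite !mulr_ge0 ?exprn_ge0// prodr_ge0// => j _; rewrite sqrtr_ge0.
  move=> s sN; rewrite -LE.
  apply: le_trans (IH (ltnW km) _ _) _.
    move=> j; case: eqP => [_ _|/eqP jk kj]; first by exists s.
    by apply: xk; rewrite ltn_neqAle kj andbT eq_sym.
  rewrite le_eqVlt; apply/orP; left; apply/eqP; congr (_ * _); apply: eq_bigr => j jk.
  by case: eqP => // jk'; move: jk; rewrite jk' /= ltnn.
move=> x; have := H m (leqnn m) x; rewrite (eq_bigl xpredT) => [|j]; last by rewrite ltn_ord.
by apply => j; rewrite leqNgt ltn_ord.
Qed.

Lemma good_signs : exists e : {ffun idx -> bool}, forall x : 'I_m -> 'I_N -> C,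
  cabs (sgform e x) <= 72 ^+ m * Num.sqrt N%:R * \prod_(j < m) l2norm (x j).
Proof.
have [e He] := good_signs_net; exists e => x.
have b0 : 0 <= 9 * Num.sqrt (N * m)%:R :> R by rewrite mulr_ge0 ?sqrtr_ge0.
apply: le_trans (sgform_extend b0 He x) _.
apply: ler_wpM2r; first by apply: prodr_ge0 => j _; rewrite sqrtr_ge0.
rewrite natrM sqrtrM//.
have sm : Num.sqrt m%:R <= 2 ^+ m :> R.
  rewrite -[leRHS]ger0_norm ?exprn_ge0// -sqrtr_sqr ler_wsqrtr// -exprM -natrX ler_nat.
  apply: leq_trans (ltnW (ltn_expl m (ltnSn 1))) _.
  by rewrite leq_exp2l// leq_pmulr.
have n9 : 9 <= 9 ^+ m :> R by rewrite -[leLHS]expr1 ler_weXn2l// ler1n.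
(* 4^m from the extension, 9 <= 9^m, and sqrt m <= 2^m, which leaves only sqrt N beside the m-th
   power. *)
have -> : 72 ^+ m = 4 ^+ m * (9 ^+ m * 2 ^+ m) :> R.
  by rewrite -!exprMn; congr (_ ^+ _); ring.
rewrite -!mulrA ler_wpM2l ?exprn_ge0//; apply: ler_pM; rewrite ?mulr_ge0 ?sqrtr_ge0//.
by rewrite mulrC ler_wpM2r ?sqrtr_ge0.
Qed.

End RandomForm.

(** * Upper bounds *)

Section TaylorUniqueness.
Context {R : realType}.
Local Notation C := (R[i]).
Variables (Xs : set (nat -> C)) (Xn : (nat -> C) -> R).
Hypothesis XL : banach_seq_lattice Xs Xn.

Lemma differentiable_sum_seq (V : normedModType C) (I : Type) (s : seq I) (F : I -> V -> C^o) (z : V) :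
  (forall i, differentiable (F i) z) -> differentiable ((fun x => \sum_(i <- s) F i x) : V -> C^o) z.
Proof.
move=> dF; elim: s => [|i s IH].
  by rewrite (_ : (fun x => _) = cst 0); [exact: differentiable_cst | apply/funext => x; rewrite big_nil].
rewrite (_ : (fun x => _) = F i + (fun x => \sum_(j <- s) F j x)).
  exact: differentiableD.
by apply/funext => x; rewrite big_cons.
Qed.

Lemma differentiable_prod_seq (V : normedModType C) (I : Type) (s : seq I) (F : I -> V -> C^o) (z : V) :
  (forall i, differentiable (F i) z) -> differentiable ((fun x => \prod_(i <- s) F i x) : V -> C^o) z.
Proof.
move=> dF; elim: s => [|i s IH].
  by rewrite (_ : (fun x => _) = cst 1); [exact: differentiable_cst | apply/funext => x; rewrite big_nil].
rewrite (_ : (fun x => _) = (F i : V -> C) * (fun x => \prod_(j <- s) F j x : C)).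
  exact: differentiableM.
by apply/funext => x; rewrite big_cons.
Qed.

Lemma mono_tpolyE n N (a : {ffun 'I_n -> 'I_N}) (z : @Cn R n) :
  monom n z (mext a) = mono a (fun k => z 0 k).
Proof. by apply: eq_bigr => k _; rewrite mextE. Qed.

(** Avoids differentiating the polynomial: its slice means are known, so the difference of the two
    homogeneous parts vanishes on the ball, in particular on a small discrete torus, and Parseval
    kills its coefficients. *)
Lemma taylor_coef_unique n (f : @Cn R n -> C^o) (b : R) m N (A : {ffun 'I_n -> 'I_N.+1} -> C) :
  holomorphic_on n (Xball Xn n 1) f ->
  (forall z, Xball Xn n 1 z -> cabs (f z) <= b) ->
  (forall a, mdeg a != m -> A a = 0) ->
  (forall z, f z = tpoly A (fun k => z 0 k)) ->
  (m <= N)%N -> forall a, (mdeg a <= N)%N -> taylor_coef n (mext a) f = A a.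
Proof.
move=> fh fb A0 fE mN a aN; set d := mdeg a.
have fZ (w : C) z : f (w *: z) = w ^+ m * f z.
  rewrite !fE -(tpolyZ A0); congr tpoly; apply/funext => k; by rewrite mxE.
have hE z : Xball Xn n 1 z -> hpart f d N.+1 z = (d == m)%:R * f z.
  move=> z1; apply: ctends_unique (hpart_limit XL fh fb z1 (aN : (d < N.+1)%N)) _.
  have [d0 Hd] := pow2_gt_ex (m + d).
  apply: (@ctends_ext _ (fun=> (d == m)%:R * f z) _ _ d0); last exact: ctends_cst.
  move=> l /Hd ld.
  transitivity (cmean l (fun w => f z * (w ^+ m * w^-1 ^+ d))).
    rewrite cmeanZ cmean_mono; [|exact: leq_ltn_trans (leq_addr _ _) ld|exact: leq_ltn_trans (leq_addl _ _) ld].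
    by rewrite mulrC eq_sym.
  by apply: eq_cmean => w _; rewrite fZ; ring.
pose D (c : {ffun 'I_n -> 'I_N.+1}) : C := if mdeg c == d then taylor_coef n (mext c) f - A c else 0.
have Dz z : Xball Xn n 1 z -> tpoly D (fun k => z 0 k) = 0.
  move=> z1.
  have -> : tpoly D (fun k => z 0 k) = hpart f d N.+1 z - (d == m)%:R * f z; last by rewrite hE// subrr.
  have -> : (d == m)%:R * f z = \sum_(c : {ffun 'I_n -> 'I_N.+1} | mdeg c == d) A c * monom n z (mext c).
    rewrite fE /tpoly mulr_sumr [RHS]big_mkcond; apply: eq_bigr => c _; rewrite mono_tpolyE.
    have [cm|cm] := eqVneq (mdeg c) m; last by rewrite A0// mul0r mulr0; case: ifP.
    by rewrite cm eq_sym; case: eqP => _; rewrite ?mul1r ?mul0r.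
  rewrite /hpart -sumrB /tpoly [RHS]big_mkcond; apply: eq_bigr => c _; rewrite /D mono_tpolyE.
  by case: eqP => _; rewrite ?mul0r// mulrBl.
pose sg : R := \sum_(k < n) Xn (seq_unit k).
have sg0 : 0 <= sg by apply: sumr_ge0 => k _; rewrite ltW// (Xn_unit_gt0 XL).
pose t : R := (1 + sg)^-1 / 2.
have t0 : 0 < t by rewrite divr_gt0// invr_gt0; lra.
have [l Hl] := pow2_gt_ex N.+1.
have Nl : (N.+1 <= 2 ^ l)%N by rewrite ltnW// Hl.
have Ddeg c : mdeg c != d -> D c = 0 by rewrite /D => /negbTE ->.
have zero t' : tpoly D (@tpt R n l t') = 0.
  have := Dz (\row_k (t%:C%C * tpt t' k)).
  have -> : (fun k => (\row_k0 (t%:C%C * tpt t' k0) : @Cn R n) 0 k) = (fun k => t%:C%C * tpt t' k).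
    by apply/funext => k; rewrite mxE.
  rewrite (tpolyZ Ddeg).
  have B : Xball Xn n 1 (\row_k (t%:C%C * tpt t' k)).
    have yr k : cabs ((\row_k (t%:C%C * tpt t' k) : @Cn R n) 0 k) <= t.
      by rewrite mxE cabsM cabs_tpt mulr1 cabs_real gtr0_norm.
    rewrite /Xball /=; apply: le_lt_trans (Xn_norm_le_sum XL yr) _.
    rewrite -/sg /t mulrAC ltr_pdivrMr// mulrC -ltr_pdivlMr ?invr_gt0; last lra.
    rewrite invrK; lra.
  move=> /(_ B) /eqP; rewrite mulf_eq0 expf_eq0 => /orP[/andP[_]|/eqP//].
  by rewrite -cabs_eq0 cabs_real normr_eq0 gt_eqF.
have := tpoly_parseval D Nl.
rewrite big1 => [/esym/eqP|t' _]; last by rewrite zero cabs0 expr0n.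
rewrite mulf_eq0 pnatr_eq0 expn_eq0 expn_eq0 /=.
rewrite psumr_eq0 => [/allP /(_ a) /(_ (mem_index_enum _))|c _]; last by rewrite sqr_ge0.
by rewrite /= sqrf_eq0 cabs_eq0 /D eqxx subr_eq0 => /eqP.
Qed.

End TaylorUniqueness.

(** * The tetrahedral test polynomial *)

Section UpperBound.
Context {R : realType}.
Local Notation C := (R[i]).
Variables (Xs : set (nat -> C)) (Xn : (nat -> C) -> R).
Hypothesis XL : banach_seq_lattice Xs Xn.
Variable M : R.
Variables (n m : nat).
Hypothesis m0 : (0 < m)%N.
Let N := (n %/ m)%N.

Lemma blk_proof (j : 'I_m) (i : 'I_N) : (j * N + i < n)%N.
Proof.
apply: (@leq_trans (m * N)%N); last by rewrite mulnC leq_divM.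
have := ltn_ord j; have := ltn_ord i; case: j i => [j /= _] [i /= _] iN jm.
apply: (@leq_trans (j.+1 * N)%N); last by rewrite leq_mul2r jm orbT.
by rewrite mulSn addnC ltn_add2r.
Qed.

(* The n variables contain m disjoint blocks of n %/ m variables each. *)
Definition blk j i : 'I_n := Ordinal (blk_proof j i).

Lemma blk_inj j i j' i' : blk j i = blk j' i' -> j = j' /\ i = i'.
Proof.
move=> /(congr1 val) /= e.
have E : j = j' :> nat.
  have := congr1 (divn^~ N) e.
  have N0 : (0 < N)%N by apply: leq_ltn_trans (ltn_ord i).
  by rewrite !divnMDl// !divn_small ?addn0 ?ltn_ord.
by split; apply/val_inj => //=; move/eqP: e; rewrite E eqn_add2l => /eqP.
Qed.

Variables (p : 'I_n -> R) (e : {ffun {ffun 'I_m -> 'I_N} -> bool}).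
Hypothesis p0 : forall k, 0 < p k.
Hypothesis pM : Xn_norm Xn n (\row_k (p k)%:C%C) <= Num.max M 1.
Hypothesis p_ell : forall z : @Cn R n, Xn_norm Xn n z <= 1 ->
  \sum_(k < n) cabs (z 0 k) ^+ 2 / p k ^+ 2 <= 6 * n%:R.
Hypothesis eP : forall x : 'I_m -> 'I_N -> C,
  cabs (sgform e x) <= 72 ^+ m * Num.sqrt N%:R * \prod_(j < m) l2norm (x j).

Definition block_form (z : @Cn R n) : C^o :=
  sgform e (fun j i => z 0 (blk j i) / (p (blk j i))%:C%C).

Definition block_bound : R := 72 ^+ m * Num.sqrt N%:R * Num.sqrt ((6 * n%:R / m%:R) ^+ m).

(** The arithmetic-geometric mean inequality over the m blocks turns the product of squared norms
    into the m-th power of their average; the blocks being disjoint, their sum is at most the 6 n of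
    the ellipsoid. *)
Lemma block_form_le z : Xn_norm Xn n z <= 1 -> cabs (block_form z) <= block_bound.
Proof.
move=> z1; pose x (j : 'I_m) (i : 'I_N) := z 0 (blk j i) / (p (blk j i))%:C%C.
apply: le_trans (eP x) _.
apply: ler_wpM2l; first by rewrite mulr_ge0 ?sqrtr_ge0// exprn_ge0.
have P0 : 0 <= \prod_(j < m) l2norm (x j) by apply: prodr_ge0 => j _; rewrite sqrtr_ge0.
rewrite -[leLHS]ger0_norm// -sqrtr_sqr ler_wsqrtr//.
have S0 j : 0 <= \sum_(i < N) cabs (x j i) ^+ 2 by apply: sumr_ge0 => i _; rewrite sqr_ge0.
have -> : (\prod_(j < m) l2norm (x j)) ^+ 2 = \prod_(j < m) \sum_(i < N) cabs (x j i) ^+ 2.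
  by rewrite -prodrXl; apply: eq_bigr => j _; rewrite sqr_sqrtr.
have := leif_AGM (A := [pred j : 'I_m | true]) (E := fun j => \sum_(i < N) cabs (x j i) ^+ 2) (fun j _ => S0 j).
move=> /leifP; rewrite card_ord.
set T := \sum_(j in _) _ => h.
have {}h : \prod_(j < m) \sum_(i < N) cabs (x j i) ^+ 2 <= (T / m%:R) ^+ m.
  by move: h; case: ifP => _; [move/eqP => -> | move/ltW].
apply: (le_trans h); apply: lerXn2r; rewrite ?nnegrE ?divr_ge0 ?sumr_ge0 ?mulr_ge0//.
rewrite ler_pM2r ?invr_gt0 ?ltr0n//; apply: le_trans (p_ell z1).
rewrite /T pair_big /=.
have E (q : 'I_m * 'I_N) : cabs (x q.1 q.2) ^+ 2 = cabs (z 0 (blk q.1 q.2)) ^+ 2 / p (blk q.1 q.2) ^+ 2.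
  by rewrite /x cabsM cabsV cabs_real gtr0_norm// exprMn exprVn.
under eq_bigr do rewrite E.
pose blq (q : 'I_m * 'I_N) := blk q.1 q.2.
have binj : injective blq.
  by move=> [j i] [j' i'] /blk_inj /= [-> ->].
pose G k := cabs (z 0 k) ^+ 2 / p k ^+ 2.
have G0 k : 0 <= G k by rewrite divr_ge0 ?sqr_ge0.
apply: (@le_trans _ _ (\sum_(k in (blq @: [set: 'I_m * 'I_N])%SET) G k)).
  rewrite big_imset /=; last by move=> ? ? _ _; exact: binj.
  rewrite le_eqVlt; apply/orP; left; apply/eqP; by apply: eq_bigl => q; rewrite finset.in_setT.
rewrite [leLHS]big_mkcond; apply: ler_sum => k _; case: ifP => _; [exact: lexx | exact: G0].
Qed.

Lemma block_form_hol : holomorphic_on n (Xball Xn n 1) block_form.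
Proof.
move=> z _; apply: differentiable_sum_seq => q.
have H := @differentiable_prod_seq R (@Cn R n) 'I_m (index_enum 'I_m)
  (fun j z => z 0 (blk j (q j)) / (p (blk j (q j)))%:C%C) z.
have dP : differentiable ((fun x : @Cn R n => \prod_(j < m) (x 0 (blk j (q j)) / (p (blk j (q j)))%:C%C)) : @Cn R n -> C^o) z.
  apply: H => j.
  have := @differentiableM C (@Cn R n) (fun x => x 0 (blk j (q j))) (cst ((p (blk j (q j)))%:C%C)^-1) z.
  by apply; [exact: differentiable_coord | exact: differentiable_cst].
have := @differentiableM C (@Cn R n) (cst ((-1) ^+ e q)) (fun x => \prod_(j < m) (x 0 (blk j (q j)) / (p (blk j (q j)))%:C%C)) z.
by apply; [exact: differentiable_cst | exact: dP].
Qed.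

Definition blk_index (q : {ffun 'I_m -> 'I_N}) : mindex :=
  fun k => (\sum_(j < m) (k == blk j (q j) :> nat))%N.

Lemma blk_index_le1 q k : (blk_index q k <= 1)%N.
Proof.
rewrite /blk_index; have [[j /eqP jk]|nj] := pselect (exists j : 'I_m, k == blk j (q j) :> nat).
  rewrite (bigD1 j)// -jk eqxx big1 ?addn0// => j' jj'.
  case: eqP => // E; move: jj'; rewrite /=; have /val_inj/blk_inj[-> _] : val (blk j (q j)) = val (blk j' (q j')).
    exact: etrans (esym jk) E.
  by rewrite eqxx.
rewrite big1// => j _; case: eqP => // E; case: nj; exists j; exact/eqP.
Qed.

Lemma blk_index_supp q : supp_le n (blk_index q).
Proof.
move=> k nk; rewrite /blk_index big1// => j _; case: eqP => // E.
by have := ltn_ord (blk j (q j)); rewrite -E ltnNge nk.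
Qed.

Lemma sum_blk_index q (F : 'I_n -> nat) : (\sum_(k < n) blk_index q k * F k = \sum_(j < m) F (blk j (q j)))%N.
Proof.
rewrite /blk_index; under eq_bigr do rewrite big_distrl.
rewrite exchange_big; apply: eq_bigr => j _ /=.
rewrite (bigD1 (blk j (q j)))// eqxx mul1n big1 => [|k kb]; first by rewrite /= addn0.
by rewrite -val_eqE in kb; rewrite (negbTE kb).
Qed.

Lemma blk_index_deg q : mdeg_is (blk_index q) m.
Proof.
exists n; split; first exact: blk_index_supp.
have := sum_blk_index q (fun=> 1%N); under eq_bigr do rewrite muln1.
by move=> ->; rewrite sum1_card card_ord.
Qed.

Lemma blk_index_LambdaT q : LambdaT (blk_index q).
Proof. by split; [exists n; exact: blk_index_supp | exact: blk_index_le1]. Qed.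

Lemma blk_index_inj : injective blk_index.
Proof.
move=> q q' E; apply/ffunP => j.
have : (0 < blk_index q' (blk j (q j)))%N.
  by rewrite -E /blk_index (bigD1 j)// eqxx.
rewrite /blk_index lt0n sum_nat_eq0 negb_forall => /existsP[j' /=].
rewrite eqb0 negbK => /eqP E'.
have B : blk j (q j) = blk j' (q' j') by exact: ord_inj.
by have [-> ->] := blk_inj B.
Qed.

Lemma monom_blk_index q (z : @Cn R n) : monom n z (blk_index q) = \prod_(j < m) z 0 (blk j (q j)).
Proof.
rewrite /monom /blk_index; under eq_bigr do rewrite -prodrXr.
rewrite exchange_big; apply: eq_bigr => j _ /=.
rewrite (bigD1 (blk j (q j)))// eqxx expr1 big1 => [|k kb]; first by rewrite /= mulr1.
by rewrite -val_eqE in kb; rewrite (negbTE kb) expr0.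
Qed.

Definition blk_coef q : C := (-1) ^+ e q * \prod_(j < m) ((p (blk j (q j)))%:C%C)^-1.

Lemma block_formE z : block_form z = \sum_q blk_coef q * monom n z (blk_index q).
Proof.
apply: eq_bigr => q _; rewrite monom_blk_index /blk_coef -mulrA; congr (_ * _).
by rewrite -big_split; apply: eq_bigr => j _ /=; rewrite mulrC.
Qed.

Definition blk_ffun K (q : {ffun 'I_m -> 'I_N}) : {ffun 'I_n -> 'I_K.+1} := [ffun k : 'I_n => inord (blk_index q k)].

Lemma mext_blk_ffun K q : (0 < K)%N -> mext (blk_ffun K q) = blk_index q.
Proof.
move=> K0; apply/funext => k; rewrite /mext; case: insubP => [i _ <-|] /=.
  by rewrite ffunE inordK// ltnS (leq_trans (blk_index_le1 _ _)).
by rewrite -leqNgt => /blk_index_supp ->.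
Qed.

(** The sum has at most one term. In this form it also covers the indices outside the form, where it
    is empty. *)
Lemma block_taylor K (a : {ffun 'I_n -> 'I_K.+1}) : (m <= K)%N -> (mdeg a <= K)%N ->
  taylor_coef n (mext a) block_form = \sum_(q | blk_ffun K q == a) blk_coef q.
Proof.
move=> mK aK; have K0 : (0 < K)%N by apply: leq_trans mK.
pose A (a : {ffun 'I_n -> 'I_K.+1}) := \sum_(q | blk_ffun K q == a) blk_coef q.
apply: (taylor_coef_unique XL (A := A) (m := m) block_form_hol (b := block_bound)) => //.
- by move=> z z1; apply: block_form_le; exact: ltW.
- move=> c cm; rewrite /A big_pred0// => q; apply/negP => /eqP qc; move: cm.
  have := blk_index_deg q; rewrite -(mext_blk_ffun q K0) => /mdeg_isE.
  by rewrite qc => ->; rewrite eqxx.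
move=> z; rewrite block_formE /tpoly /A.
under [RHS]eq_bigr do rewrite mulr_suml.
rewrite (partition_big (blk_ffun K) xpredT)//=; apply: eq_bigr => c _; apply: eq_bigr => q /eqP qc.
by rewrite -qc -(mext_blk_ffun q K0) mono_tpolyE.
Qed.

Lemma block_taylor_index q : taylor_coef n (blk_index q) block_form = blk_coef q.
Proof.
have mm : mdeg (blk_ffun m q) = m.
  by apply: mdeg_isE; rewrite mext_blk_ffun//; exact: blk_index_deg.
rewrite -(mext_blk_ffun q m0) block_taylor ?mm//.
rewrite (big_pred1 q)// => q'; apply/eqP/eqP => [E|->//].
by apply: blk_index_inj; rewrite -(mext_blk_ffun q m0) -(mext_blk_ffun q' m0) E.
Qed.

Lemma block_taylor_out (I : set mindex) a : (forall a, LambdaT a -> mdeg_is a m -> I a) ->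
  supp_le n a -> ~ I a -> taylor_coef n a block_form = 0.
Proof.
move=> HI an nI.
pose K := (m + \sum_(k < n) a k)%N.
pose c : {ffun 'I_n -> 'I_K.+1} := [ffun k : 'I_n => inord (a k)].
have aK (k : 'I_n) : (a k < K.+1)%N.
  by rewrite ltnS; apply: leq_trans (leq_addl _ _); rewrite (bigD1 k)//= leq_addr.
have cE : mext c = a.
  apply/funext => k; rewrite /mext; case: insubP => [i _ <-|] /=; first by rewrite ffunE inordK.
  by rewrite -leqNgt => /an ->.
rewrite -cE block_taylor ?leq_addr//; last first.
  apply: leq_trans (leq_addl _ _); rewrite leq_eqVlt; apply/orP; left; apply/eqP.
  by apply: eq_bigr => k _; rewrite ffunE inordK.
rewrite big_pred0// => q; apply/negP => /eqP qc; apply: nI.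
rewrite -cE -qc mext_blk_ffun; last exact: leq_trans m0 (leq_addr _ _).
by apply: HI; [exact: blk_index_LambdaT | exact: blk_index_deg].
Qed.

Lemma bohr_point_le (I : set mindex) (r : R) : (forall a, LambdaT a -> mdeg_is a m -> I a) ->
  0 < r ->
  (forall f : @Cn R n -> C^o,
      holomorphic_on n (Xball Xn n 1) f -> bounded_on n (Xball Xn n 1) f ->
      (forall a, supp_le n a -> ~ I a -> taylor_coef n a f = 0) ->
      (ereal_sup [set (\esum_(a in [set a | I a /\ supp_le n a])
                         (cabs (taylor_coef n a f * monom n z a))%:E)%E
                 | z in Xball Xn n r]
       <= ereal_sup [set (cabs (f z))%:E | z in Xball Xn n 1])%E) ->
  (N%:R * (r / (2 * Num.max M 1))) ^+ m <= block_bound.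
Proof.
move=> HI r0 H.
have M0 : 0 < Num.max M 1 by rewrite lt_max ltr01 orbT.
have := H block_form block_form_hol.
have bb : bounded_on n (Xball Xn n 1) block_form.
  by exists block_bound => z z1; apply: block_form_le; exact: ltW.
move=> /(_ bb (fun a => block_taylor_out HI)) hle.
have sup1 : (ereal_sup [set (cabs (block_form z))%:E | z in Xball Xn n 1] <= block_bound%:E)%E.
  apply: ge_ereal_sup => _ [z z1 <-]; rewrite lee_fin; apply: block_form_le; exact: ltW.
have {hle sup1} := le_trans hle sup1.
(* The factor 2 puts rho p strictly inside the open ball of radius r. At this point the weights
   cancel and each of the N^m terms has modulus rho^m. *)
pose rho := r / (2 * Num.max M 1).
have rho0 : 0 < rho by rewrite divr_gt0// mulr_gt0.
pose z : @Cn R n := rho%:C%C *: \row_k (p k)%:C%C.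
have zB : Xball Xn n r z.
  rewrite /Xball /= (Xn_normZ XL) cabs_real gtr0_norm//.
  apply: le_lt_trans (ler_wpM2l (ltW rho0) pM) _.
  rewrite /rho; have -> : r / (2 * Num.max M 1) * Num.max M 1 = r / 2 by field; rewrite gt_eqF.
  by rewrite ltr_pdivrMr// ltr_pMr// ltr1n.
set S := ereal_sup _ => hS.
have {hS} : (\esum_(a in [set a | I a /\ supp_le n a])
                         (cabs (taylor_coef n a block_form * monom n z a))%:E <= block_bound%:E)%E.
  by apply: le_trans hS; apply: ereal_sup_ubound; exists z.
rewrite -lee_fin; apply: le_trans; apply: esum_ge.
exists (blk_index @` [set: {ffun 'I_m -> 'I_N}]).
  split; first exact: finite_image.
  move=> _ [q _ <-]; split; last exact: blk_index_supp.
  by apply: HI; [exact: blk_index_LambdaT | exact: blk_index_deg].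
rewrite fsbig_image; last by move=> q q' _ _; exact: blk_index_inj.
rewrite (fsbigE (enum {ffun 'I_m -> 'I_N})) ?enum_uniq//; last by move=> q _; rewrite mem_enum.
have term q : cabs (taylor_coef n (blk_index q) block_form * monom n z (blk_index q)) = rho ^+ m.
  rewrite block_taylor_index monom_blk_index /blk_coef -mulrA -big_split /=.
  rewrite (eq_bigr (fun=> rho%:C%C)) => [|j _]; last first.
    rewrite !mxE mulrCA mulVf ?mulr1//.
    by rewrite -cabs_gt0 cabs_real normr_gt0 gt_eqF.
  rewrite prodr_const card_ord cabsM !cabsX cabs_real gtr0_norm//.
  by rewrite cabsN cabs1 expr1n mul1r.
rewrite (eq_bigr (fun=> (rho ^+ m)%:E)) => [|q _]; last by rewrite term.
rewrite sumEFin lee_fin big_enum_cond /= (eq_bigl xpredT) => [|q]; last first.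
  by rewrite in_setT.
rewrite sumr_const card_ffun !card_ord -(mulr_natr (rho ^+ m)) natrX exprMn mulrC.
exact: lexx.
Qed.

End UpperBound.

(** * Explicit constants in the upper bounds *)

Section NumericUpper.
Context {R : realType}.
Local Notation C := (R[i]).
Variables (Xs : set (nat -> C)) (Xn : (nat -> C) -> R).
Hypothesis XL : banach_seq_lattice Xs Xn.
Variable M : R.
Hypothesis cvxM : forall (N : nat) (x : 'I_N -> (nat -> C)), (forall j, Xs (x j)) ->
    Xn (fun k => ((Num.sqrt (\sum_(j < N) cabs (x j k) ^+ 2))%:C)%C)
      <= M * Num.sqrt (\sum_(j < N) Xn (x j) ^+ 2).

Lemma bohr_radius_le n (I : set mindex) (c : R) : 0 <= c ->
  (forall r, 0 < r < 1 ->
   (forall f : @Cn R n -> C^o,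
      holomorphic_on n (Xball Xn n 1) f -> bounded_on n (Xball Xn n 1) f ->
      (forall a, supp_le n a -> ~ I a -> taylor_coef n a f = 0) ->
      (ereal_sup [set (\esum_(a in [set a | I a /\ supp_le n a])
                         (cabs (taylor_coef n a f * monom n z a))%:E)%E
                 | z in Xball Xn n r]
       <= ereal_sup [set (cabs (f z))%:E | z in Xball Xn n 1])%E) -> r <= c) ->
  bohr_radius Xn n I <= c.
Proof.
move=> c0 H; rewrite /bohr_radius; set S := [set r | _].
have [[r Sr]|S0] := pselect (S !=set0); last first.
  (* The supremum of the empty set is 0 by convention, whence the assumption 0 <= c. *)
  have -> : S = set0 by apply/seteqP; split => // x Sx; case: S0; exists x.
  by rewrite sup0.
apply: ge_sup; first by exists r.
by move=> x [x01 Hx]; apply: H.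
Qed.

Lemma bohr_radius_le1 n (I : set mindex) : bohr_radius Xn n I <= 1.
Proof. by apply: bohr_radius_le => // r /andP[_ /ltW]. Qed.

Definition upper_const : R := 2 * Num.max M 1 * 8 ^+ 3.

Lemma max1_gt0 : 0 < Num.max M 1. Proof. by rewrite lt_max ltr01 orbT. Qed.

(** Here nu stands for n %/ m, x for m / (n + m) and y for 6 n / m. Squaring and cancelling nu^(m+1)
    leaves nu^(m-1) rho^(2m) <= (72^2 * 12)^m, and 1 <= 4 x nu trades nu^(m-1) for (4 x)^(m-1).
    Finally 4 * 72^2 * 12 <= 8^6. *)
Lemma upper_algebra (rho nu x rate y : R) (m : nat) : (0 < m)%N -> 0 <= rho -> 1 <= nu ->
  0 < x -> 0 <= rate -> 1 <= 4 * x * nu -> 0 <= y -> y <= 12 * nu ->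
  rate ^+ (2 * m) = x ^+ m.-1 ->
  (nu * rho) ^+ m <= 72 ^+ m * Num.sqrt nu * Num.sqrt (y ^+ m) ->
  rho <= 8 ^+ 3 * rate.
Proof.
move=> m0 rho0 nu1 x0 rate0 xnu y0 ynu rX h.
have nu0 : 0 < nu by lra.
have m2 : (0 < 2 * m)%N by rewrite muln_gt0.
rewrite -(@ler_pXn2r _ (2 * m)) ?nnegrE ?mulr_ge0 ?exprn_ge0//.
have h2 : (nu * rho) ^+ (2 * m) <= (72 ^+ 2 * y) ^+ m * nu.
  rewrite mulnC exprM; have -> : (72 ^+ 2 * y) ^+ m * nu = (72 ^+ m * Num.sqrt nu * Num.sqrt (y ^+ m)) ^+ 2.
    rewrite (exprMn 2 (72 ^+ m * Num.sqrt nu)) (exprMn 2 (72 ^+ m)) !sqr_sqrtr ?exprn_ge0//; last lra.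
    by rewrite (exprMn m) -!exprM mulnC; ring.
  apply: lerXn2r; rewrite ?nnegrE; last exact: h.
    by apply: exprn_ge0; apply: mulr_ge0 => //; exact: ltW.
  by rewrite !mulr_ge0 ?sqrtr_ge0 ?exprn_ge0.
have h3 : nu ^+ m.-1 * rho ^+ (2 * m) <= (72 ^+ 2 * 12) ^+ m.
  have p0 : 0 < nu ^+ m * nu by rewrite mulr_gt0// exprn_gt0.
  rewrite -(ler_pM2l p0).
  have -> : nu ^+ m * nu * (nu ^+ m.-1 * rho ^+ (2 * m)) = (nu * rho) ^+ (2 * m).
    rewrite exprMn mulrA; congr (_ * _); rewrite -mulrA -exprS prednK// -exprD.
    by rewrite mul2n -addnn.
  apply: (le_trans h2).
  have -> : nu ^+ m * nu * (72 ^+ 2 * 12) ^+ m = (72 ^+ 2 * (12 * nu)) ^+ m * nu.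
    by rewrite !(exprMn m); ring.
  apply: ler_wpM2r; first exact: ltW.
  apply: lerXn2r; rewrite ?nnegrE ?mulr_ge0 ?exprn_ge0//; first exact: ltW.
  by apply: ler_wpM2l => //; exact: exprn_ge0.
have h4 : 1 <= (4 * x * nu) ^+ m.-1 by rewrite exprn_ege1.
have r0 : 0 <= rho ^+ (2 * m) by rewrite exprn_ge0.
have h5 : rho ^+ (2 * m) <= (4 * x) ^+ m.-1 * (72 ^+ 2 * 12) ^+ m.
  apply: (@le_trans _ _ ((4 * x * nu) ^+ m.-1 * rho ^+ (2 * m))).
    by rewrite ler_peMl.
  rewrite (exprMn m.-1 (4 * x)) -mulrA; apply: ler_wpM2l => //.
  by rewrite exprn_ge0// mulr_ge0// ltW.
apply: (le_trans h5); rewrite (exprMn (2 * m) (8 ^+ 3)) rX (exprMn m.-1 4).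
rewrite mulrAC; apply: ler_wpM2r; first by apply: exprn_ge0; exact: ltW.
apply: (@le_trans _ _ (4 ^+ m * (72 ^+ 2 * 12) ^+ m)).
  apply: ler_wpM2r; first by rewrite exprn_ge0// mulr_ge0// exprn_ge0.
  by rewrite ler_weXn2l ?leq_pred// ler1n.
rewrite -(exprMn m) exprM; apply: lerXn2r; rewrite ?nnegrE.
- by rewrite !mulr_ge0 ?exprn_ge0.
- by rewrite !exprn_ge0.
have -> : 4 * (72 ^+ 2 * 12) = 64 ^+ 2 * 60 + 64 ^+ 2 * (3 / 4) :> R by field.
have -> : 8 ^+ 3 ^+ 2 = 64 ^+ 2 * 64 :> R by ring.
by have : 0 <= 64 ^+ 2 :> R by [exact: exprn_ge0]; lra.
Qed.

Lemma bohr_radius_upper n m (I : set mindex) : (0 < m)%N -> (m <= n)%N ->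
  (forall a, LambdaT a -> mdeg_is a m -> I a) ->
  bohr_radius Xn n I <= upper_const * powR (m%:R / (n + m)%:R) (m.-1%:R / (2 * m)%:R).
Proof.
move=> m0 mn HI; have M0 := max1_gt0.
have n0 : (0 < n)%N by apply: leq_trans mn.
have N0 : (0 < n %/ m)%N by rewrite divn_gt0.
have [p [p0 pM p_ell]] := ellipsoid_weights XL cvxM n0.
have [e eP] := @good_signs R m (n %/ m) m0 N0.
have rt0 := @rate_gt0 R n m m0; have rX := @rate_powX R n m m0.
set rate := powR _ _ in rt0 rX *.
apply: bohr_radius_le => [|r /andP[r0 _] Hr].
  by rewrite mulr_ge0 ?(ltW rt0)// mulr_ge0 ?exprn_ge0// mulr_ge0// ltW.
have key := bohr_point_le XL m0 p0 pM p_ell eP HI r0 Hr.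
have nR : 0 < n%:R :> R by rewrite ltr0n.
have mR : 0 < m%:R :> R by rewrite ltr0n.
have nmR : 0 < (n + m)%:R :> R by rewrite ltr0n addn_gt0 n0.
have n2 : (n <= 2 * ((n %/ m) * m))%N.
  rewrite {1}(divn_eq n m) mul2n -addnn leq_add2l; apply: leq_trans (ltnW (ltn_pmod n m0)) _.
  by rewrite leq_pmull.
have n2R : n%:R <= 2 * ((n %/ m)%:R * m%:R) :> R by rewrite -!natrM ler_nat.
have mnR : m%:R <= n%:R :> R by rewrite ler_nat.
have := upper_algebra (rho := r / (2 * Num.max M 1)) (nu := (n %/ m)%:R) (x := m%:R / (n + m)%:R)
  (rate := rate) (y := 6 * n%:R / m%:R) m0.
have h1 : 0 <= r / (2 * Num.max M 1) by rewrite divr_ge0 ?mulr_ge0// ltW.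
have h2 : 1 <= (n %/ m)%:R :> R by rewrite ler1n.
have h3 : 0 < m%:R / (n + m)%:R :> R by rewrite divr_gt0.
have h4 : 1 <= 4 * (m%:R / (n + m)%:R) * (n %/ m)%:R :> R.
  have -> : 4 * (m%:R / (n + m)%:R) * (n %/ m)%:R = 4 * ((n %/ m)%:R * m%:R) / (n + m)%:R :> R.
    by field; rewrite -natrD gt_eqF.
  rewrite ler_pdivlMr// mul1r natrD; lra.
have h5 : 0 <= 6 * n%:R / m%:R :> R by rewrite divr_ge0// mulr_ge0.
have h6 : 6 * n%:R / m%:R <= 12 * (n %/ m)%:R :> R.
  by rewrite ler_pdivrMr//; lra.
move=> /(_ h1 h2 h3 (ltW rt0) h4 h5 h6 rX key).
rewrite ler_pdivrMr ?mulr_gt0// => h; apply: (le_trans h).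
by rewrite /upper_const le_eqVlt; apply/orP; left; apply/eqP; ring.
Qed.

Lemma upper_const_ge : 2 <= upper_const.
Proof.
have h : 1 <= Num.max M 1 by rewrite le_max lexx orbT.
have h8 : 1 <= 8 ^+ 3 :> R by rewrite exprn_ege1// ler1n.
rewrite /upper_const; nra.
Qed.

(** For m > n there are too few variables for m blocks, but then the rate is at least 1/2 and the
    trivial bound 1 suffices. *)
Lemma bohr_radius_m_upper n m (J : set mindex) : LambdaT `<=` J -> (0 < m)%N -> (0 < n)%N ->
  bohr_radius_m Xn n J m <= upper_const * powR (m%:R / (n + m)%:R) (m.-1%:R / (2 * m)%:R).
Proof.
move=> LJ m0 n0; have [mn|nm] := leqP m n.
  by apply: bohr_radius_upper => // a aL am; split => //; exact: LJ.
apply: (le_trans (bohr_radius_le1 _ _)).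
have rt0 := @rate_gt0 R n m m0; have rX := @rate_powX R n m m0.
set rate := powR _ _ in rt0 rX *.
have rhalf : 1 / 2 <= rate.
  rewrite -(@ler_pXn2r _ (2 * m)) ?nnegrE ?muln_gt0// ?(ltW rt0)// rX.
  have xh : 1 / 2 <= m%:R / (n + m)%:R :> R.
    rewrite ler_pdivlMr ?ltr0n ?addn_gt0 ?m0 ?orbT// natrD.
    have : n%:R <= m%:R :> R by rewrite ler_nat ltnW.
    lra.
  apply: (@le_trans _ _ ((1 / 2) ^+ m.-1)).
    apply: ler_wiXn2l; [lra | lra | lia].
  by apply: lerXn2r; rewrite ?nnegrE// divr_ge0.
have := upper_const_ge; nra.
Qed.

(** In the 2m-th power the exponent m - 1 costs a factor (n + m) / m compared with m. This is at
    most 8^m because n < 2^(m+1), so it disappears in the root. *)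
Lemma rate_log_le n : (2 <= n)%N ->
  powR ((trunc_log 2 n)%:R / (n + trunc_log 2 n)%:R) ((trunc_log 2 n).-1%:R / (2 * trunc_log 2 n)%:R)
  <= Num.sqrt (8 / ln 2) * Num.sqrt (ln n%:R / n%:R) :> R.
Proof.
move=> n2; set m := trunc_log 2 n.
have m0 : (0 < m)%N by rewrite trunc_log_gt0; lia.
have n0 : (0 < n)%N by lia.
have /andP[m1 m2] := trunc_log_bounds (isT : (1 < 2)%N) n0; rewrite -/m in m1 m2.
have rt0 := @rate_gt0 R n m m0; have rX := @rate_powX R n m m0.
set rate := powR _ _ in rt0 rX *.
have l20 : 0 < ln 2 :> R by rewrite ln_gt0// ltr1n.
have nR : 0 < n%:R :> R by rewrite ltr0n.
have mR : 0 < m%:R :> R by rewrite ltr0n.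
have nmR : 0 < (n + m)%:R :> R by rewrite ltr0n addn_gt0 n0.
have lnn : 0 <= ln n%:R :> R by rewrite ln_ge0// ler1n.
rewrite -sqrtrM ?divr_ge0 ?(ltW l20)//.
set W := 8 / ln 2 * _.
have W0 : 0 <= W by rewrite mulr_ge0// divr_ge0// ltW.
rewrite -(@ler_pXn2r _ (2 * m)) ?nnegrE ?muln_gt0 ?sqrtr_ge0 ?(ltW rt0)//.
rewrite rX exprM sqr_sqrtr//.
have mln : m%:R * ln 2 <= ln n%:R :> R.
  have -> : m%:R * ln 2 = ln (2 ^+ m) :> R by rewrite lnXn// mulr_natl.
  by rewrite ler_ln ?posrE ?exprn_gt0// -natrX ler_nat.
have -> : (m%:R / (n + m)%:R) ^+ m.-1 = (m%:R / (n + m)%:R) ^+ m * ((n + m)%:R / m%:R) :> R.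
  rewrite -[X in _ = _ ^+ X * _](prednK m0) exprSr -mulrA.
  have -> : m%:R / (n + m)%:R * ((n + m)%:R / m%:R) = 1 :> R by rewrite mulrA divfK ?divff ?gt_eqF.
  by rewrite mulr1.
apply: (@le_trans _ _ ((ln n%:R / ln 2 / n%:R) ^+ m * 8 ^+ m)); last first.
  rewrite -exprMn le_eqVlt; apply/orP; left; apply/eqP; congr (_ ^+ _).
  by rewrite /W; field; rewrite !gt_eqF.
apply: ler_pM; [by apply: exprn_ge0; rewrite divr_ge0 | by rewrite divr_ge0 | |].
  apply: lerXn2r; rewrite ?nnegrE; [by rewrite divr_ge0 | by rewrite !divr_ge0// ltW|].
  apply: ler_pM => //; first by rewrite ler_pdivlMr.
  by rewrite lef_pV2 ?posrE// ler_nat leq_addr.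
rewrite ler_pdivrMr// -natrX -natrM ler_nat.
have -> : (8 ^ m = 2 ^ m * 2 ^ m * 2 ^ m)%N by rewrite -!expnMn.
have p2 : (2 <= 2 ^ m)%N by rewrite -{1}(expn1 2) leq_exp2l.
have mp : (m < 2 ^ m)%N by exact: ltn_expl.
rewrite expnS in m2; set t := (2 ^ m)%N in m1 m2 p2 mp *.
have : (n + m <= 4 * t)%N by lia.
move=> h; apply: (leq_trans h); apply: leq_trans (leq_pmulr _ m0).
by rewrite leq_mul2r (leq_mul p2 p2) orbT.
Qed.

Lemma bohr_radius_full_upper n (J : set mindex) : LambdaT `<=` J -> (2 <= n)%N ->
  bohr_radius Xn n J <= upper_const * Num.sqrt (8 / ln 2) * Num.sqrt (ln n%:R / n%:R).
Proof.
move=> LJ n2; have n0 : (0 < n)%N by lia.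
have m0 : (0 < trunc_log 2 n)%N by rewrite trunc_log_gt0; lia.
have mn : (trunc_log 2 n <= n)%N.
  apply: leq_trans (trunc_logP (isT : (1 < 2)%N) n0); exact/ltnW/ltn_expl.
apply: le_trans (bohr_radius_upper m0 mn (fun a aL _ => LJ a aL)) _.
rewrite -mulrA; apply: ler_wpM2l; last exact: rate_log_le.
by have := upper_const_ge; lra.
Qed.

End NumericUpper.

Theorem theorem2p33 (R : realType) (Xs : set (nat -> R[i])) (Xn : (nat -> R[i]) -> R) :
  banach_seq_lattice Xs Xn -> two_convex Xs Xn ->
  (exists c : R, 1 <= c /\
     forall J : set mindex, index_set J -> LambdaT `<=` J ->
     forall m n : nat, (0 < m)%N -> (0 < n)%N ->
       c^-1 * powR (m%:R / (n + m)%:R) (m.-1%:R / (2 * m)%:R)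
         <= bohr_radius_m Xn n J m /\
       bohr_radius_m Xn n J m
         <= c * powR (m%:R / (n + m)%:R) (m.-1%:R / (2 * m)%:R)) /\
  (exists c : R, 1 <= c /\
     forall J : set mindex, index_set J -> LambdaT `<=` J ->
     forall n : nat, (2 <= n)%N ->
       c^-1 * Num.sqrt (ln n%:R / n%:R) <= bohr_radius Xn n J /\
       bohr_radius Xn n J <= c * Num.sqrt (ln n%:R / n%:R)).
Proof.
move=> XL [M cvxM].
have K1 := @expR1_ge1 R; have U2 := upper_const_ge M.
split.
  exists (Num.max (upper_const M) (16 * expR 1)).
  set c := Num.max _ _.
  have c1 : upper_const M <= c by rewrite le_max lexx.
  have c2 : 16 * expR 1 <= c by rewrite le_max lexx orbT.
  split; first lra.
  move=> J _ LJ m n m0 n0; have r0 := @rate_gt0 R n m m0; split.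
    apply: le_trans (bohr_radius_m_lower XL J m0 n0).
    apply: ler_wpM2r; first exact: ltW.
    by rewrite lef_pV2 ?posrE; lra.
  apply: le_trans (bohr_radius_m_upper XL cvxM LJ m0 n0) _.
  by apply: ler_wpM2r => //; exact: ltW.
exists (Num.max (upper_const M * Num.sqrt (8 / ln 2)) (128 * expR 1)).
set c := Num.max _ _.
have c1 : upper_const M * Num.sqrt (8 / ln 2) <= c by rewrite le_max lexx.
have c2 : 128 * expR 1 <= c by rewrite le_max lexx orbT.
split; first lra.
move=> J _ LJ n n2; split.
  apply: le_trans (bohr_radius_lower XL J n2).
  apply: ler_wpM2r; first exact: sqrtr_ge0.
  by rewrite lef_pV2 ?posrE; lra.
apply: le_trans (bohr_radius_full_upper XL cvxM LJ n2) _.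
by apply: ler_wpM2r => //; exact: sqrtr_ge0.
Qed.
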